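(* For every matrix $A\in\mathbf{M}_n(\mathbb{C})$, one has $\mathrm{sing\,supp}(\mu_A)\subset\Sigma_A$.
   Context: $\mathbf{M}_n(\mathbb{C})$ is the space of complex $n\times n$ matrices; $\langle x,y\rangle=y^*x$ on $\mathbb{C}^n$, $\|x\|=\langle x,x\rangle^{1/2}$, and $\partial\mathbb{B}^n=\{x\in\mathbb{C}^n : \|x\|=1\}$, a real manifold of dimension $2n-1$. The numerical map is $\Phi_A:\partial\mathbb{B}^n\to\mathbb{C}\simeq\mathbb{R}^2$, $\Phi_A(x)=\langle Ax,x\rangle$. A point $x\in\partial\mathbb{B}^n$ is a critical point of $\Phi_A$ if the ($\mathbb{R}$-linear) differential of $\Phi_A$ at $x$ is not onto $\mathbb{C}$; $\Sigma_A\subset\mathbb{C}$ is the set of critical values of $\Phi_A$, i.e. the image under $\Phi_A$ of its set of critical points. The numerical measure $\mu_A$ is the Borel probability measure on $\mathbb{C}$ which is the image under $\Phi_A$ of the normalized (probability) Euclidean surface measure $\bar\sigma$ on $\partial\mathbb{B}^n$. The singular support of $\mu_A$ is the complement of the largest open subset of $\mathbb{C}$ on which $\mu_A$ has a $C^\infty$ density with respect to two-dimensional Lebesgue measure. *)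

(* Defs.v *)
From HB Require Import structures.
From mathcomp Require Import all_boot all_order all_algebra complex.
From mathcomp Require Import all_classical all_reals all_analysis.
Set Implicit Arguments.
Unset Strict Implicit.
Unset Printing Implicit Defensive.
Import Order.TTheory GRing.Theory Num.Theory numFieldNormedType.Exports.
Local Open Scope classical_set_scope.
Local Open Scope ring_scope.

Section numerical_map.
Variables (R : realType) (n : nat).
Implicit Types (x y : 'cV[R[i]]_n) (A : 'M[R[i]]_n) (u v : 'rV[R]_(n + n)).

Definition inner x y : R[i] := (map_mx Num.conj y^T *m x) 0 0.

Definition hnorm x : R := Num.sqrt (complex.Re (inner x x)).

Definition numerical_form A x : R[i] := inner (A *m x) x.

(* R[i] has no structure of normed module over R, so C^n is identified with
   R^2n by listing the n real parts and then the n imaginary parts, and C with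
   R * R; the norm of 'rV[R]_(n + n) is the sup norm, which only matters through
   its topology, the Euclidean norm being hnorm (cvec u). *)
Definition cvec u : 'cV[R[i]]_n :=
  \col_j Complex (u 0 (lshift n j)) (u 0 (rshift n j)).

Definition plane (z : R[i]) : R * R := (complex.Re z, complex.Im z).

Definition unit_sphere : set 'rV[R]_(n + n) := [set u | hnorm (cvec u) = 1].

(* The quadratic form is defined on the whole of R^2n; the numerical map is its
   restriction to the sphere. *)
Definition numerical_map A u : R * R := plane (numerical_form A (cvec u)).

Lemma differentiable_numerical_map A u : differentiable (numerical_map A) u.
Proof.
pose D (f : 'rV[R]_(n + n) -> R[i]) :=
  differentiable (@complex.Re R \o f) u /\ differentiable (@complex.Im R \o f) u.
have Dcst c : D (fun=> c) by split; exact: differentiable_cst.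
have DM f g : D f -> D g -> D (fun v => f v * g v).
  move=> [f1 f2] [g1 g2]; split.
    rewrite (_ : _ \o _ = (@complex.Re R \o f) * (@complex.Re R \o g)
                         - (@complex.Im R \o f) * (@complex.Im R \o g)).
      by apply: differentiableB; exact: differentiableM.
    by apply/funext => v; rewrite !fctE /=; case: (f v) (g v) => [a b] [c d].
  rewrite (_ : _ \o _ = (@complex.Re R \o f) * (@complex.Im R \o g)
                       + (@complex.Im R \o f) * (@complex.Re R \o g)).
    by apply: differentiableD; exact: differentiableM.
  by apply/funext => v; rewrite !fctE /=; case: (f v) (g v) => [a b] [c d].
have Dsum m (F : 'I_m -> 'rV[R]_(n + n) -> R[i]) :
    (forall i, D (F i)) -> D (fun v => \sum_(i < m) F i v).
  move=> DF; split.
    rewrite (_ : _ \o _ = \sum_(i < m) (@complex.Re R \o F i)).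
      by apply: differentiable_sum => i; have [] := DF i.
    apply/funext => v; rewrite fct_sumE /=.
    by apply: (big_morph (@complex.Re R)) => // -[a b] [c d].
  rewrite (_ : _ \o _ = \sum_(i < m) (@complex.Im R \o F i)).
    by apply: differentiable_sum => i; have [] := DF i.
  apply/funext => v; rewrite fct_sumE /=.
  by apply: (big_morph (@complex.Im R)) => // -[a b] [c d].
have Dcoord j : D (fun v => cvec v j 0).
  split.
    rewrite (_ : _ \o _ = (fun v : 'rV[R]_(n + n) => v 0 (lshift n j))).
      exact: differentiable_coord.
    by apply/funext => v /=; rewrite mxE.
  rewrite (_ : _ \o _ = (fun v : 'rV[R]_(n + n) => v 0 (rshift n j))).
    exact: differentiable_coord.
  by apply/funext => v /=; rewrite mxE.
have Dconj f : D f -> D (fun v => Num.conj (f v)).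
  move=> [f1 f2]; split.
    rewrite (_ : _ \o _ = @complex.Re R \o f) //.
    by apply/funext => v /=; case: (f v).
  rewrite (_ : _ \o _ = - (@complex.Im R \o f)); first exact: differentiableN.
  by apply/funext => v; rewrite -[RHS]/(- complex.Im (f v)) /=; case: (f v).
suff [Dre Dim] : D (fun v => numerical_form A (cvec v)).
  exact: (differentiable_pair Dre Dim).
rewrite (_ : (fun v => _) = (fun v => \sum_j Num.conj (cvec v j 0) *
    \sum_k A j k * cvec v k 0)); last first.
  apply/funext => v; rewrite /numerical_form /inner mxE.
  by apply: eq_bigr => j _; rewrite mxE [X in _ * X]mxE mxE.
apply: (Dsum) => j; apply: (DM); first exact/Dconj.
by apply: Dsum => k; apply: DM.
Qed.

Definition tangent u : set 'rV[R]_(n + n) :=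
  [set v | complex.Re (inner (cvec v) (cvec u)) = 0].

(* The differential at u of the restriction to the sphere is the restriction of
   the ambient differential to the tangent space at u. *)
Definition critical_point A u : Prop :=
  unit_sphere u /\ ~ ('d (numerical_map A) u @` tangent u = [set: R * R]).

Definition critical_values A : set (R * R) :=
  numerical_map A @` [set u | critical_point A u].

End numerical_map.

Section cons_measure.
Context d (T : measurableType d) (R : realType) (m : nat).
Variables (mu1 : {sigma_finite_measure set T -> \bar R})
  (mu : {sigma_finite_measure set (m.-tuple T) -> \bar R}).

Let cons_pair (p : T * m.-tuple T) : m.+1.-tuple T := [tuple of p.1 :: p.2].

Let measurable_cons_pair : measurable_fun [set: T * m.-tuple T] cons_pair.
Proof. exact: measurable_cons. Qed.

Definition cons_measure : set (m.+1.-tuple T) -> \bar R :=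
  pushforward (mu1 \x mu)%E (fun p => [tuple of p.1 :: p.2]).

Let cons_measure0 : cons_measure set0 = 0%E.
Proof. by apply: measure0; exact: measurable_cons_pair. Qed.

Let cons_measure_ge0 A : (0 <= cons_measure A)%E.
Proof. by apply: measure_ge0; exact: measurable_cons_pair. Qed.

Let cons_measure_sigma_additive : semi_sigma_additive cons_measure.
Proof.
by apply: measure_semi_sigma_additive; exact: measurable_cons_pair.
Qed.

HB.instance Definition _ := isMeasure.Build _ _ _ cons_measure
  cons_measure0 cons_measure_ge0 cons_measure_sigma_additive.

Let cons_measure_sigma_finite : sigma_finite setT cons_measure.
Proof.
have /sigma_finiteP[F [FT ndF Foo]] := sigma_finiteT mu1.
have /sigma_finiteP[G [GT ndG Goo]] := sigma_finiteT mu.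
pose g (t : m.+1.-tuple T) : T * m.-tuple T :=
  (tnth t ord0, [tuple of behead t]).
have mg : measurable_fun setT g.
  apply: measurable_fun_pair; first exact: measurable_tnth.
  exact: measurable_behead.
exists (fun i => g @^-1` (F i `*` G i)).
  rewrite -preimage_bigcup; apply/esym/seteqP; split=> // t _.
  have [k _ Fk] : (\bigcup_i F i) (g t).1 by rewrite -FT.
  have [l _ Gl] : (\bigcup_i G i) (g t).2 by rewrite -GT.
  exists (maxn k l) => //; split.
    by move: (g t).1 Fk; exact/subsetPset/ndF/leq_maxl.
  by move: (g t).2 Gl; exact/subsetPset/ndG/leq_maxr.
move=> i; have [mF Fi] := Foo i; have [mG Gi] := Goo i; split.
  by rewrite -[X in measurable X]setTI; apply: mg => //; exact: measurableX.
rewrite /cons_measure /pushforward -comp_preimage.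
rewrite (_ : g \o _ = id); last first.
  by apply/funext => -[x t]; congr pair; apply/val_inj.
by rewrite preimage_id product_measure1E// lte_mul_pinfty// ge0_fin_numE.
Qed.

HB.instance Definition _ := Measure_isSigmaFinite.Build _ _ _ cons_measure
  cons_measure_sigma_finite.

End cons_measure.

Fixpoint power_measure d (T : measurableType d) (R : realType)
    (mu : {sigma_finite_measure set T -> \bar R}) m :
    {sigma_finite_measure set (m.-tuple T) -> \bar R} :=
  if m is m'.+1 then cons_measure mu (power_measure mu m')
  else dirac [tuple].

Definition lebesgue_rV (R : realType) m : set 'rV[R]_m -> \bar R :=
  fun E => power_measure lebesgue_measure m [set t | E (\row_i tnth t i)].

Section numerical_measure.
Variables (R : realType) (n : nat).
Implicit Types (E : set 'rV[R]_(n + n)) (A : 'M[R[i]]_n).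

Definition cone E : set 'rV[R]_(n + n) :=
  [set u | 0 < hnorm (cvec u) <= 1 /\ E ((hnorm (cvec u))^-1 *: u)].

(* The Euclidean surface measure of the sphere of R^d, here with d = 2n, given
   by polar coordinates: the surface measure of E is d times the Lebesgue measure
   of the part of the unit ball that projects radially to E. *)
Definition surface_measure E : \bar R :=
  ((n + n)%:R%:E * lebesgue_rV (cone E))%E.

Definition sphere_probability E : \bar R :=
  (surface_measure E * (fine (surface_measure (@unit_sphere R n)))^-1%:E)%E.

Definition numerical_measure A (B : set (R * R)) : \bar R :=
  sphere_probability (@unit_sphere R n `&` numerical_map A @^-1` B).

End numerical_measure.

Section singular_support.
Variable R : realType.

Definition iter_derive (V W : normedModType R) (f : V -> W) (s : seq V) :=
  foldr (fun v g => 'D_v g) f s.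

(* All the iterated directional derivatives of f exist and are continuous on U;
   for U open in a finite dimensional space this is f being C^oo on U. *)
Definition smooth_on (V W : normedModType R) (U : set V) (f : V -> W) :=
  forall (s : seq V) x, U x ->
    {for x, continuous (iter_derive f s)} /\
    forall v, derivable (iter_derive f s) x v.

Definition has_smooth_density (mu : set (R * R) -> \bar R) (U : set (R * R)) :=
  exists2 f : R * R -> R, smooth_on U f &
    forall B : set (measurableTypeR R * measurableTypeR R),
      measurable B -> B `<=` U ->
      mu B = (\int[@lebesgue_measure R \x @lebesgue_measure R]_(z in B) (f z)%:E)%E.

(* Smooth densities on open sets glue, so the largest open set carrying one is
   the union of all of them. *)
Definition sing_supp (mu : set (R * R) -> \bar R) : set (R * R) :=
  ~` \bigcup_(U in [set U | open U /\ has_smooth_density mu U]) U.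

End singular_support.

(* Main.v *)
(* Let Psi be the numerical map extended to the punctured unit ball by homogeneity of
   degree 0; in polar coordinates the numerical measure is a multiple of the image
   under Psi of Lebesgue measure on that ball. Near a value z that is not critical, the
   tangential gradients of the two components of Psi are independent, and the
   tangential fields dual to them give, by the divergence theorem, first order
   operators T_1, T_2 with int (d_b g)(Psi) w = int g(Psi) T_b w for every weight w
   supported near the fibre of z. Applied repeatedly to the truncated powers
   g(s, t) = (s - x)_+^a (t - y)_+^b, this writes the mass of a quadrant, its mixed
   derivative and all further derivatives as integrals of truncated powers of high
   order, whose regularity in (x, y) is plain. No change of variables and no implicit
   function theorem is needed. Taking w = 1 near the fibre of z gives the density. *)
Require Import Defs.
From HB Require Import structures.
From mathcomp Require Import all_boot all_order all_algebra complex.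
From mathcomp Require Import all_classical all_reals all_analysis.
From mathcomp Require Import measurable_realfun ring lra.
Set Implicit Arguments.
Unset Strict Implicit.
Unset Printing Implicit Defensive.
Import Order.TTheory GRing.Theory Num.Theory numFieldNormedType.Exports.
Local Open Scope classical_set_scope.
Local Open Scope ring_scope.

(** * Smooth step functions *)

(** Two classes closed under differentiation carry the argument. Functions of degree 0 are
    polynomials in the ratios u_i u_j / |u|^2 ([ratio_poly]), stable under the fields u_j d/du_i;
    weights form a module over them, generated by derivatives of a cutoff times powers of 1 /
    [gram_det]. The operators T_b never leave the weights, and all the calculus is along single
    coordinates. The obstacle is that [gram_det] may vanish away from the fibre of z. Compactness of
    the sphere gives [kappa] with [gram_det] + [dist2] >= [kappa], so closeness to z forces
    [gram_det] >= [kappa] / 2 and the cutoff kills every zero outside the origin. Moving the corner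
    of a potential lowers the order of a truncated power by one; transport raises it again at the
    price of a new weight. Potentials of order (2, 2) are thus stable under all directional
    derivatives, 2 being the least order at which a truncated power has a quadratic Taylor
    remainder. The jump of an indicator is never differentiated: identities proved at high order
    descend by difference quotients. *)

Section real_derivatives.
Context {R : realType}.
Implicit Types (f g : R -> R) (x : R).

Lemma deriv1_near f g x (d : R) : (\near x, f x = g x) ->
  is_derive x 1 f d -> is_derive x 1 g d.
Proof. exact: (@near_eq_is_derive R R R). Qed.

Lemma deriv1_eq f x (d d' : R) : is_derive x 1 f d -> d = d' -> is_derive x 1 f d'.
Proof. by move=> + <-. Qed.

Lemma deriv1D f g x (df dg : R) : is_derive x 1 f df -> is_derive x 1 g dg ->
  is_derive x 1 (fun y => f y + g y) (df + dg).
Proof. by move=> ? ?; exact: (@is_deriveD R R R f g). Qed.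

Lemma deriv1M f g x (df dg : R) : is_derive x 1 f df -> is_derive x 1 g dg ->
  is_derive x 1 (fun y => f y * g y) (df * g x + f x * dg).
Proof.
move=> df' dg'; have h := @is_deriveM R R f g x 1 df dg df' dg'.
apply: (@is_derive_eq _ _ _ _ _ _ _ _ h).
by rewrite addrC /GRing.scale/= mulrC.
Qed.

Lemma deriv1V f x (df : R) : f x != 0 -> is_derive x 1 f df ->
  is_derive x 1 (fun y => (f y)^-1) (- (df * (f x)^-1 ^+ 2)).
Proof.
move=> f0 df'; have h := @is_deriveV R f x df 1 f0 df'.
apply: (@is_derive_eq _ _ _ _ _ _ _ _ h).
by rewrite /GRing.scale/= mulNr mulrC exprVn.
Qed.

Lemma deriv1X f n x (df : R) : is_derive x 1 f df ->
  is_derive x 1 (fun y => f y ^+ n) (n%:R * f x ^+ n.-1 * df).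
Proof.
move=> d; rewrite (_ : (fun y => _) = f ^+ n); first exact: (@is_deriveX R R f).
by apply/funext => y; rewrite exprfctE.
Qed.

Lemma deriv1_comp f g x (df dg : R) :
  is_derive (g x) 1 f df -> is_derive x 1 g dg ->
  is_derive x 1 (fun y => f (g y)) (df * dg).
Proof. by move=> ? ?; exact: (@is_derive1_comp R f g). Qed.

Lemma deriv1_continuous f x (d : R) : is_derive x 1 f d -> {for x, continuous f}.
Proof.
by move=> ?; apply: differentiable_continuous; apply/derivable1_diffP; exact: ex_derive.
Qed.

Lemma deriv1_cst (c : R) x : is_derive x 1 (fun=> c) (0 : R).
Proof. exact: is_derive_cst. Qed.

Lemma deriv1_id x : is_derive x 1 (fun y : R => y) (1 : R).
Proof. exact: is_derive_id. Qed.

Lemma deriv1_sum (I : Type) (r : seq I) (F : I -> R -> R) (d : I -> R) x :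
  (forall i, is_derive x 1 (F i) (d i)) ->
  is_derive x 1 (fun y => \sum_(i <- r) F i y) (\sum_(i <- r) d i).
Proof.
move=> Fd; elim: r => [|i r IH].
  rewrite big_nil (_ : (fun y => _) = fun=> 0); first exact: deriv1_cst.
  by apply/funext => y; rewrite big_nil.
rewrite big_cons (_ : (fun y => _) = fun y => F i y + \sum_(j <- r) F j y).
  exact: deriv1D.
by apply/funext => y; rewrite big_cons.
Qed.

Lemma continuous1M f g : continuous f -> continuous g -> continuous (fun x => f x * g x).
Proof. by move=> cf cg x; exact: (@continuousM R R f g x (cf x) (cg x)). Qed.

Lemma continuous1D f g : continuous f -> continuous g -> continuous (fun x => f x + g x).
Proof. by move=> cf cg x; exact: (@continuousD R R R f g x (cf x) (cg x)). Qed.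

Lemma continuous1_cst (c : R) : continuous (fun _ : R => c).
Proof. exact: cst_continuous. Qed.

End real_derivatives.

(** A quadratic remainder bound at the single point [a] replaces any regularity nearby. It serves
    for [flat_exp] at the origin, for truncated powers, under the integral sign for potentials, and
    for quadratic forms. *)
Lemma is_derive_quadratic (R : realType) (V : normedModType R) (f : V -> R)
    (a v : V) (d C : R) :
  (forall h, `|h| <= 1 -> `|f (h *: v + a) - f a - h * d| <= C * h ^+ 2) ->
  is_derive a v f d.
Proof.
move=> H.
have fd : h^-1 *: (f (h *: v + a) - f a) @[h --> 0^'] --> d.
  apply/cvgrPdist_le => e e0.
  have C1 : 0 < `|C| + 1 by rewrite ltr_wpDl.
  near=> h.
  have h0 : h != 0 by near: h; exact: nbhs_dnbhs_neq.
  have h1 : `|h| <= 1.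
    near: h; apply: dnbhs0_le; exact: ltr01.
  have h2 : `|h| <= e / (`|C| + 1).
    near: h; apply: dnbhs0_le; exact: divr_gt0.
  rewrite -(ler_pM2l (x := `|h|)) ?normr_gt0// -normrM.
  rewrite mulrBr /GRing.scale/= [X in `|_ - X|]mulrA divff// mul1r distrC.
  apply: le_trans (H h h1) _.
  rewrite -real_normK ?num_real// expr2 mulrCA ler_wpM2l//.
  apply: le_trans (_ : (`|C| + 1) * `|h| <= _).
    by rewrite ler_wpM2r// (le_trans (ler_norm _))// lerDl.
  by rewrite mulrC -ler_pdivlMr.
split; first by apply/cvg_ex; exists d.
exact: cvg_lim fd.
Unshelve. all: by end_near.
Qed.

Section flat_functions.
Context {R : realType}.
Implicit Types (x : R) (m k : nat).

(** The factor x^(-m) makes the linear span of this family stable under differentiation. *)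
Definition flat_exp m x : R := if 0 < x then expR (- x^-1) * x^-1 ^+ m else 0.

Lemma flat_exp_ge0 m x : 0 <= flat_exp m x.
Proof.
rewrite /flat_exp; case: ifP => // x0.
by rewrite mulr_ge0 ?expR_ge0// exprn_ge0// invr_ge0 ltW.
Qed.

Lemma flat_exp_gt0 m x : 0 < x -> 0 < flat_exp m x.
Proof.
by move=> x0; rewrite /flat_exp x0 mulr_gt0 ?expR_gt0// exprn_gt0// invr_gt0.
Qed.

(** With y = 1/x, the exponential series gives e^y >= y^(m+k+1) / (m+k+1)!. The case k = 1 is the
    quadratic flatness at 0 used for the derivative there. *)
Lemma flat_exp_le m k x : 0 < x -> flat_exp m x <= (m + k).+1`!%:R * x ^+ k.+1.
Proof.
move=> x0; rewrite /flat_exp x0.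
have y0 : 0 <= x^-1 by rewrite invr_ge0 ltW.
have := expR_ge1Dxn (m + k) y0 => h.
have {}h : x^-1 ^+ (m + k).+1 / (m + k).+1`!%:R <= expR x^-1.
  by apply: le_trans h; rewrite lerDr.
have f0 : 0 < (m + k).+1`!%:R :> R by rewrite ltr0n fact_gt0.
rewrite expRN mulrC ler_pdivrMr ?expR_gt0//.
rewrite ler_pdivrMr// in h.
rewrite (_ : x^-1 ^+ m = x ^+ k.+1 * x^-1 ^+ (m + k).+1); last first.
  by rewrite -addnS addnC exprD mulrA -exprMn divff ?gt_eqF// expr1n mul1r.
rewrite mulrAC [leRHS]mulrC ler_wpM2l//.
  by rewrite exprn_ge0// ltW.
by rewrite mulrC.
Qed.

Lemma flat_exp_bounded m : exists C : R, forall x, `|flat_exp m x| <= C.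
Proof.
exists ((m.+1)`!%:R + m`!%:R) => x; rewrite ger0_norm ?flat_exp_ge0//.
case: (ltP 0 x) => x0; last by rewrite /flat_exp ltNge x0/= addr_ge0.
rewrite /flat_exp x0 expRN mulrC ler_pdivrMr ?expR_gt0//.
have y0 : 0 <= x^-1 by rewrite invr_ge0 ltW.
case: m => [|m].
  have : 1 <= expR x^-1 by rewrite -expR0 ler_expR.
  rewrite expr0 -[1`!]/1%N -[0`!]/1%N; lra.
have f0 : 0 < m.+1`!%:R :> R by rewrite ltr0n fact_gt0.
have := expR_ge1Dxn m y0 => h.
apply: le_trans (_ : m.+1`!%:R * expR x^-1 <= _); last first.
  by rewrite ler_wpM2r ?expR_ge0// lerDr.
rewrite mulrC -ler_pdivrMr//.
by apply: le_trans h; rewrite lerDr.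
Qed.

Lemma is_derive_flat_exp m x :
  is_derive x 1 (flat_exp m) (flat_exp m.+2 x - m%:R * flat_exp m.+1 x).
Proof.
case: (ltgtP x 0) => x0.
- rewrite {2 3}/flat_exp ltNge ltW//= mulr0 subr0.
  apply: (@deriv1_near _ (cst 0)) (deriv1_cst _ _).
  near=> y; rewrite /flat_exp /cst ifF//; apply/negbTE; rewrite -leNgt ltW//.
  by near: y; exact: lt_nbhsl.
- have x1 : x != 0 by rewrite gt_eqF.
  apply: (@deriv1_near _ (fun y => expR (- y^-1) * y^-1 ^+ m)).
    near=> y; rewrite /flat_exp ifT//.
    by near: y; exact: lt_nbhsr.
  have dV := deriv1V x1 (deriv1_id x).
  have dN := deriv1M (deriv1_cst (-1) x) dV.
  have dE := deriv1_comp (is_derive_expR _) dN.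
  have := deriv1M dE (deriv1X m dV).
  rewrite (_ : (fun y => _) = fun y => expR (- y^-1) * y^-1 ^+ m); last first.
    by apply/funext => y; rewrite mulN1r.
  move=> /deriv1_eq; apply; rewrite /flat_exp x0 mulN1r; clear.
  case: m => [|m]; first by rewrite expr0 !mul0r; ring.
  rewrite -[m.+1.-1]/m !exprS; ring.
- rewrite x0 {2 3}/flat_exp ltxx mulr0 subr0.
  apply: (@is_derive_quadratic _ _ _ _ _ _ (m + 1).+1`!%:R) => h h1.
  rewrite addr0 mulr0 subr0 {2}/flat_exp ltxx subr0 [h *: _]mulr1.
  case: (ltP 0 h) => h0; last by rewrite /flat_exp ltNge h0/= normr0 mulr_ge0// sqr_ge0.
  by rewrite ger0_norm ?flat_exp_ge0//; exact: flat_exp_le.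
Unshelve. all: by end_near.
Qed.

(** Denominator of the classical step f(x) / (f(x) + f(1 - x)) with f(x) = exp(-1/x). One of x and 1
    - x is at least 1/2, whence the lower bound exp(-2). *)
Let denom x := flat_exp 0 x + flat_exp 0 (1 - x).

Let denom_ge x : expR (- 2) <= denom x.
Proof.
have H (y : R) : 2^-1 <= y -> expR (-2) <= flat_exp 0 y.
  move=> y2; have y0 : 0 < y by apply: lt_le_trans y2; rewrite invr_gt0.
  by rewrite /flat_exp y0 expr0 mulr1 ler_expR lerN2 invf_ple ?posrE.
rewrite /denom; case: (leP 2^-1 x) => x2.
  by rewrite -[leLHS]addr0 lerD ?H ?flat_exp_ge0.
rewrite -[leLHS]add0r lerD ?flat_exp_ge0// H//.
by rewrite lerBrDr -lerBrDl (le_trans (ltW x2))//; lra.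
Qed.

(** An algebra of bounded functions stable under differentiation: the derivatives of the step of
    every order, and their bounds, come from inductions over the constructors. *)
Inductive smooth_step_class : (R -> R) -> Prop :=
| ssc_flat m : smooth_step_class (flat_exp m)
| ssc_flip m : smooth_step_class (fun x => flat_exp m (1 - x))
| ssc_denom : smooth_step_class (fun x => (denom x)^-1)
| ssc_cst c : smooth_step_class (fun=> c)
| ssc_add f g : smooth_step_class f -> smooth_step_class g ->
    smooth_step_class (fun x => f x + g x)
| ssc_mul f g : smooth_step_class f -> smooth_step_class g ->
    smooth_step_class (fun x => f x * g x).

Let ssc_bounded f : smooth_step_class f -> exists C : R, forall x, `|f x| <= C.
Proof.
elim=> [m|m||c|{}f g _ [C fC] _ [D gD]|{}f g _ [C fC] _ [D gD]].
- exact: flat_exp_bounded.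
- by have [C H] := flat_exp_bounded m; exists C.
- exists (expR (-2))^-1 => x.
  have d0 := lt_le_trans (expR_gt0 (-2)) (denom_ge x).
  rewrite ger0_norm; last by rewrite invr_ge0 ltW.
  by rewrite lef_pV2 ?posrE ?expR_gt0.
- by exists `|c|.
- by exists (C + D) => x; rewrite (le_trans (ler_normD _ _))// lerD.
- by exists (C * D) => x; rewrite normrM ler_pM.
Qed.

Let is_derive_flip m x : is_derive x 1 (fun x => flat_exp m (1 - x))
  (-1 * (flat_exp m.+2 (1 - x) - m%:R * flat_exp m.+1 (1 - x))).
Proof.
have d := deriv1D (deriv1_cst 1 x) (deriv1M (deriv1_cst (-1) x) (deriv1_id x)).
rewrite (_ : (fun y => _) = fun y => 1 - y) in d; last first.
  by apply/funext => y; rewrite mulN1r.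
have h := @deriv1_comp _ (flat_exp m) (fun y => 1 - y) x _ _ (is_derive_flat_exp m (1 - x)) d.
by apply: (deriv1_eq h); ring.
Qed.

Let ssc_derive f : smooth_step_class f ->
  exists2 g, smooth_step_class g & forall x, is_derive x 1 f (g x).
Proof.
have cflat m : smooth_step_class (fun x => flat_exp m.+2 x - m%:R * flat_exp m.+1 x).
  rewrite (_ : (fun x => _) = fun x => flat_exp m.+2 x + (- m%:R) * flat_exp m.+1 x).
    apply: ssc_add; first exact: ssc_flat.
    apply: ssc_mul; [exact: ssc_cst|exact: ssc_flat].
  by apply/funext => x; rewrite mulNr.
have cflip m : smooth_step_class (fun x => -1 *
    (flat_exp m.+2 (1 - x) - m%:R * flat_exp m.+1 (1 - x))).
  apply: ssc_mul; first exact: ssc_cst.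
  rewrite (_ : (fun x => _) = fun x => flat_exp m.+2 (1 - x) +
      (- m%:R) * flat_exp m.+1 (1 - x)).
    apply: ssc_add; first exact: ssc_flip.
    apply: ssc_mul; [exact: ssc_cst|exact: ssc_flip].
  by apply/funext => x; rewrite mulNr.
elim=> [m|m||c|{}f g _ [f' cf df] _ [g' cg dg]|{}f g sf [f' cf df] sg [g' cg dg]].
- by eexists; [exact: cflat|exact: is_derive_flat_exp].
- by eexists; [exact: cflip|exact: is_derive_flip].
- eexists; last first.
    move=> x; have d0 := lt_le_trans (expR_gt0 (-2)) (denom_ge x).
    have d0' : denom x != 0 by rewrite gt_eqF.
    apply: (deriv1V d0').
    exact: (deriv1D (is_derive_flat_exp 0 x) (is_derive_flip 0 x)).
  rewrite (_ : (fun x => _) = (fun x => (-1 * ((denom x)^-1 * (denom x)^-1)) *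
    ((flat_exp 2 x - 0 * flat_exp 1 x) +
     (-1 * (flat_exp 2 (1 - x) - 0 * flat_exp 1 (1 - x)))))); last first.
    by apply/funext => x; set y := (denom x)^-1; ring.
  apply: ssc_mul.
    apply: ssc_mul; first exact: ssc_cst.
    by apply: ssc_mul; exact: ssc_denom.
  by apply: ssc_add; [exact: cflat|exact: cflip].
- by exists (fun=> 0); [exact: ssc_cst|exact: deriv1_cst].
- by exists (fun x => f' x + g' x); [exact: ssc_add|move=> x; exact: deriv1D].
- exists (fun x => f' x * g x + f x * g' x); last by move=> x; exact: deriv1M.
  by apply: ssc_add; exact: ssc_mul.
Qed.

Lemma smooth_step_exists : exists th : nat -> R -> R,
  [/\ forall k x, is_derive x 1 (th k) (th k.+1 x),
      forall k x, x <= 0 -> th k x = 0,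
      forall x, 1 <= x -> th 0 x = 1,
      forall x, 0 <= th 0 x &
      forall k, exists C : R, forall x, `|th k x| <= C].
Proof.
pose th0 x := flat_exp 0 x * (denom x)^-1.
have c0 : smooth_step_class th0.
  by apply: ssc_mul; [exact: ssc_flat|exact: ssc_denom].
(* [F] picks a derivative inside the class; iterating it from [th0] makes [th k] the derivative of
   order k. *)
have /choice[F HF] (u : {f | smooth_step_class f}) :
    exists v : {f | smooth_step_class f}, forall x, is_derive x 1 (sval u) (sval v x).
  case: u => f cf /=; have [g cg dg] := ssc_derive cf.
  by exists (exist _ g cg).
pose th k := sval (iter k F (exist _ th0 c0)).
have dth k x : is_derive x 1 (th k) (th k.+1 x) by exact: HF.
exists th; split => //.
- have cth k : continuous (th k).
    by move=> x; exact: deriv1_continuous (dth k x).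
  have thneg k x : x < 0 -> th k x = 0.
    elim: k x => [|k IH] x x0.
      by rewrite /th/= /th0 /flat_exp ltNge ltW//= mul0r.
    have [_ <-] := dth k x.
    rewrite (@near_eq_derive R R R _ (cst 0)) ?derive_cst//.
    near=> y; rewrite IH//.
    by near: y; exact: lt_nbhsl.
  (* At 0 itself no neighbourhood of zeros is available; continuity and the left limit give the
     value. *)
  move=> k x; rewrite le_eqVlt => /orP[/eqP ->|]; last exact: thneg.
  have H1 : th k y @[y --> 0^'-] --> th k 0.
    by apply: cvg_at_left_filter; exact: cth.
  have H2 : th k y @[y --> 0^'-] --> (0 : R).
    apply: cvg_near_cst; near=> y; apply: thneg.
    by near: y; exact: nbhs_left_lt.
  by have := cvg_unique _ H1 H2; apply.
- move=> x x1; rewrite /th/= /th0 /denom.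
  rewrite [X in _ + X]/flat_exp ltNge subr_le0 x1/= addr0 divff// gt_eqF//.
  by apply: flat_exp_gt0; apply: lt_le_trans x1.
- move=> x; rewrite /th/= /th0 mulr_ge0 ?flat_exp_ge0// invr_ge0.
  exact: ltW (lt_le_trans (expR_gt0 _) (denom_ge x)).
- by move=> k; apply: ssc_bounded; exact: proj2_sig.
Unshelve. all: by end_near.
Qed.

End flat_functions.

(** * Integration by parts on tuples *)

Section tuple_integration_by_parts.
Context {R : realType}.

Notation leb := (@lebesgue_measure R).
Notation RT m := (m.-tuple (measurableTypeR R)).
Notation pm m := (power_measure leb m).

Definition coord m (i : 'I_m) (t : RT m) : R := tnth t i.

(** Partial derivatives are ordinary derivatives of x |-> f ([upd i x t]), so tuples need no normed
    structure. *)
Definition upd m (i : 'I_m) (x : R) (t : RT m) : RT m :=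
  [tuple if j == i then (x : measurableTypeR R) else tnth t j | j < m].

Definition box m (M : R) : set (RT m) :=
  [set t | forall i, `|coord i t| <= M].

Lemma coord_upd m (i j : 'I_m) x (t : RT m) :
  coord j (upd i x t) = if j == i then x else coord j t.
Proof. by rewrite /coord tnth_mktuple. Qed.

Lemma upd_coord m (i : 'I_m) (t : RT m) : upd i (coord i t) t = t.
Proof. by apply: eq_from_tnth => j; rewrite tnth_mktuple; case: eqP => [->|]. Qed.

Lemma measurable_coord m (i : 'I_m) : measurable_fun setT (coord i).
Proof. exact: measurable_tnth. Qed.

Lemma measurable_box m M : measurable (@box m M).
Proof.
rewrite (_ : box M = \bigcap_(i in [set: 'I_m]) [set t | `|coord i t| <= M]).
  apply: fin_bigcap_measurable; first exact: finite_finset.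
  move=> i _.
  have mc : measurable_fun setT (fun t : RT m => `|coord i t|).
    by apply: measurableT_comp => //; exact: measurable_coord.
  have := mc measurableT _ (measurable_itv `]-oo, M]).
  by rewrite setTI.
by apply/seteqP; split => t /= H i; [move=> _|]; exact: H.
Qed.

Let consRT m (p : measurableTypeR R * RT m) : RT m.+1 := [tuple of p.1 :: p.2].

Let measurable_consRT m : measurable_fun setT (@consRT m).
Proof. exact: measurable_cons. Qed.

Let coord_cons0 m p : coord ord0 (@consRT m p) = p.1.
Proof. by []. Qed.

Let coord_consS m p (j : 'I_m) : coord (lift ord0 j) (consRT p) = coord j p.2.
Proof. by rewrite /coord /consRT tnthS. Qed.

Let upd_cons0 m x (p : measurableTypeR R * RT m) :
  upd ord0 x (consRT p) = consRT ((x : measurableTypeR R), p.2).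
Proof.
apply: eq_from_tnth => j; rewrite tnth_mktuple.
case: (unliftP ord0 j) => [k|] -> //=.
by rewrite /consRT !tnthS.
Qed.

Let upd_consS m (i : 'I_m) x p : upd (lift ord0 i) x (consRT p) = consRT (p.1, upd i x p.2).
Proof.
apply: eq_from_tnth => j; rewrite tnth_mktuple.
case: (unliftP ord0 j) => [k|] -> //=.
by rewrite /consRT !tnthS/= (inj_eq lift_inj) tnth_mktuple.
Qed.

Let box_cons m M : @consRT m @^-1` @box m.+1 M = `[- M, M]%classic `*` @box m M.
Proof.
apply/seteqP; split => [p /= H|p /= [H1 H2] i].
  split; first by have := H ord0; rewrite in_itv/= -ler_norml coord_cons0.
  by move=> i; have := H (lift ord0 i); rewrite coord_consS.
case: (unliftP ord0 i) => [k|] ->; first by rewrite coord_consS.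
by rewrite coord_cons0 ler_norml; move: H1; rewrite in_itv.
Qed.

Lemma box_lty m M : (pm m (@box m M) < +oo)%E.
Proof.
elim: m => [|m IH]; first by rewrite /= diracE ltry.
rewrite /= /cons_measure /pushforward [X in (_ X < _)%E](box_cons m M).
rewrite product_measure1E//=; last exact: measurable_box.
apply: lte_mul_pinfty => //.
rewrite lebesgue_measure_itv; case: ifP => _; rewrite ?fin_num_fun//.
Qed.

Lemma box_integrable m (h : RT m -> R) (M C : R) : measurable_fun setT h ->
  (forall t, `|h t| <= C) -> (forall t, h t != 0 -> box M t) ->
  (pm m).-integrable setT (EFin \o h).
Proof.
move=> mh hC hM.
have : (pm m).-integrable (box M) (EFin \o h).
  apply: measurable_bounded_integrable.
  - exact: measurable_box.
  - exact: box_lty.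
  - exact: measurable_funTS.
  - exists C; split; first by rewrite num_real.
    by move=> x Cx t _; exact: le_trans (hC t) (ltW Cx).
move/(integrable_mkcond _ (measurable_box M)).
apply: eq_integrable => // t _.
rewrite patchE; case: ifPn => // /negP tM /=; congr EFin.
by apply/esym/eqP; apply: contraPT tM => /hM H; rewrite inE.
Qed.

(* Fubini reduces the statement to the fundamental theorem of calculus along the
   lines of direction i. *)
Lemma integral_coord_derivative m (i : 'I_m) (h h' : RT m -> R) (M C : R) :
  measurable_fun setT h' -> (forall t, `|h' t| <= C) ->
  (forall t, h t != 0 \/ h' t != 0 -> box M t) ->
  (forall t, is_derive (coord i t) 1 (fun x => h (upd i x t)) (h' t)) ->
  (forall t, {for coord i t, continuous (fun x => h' (upd i x t))}) ->
  (\int[pm m]_t (h' t)%:E = 0)%E.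
Proof.
elim: m i h h' => [[]//|m IH] i h h' mh hC hM dh ch.
have ih : (pm m.+1).-integrable setT (EFin \o h').
  by apply: (@box_integrable _ _ M C) => // t th; apply: hM; right.
have mE := (measurable_EFinP _ _).2 mh.
have ip : (leb \x pm m)%E.-integrable setT ((EFin \o h') \o @consRT m).
  have mEc := measurableT_comp mE (@measurable_consRT m).
  apply/integrableP; split => //.
  move/integrableP : ih => [_]; apply: le_lt_trans.
  rewrite /= /cons_measure ge0_integral_pushforward//.
    exact: measurable_consRT.
  by apply/measurable_EFinP; apply: measurableT_comp.
rewrite /= /cons_measure integral_pushforward//; last exact: measurable_consRT.
rewrite preimage_setT.
(* If i lies in the tail, the tail is integrated first and the induction hypothesis makes that
   integral 0; if i is the head, the head is integrated first and the fundamental theorem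
   applies. *)
case: (unliftP ord0 i) => [j ij|i0].
- rewrite -integral12_prod_meas1//=.
  apply: integral0_eq => x _.
  apply: (IH j (fun t => h (consRT (x, t)))).
  + apply: measurableT_comp => //.
    by apply: (measurableT_comp (@measurable_consRT m)).
  + by move=> t; exact: hC.
  + move=> t H; have := hM (consRT (x, t)) H => Hb k.
    by have := Hb (lift ord0 k); rewrite coord_consS.
  + move=> t; have := dh (consRT (x, t)); rewrite ij coord_consS/=.
    congr (is_derive _ _ _ _); apply/funext => y.
    by rewrite upd_consS.
  + move=> t; have := ch (consRT (x, t)).
    rewrite (_ : (fun y : R => h' (upd i y _)) = fun y => h' (consRT (x, upd j y t))).
      by rewrite ij coord_consS.
    by apply/funext => y; rewrite ij upd_consS.
- rewrite -integral21_prod_meas1//=.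
  apply: integral0_eq => t _.
  pose g (x : R) := h (consRT ((x : measurableTypeR R), t)).
  pose g' (x : R) := h' (consRT ((x : measurableTypeR R), t)).
  have dg (x : R) : is_derive x 1 g (g' x).
    have := dh (consRT ((x : measurableTypeR R), t)); rewrite i0 coord_cons0/=.
    by congr (is_derive _ _ _ _); apply/funext => y; rewrite upd_cons0.
  have cg (x : R) : {for x, continuous g'}.
    have := ch (consRT ((x : measurableTypeR R), t)).
    rewrite (_ : (fun y : R => h' (upd i y _)) = g'); first by rewrite i0 coord_cons0.
    by apply/funext => y; rewrite i0 upd_cons0.
  (* Strictly beyond M, so that [g] vanishes at both ends; the absolute value covers negative M. *)
  pose N : R := `|M| + 1.
  have N0 : - N < N by rewrite /N; have := normr_ge0 M; lra.
  have gN (x : R) : M < `|x| -> g x = 0 /\ g' x = 0.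
    move=> Mx; split; apply/eqP; apply: contraPT Mx => H; apply/negP; rewrite -leNgt.
      by have := hM (consRT ((x : measurableTypeR R), t)) (or_introl H) ord0.
    by have := hM (consRT ((x : measurableTypeR R), t)) (or_intror H) ord0.
  have MN : M < N by rewrite /N ltr_pwDr// ler_norm.
  have N00 : 0 <= N by rewrite /N addr_ge0.
  rewrite -[LHS]/(\int[leb]_x (g' x)%:E)%E.
  transitivity (\int[leb]_(x in `[(- N)%R, N]) (g' x)%:E)%E.
    rewrite [RHS]integral_mkcond; apply: eq_integral => x _.
    rewrite patchE; case: ifPn => // /negP xN.
    congr EFin; apply: (gN x _).2; rewrite ltNge; apply/negP => xM.
    apply: xN; rewrite inE/= in_itv/= -ler_norml.
    by apply: le_trans xM (ltW MN).
  rewrite (@continuous_FTC2 _ g' g)//.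
  + by rewrite (gN N _).1 ?(gN (- N) _).1 ?subee// ?normrN ger0_norm.
  + by apply: continuous_in_subspaceT => x _; exact: cg.
  + split.
    * by move=> x _; exact: ex_derive.
    * by apply: cvg_at_right_filter; exact: deriv1_continuous (dg _).
    * by apply: cvg_at_left_filter; exact: deriv1_continuous (dg _).
  + by move=> x _; rewrite derive1E; case: (dg x).
Qed.

End tuple_integration_by_parts.

(** * Functions homogeneous of degree 0 *)

Section line_derivatives.
Context {R : realType} {N : nat}.

Notation T := (N.-tuple (measurableTypeR R)).
Implicit Types (f g : T -> R) (t : T) (i j k l : 'I_N).

Definition line_derive i f t (d : R) :=
  is_derive (coord i t) 1 (fun x : R => f (upd i x t)) d.

Definition line_continuous i f t :=
  {for coord i t, continuous (fun x : R => f (upd i x t))}.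

Definition bounded_fct f := exists C : R, forall t, `|f t| <= C.

Lemma line_derive_eq i f t (d d' : R) : line_derive i f t d -> d = d' -> line_derive i f t d'.
Proof. by move=> + <-. Qed.

Lemma line_deriveD i f g t (df dg : R) : line_derive i f t df -> line_derive i g t dg ->
  line_derive i (fun t => f t + g t) t (df + dg).
Proof. exact: deriv1D. Qed.

Lemma line_deriveM i f g t (df dg : R) : line_derive i f t df -> line_derive i g t dg ->
  line_derive i (fun t => f t * g t) t (df * g t + f t * dg).
Proof. by move=> hf hg; have := deriv1M hf hg; rewrite upd_coord. Qed.

Lemma line_derive_comp i (phi : R -> R) f t (df dphi : R) :
  is_derive (f t) 1 phi dphi -> line_derive i f t df ->
  line_derive i (fun t => phi (f t)) t (dphi * df).
Proof.
move=> hp hf; apply: (@deriv1_comp _ phi (fun x => f (upd i x t))) => //.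
by rewrite upd_coord.
Qed.

Lemma line_deriveV i f t (df : R) : f t != 0 -> line_derive i f t df ->
  line_derive i (fun t => (f t)^-1) t (- (df * (f t)^-1 ^+ 2)).
Proof.
move=> f0 hf; have := @deriv1V _ (fun x => f (upd i x t)) (coord i t) df.
by rewrite upd_coord; apply.
Qed.

Lemma line_derive_cst i (c : R) t : line_derive i (fun=> c) t 0.
Proof. exact: deriv1_cst. Qed.

Lemma line_derive_sum i (I : Type) (r : seq I) (F : I -> T -> R) (d : I -> R) t :
  (forall n, line_derive i (F n) t (d n)) ->
  line_derive i (fun t => \sum_(n <- r) F n t) t (\sum_(n <- r) d n).
Proof. by move=> h; exact: deriv1_sum. Qed.

Lemma line_derive_coord i k t : line_derive i (coord k) t (k == i)%:R.
Proof.
rewrite /line_derive (_ : (fun x => _) = fun x => if k == i then x else coord k t).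
  by case: eqP => _; [exact: deriv1_id|exact: deriv1_cst].
by apply/funext => x; rewrite coord_upd.
Qed.

Lemma line_derive_near0 i f t :
  (\forall x \near coord i t, f (upd i x t) = 0) -> line_derive i f t 0.
Proof.
move=> h; apply: deriv1_near (deriv1_cst 0 (coord i t)).
by apply: filterS h => x ->.
Qed.

Lemma line_derive_continuous i f t (d : R) : line_derive i f t d -> line_continuous i f t.
Proof. exact: deriv1_continuous. Qed.

Lemma line_continuousM i f g t : line_continuous i f t -> line_continuous i g t ->
  line_continuous i (fun t => f t * g t) t.
Proof.
move=> cf cg.
by apply: (@continuousM _ _ (fun x => f (upd i x t)) (fun x => g (upd i x t))).
Qed.

Lemma line_continuousD i f g t : line_continuous i f t -> line_continuous i g t ->
  line_continuous i (fun t => f t + g t) t.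
Proof.
move=> cf cg.
by apply: (@continuousD _ _ _ (fun x => f (upd i x t)) (fun x => g (upd i x t))).
Qed.

Lemma line_continuous_comp i (phi : R -> R) f t : continuous phi ->
  line_continuous i f t -> line_continuous i (fun t => phi (f t)) t.
Proof.
move=> cp cf; apply: (@continuous_comp _ _ _ (fun x => f (upd i x t)) phi) => //.
exact: cp.
Qed.

Lemma line_continuous_near i f t c : line_continuous i f t -> f t < c ->
  \forall x \near coord i t, f (upd i x t) < c.
Proof.
move=> cf fc; have : f (upd i (coord i t) t) < c by rewrite upd_coord.
by move=> h; exact: cf _ (lt_nbhsl h).
Qed.

Lemma bounded_fctM f g : bounded_fct f -> bounded_fct g -> bounded_fct (fun t => f t * g t).
Proof. by move=> [C fC] [D gD]; exists (C * D) => t; rewrite normrM ler_pM. Qed.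

Lemma bounded_fctD f g : bounded_fct f -> bounded_fct g -> bounded_fct (fun t => f t + g t).
Proof.
by move=> [C fC] [D gD]; exists (C + D) => t; rewrite (le_trans (ler_normD _ _))// lerD.
Qed.

Lemma bounded_fct_cst (c : R) : bounded_fct (fun=> c).
Proof. by exists `|c|. Qed.

Lemma bounded_fct_comp (phi : R -> R) f : continuous phi -> bounded_fct f ->
  bounded_fct (fun t => phi (f t)).
Proof.
move=> cp [C fC].
have [C0|C0] := ltP C 0.
  by exists 0 => t; have := le_lt_trans (fC t) C0; rewrite normr_lt0.
have CC : - C <= C by lra.
have cn : {within `[- C, C], continuous (fun x => `|phi x|)}.
  apply: continuous_subspaceT => x; apply: continuous_comp; first exact: cp.
  exact: norm_continuous.
have [c _ hc] := EVT_max CC cn.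
by exists `|phi c| => t; apply: hc; rewrite in_itv/= -ler_norml.
Qed.

Definition sqn t : R := \sum_i coord i t ^+ 2.

Lemma sqn_ge0 t : 0 <= sqn t.
Proof. by apply: sumr_ge0 => i _; exact: sqr_ge0. Qed.

Lemma coord_sqn i t : coord i t ^+ 2 <= sqn t.
Proof. by rewrite /sqn (bigD1 i)//= lerDl sumr_ge0// => j _; exact: sqr_ge0. Qed.

Lemma sqn_eq0 t i : sqn t = 0 -> coord i t = 0.
Proof.
move=> s0; have := coord_sqn i t; rewrite s0 => h.
by apply/eqP; rewrite -sqrf_eq0 eq_le h sqr_ge0.
Qed.

Lemma line_derive_sqn i t : line_derive i sqn t (2 * coord i t).
Proof.
rewrite /sqn; apply: line_derive_eq.
  apply: line_derive_sum => n.
  have h := line_deriveM (line_derive_coord i n t) (line_derive_coord i n t).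
  exact: h.
rewrite (bigD1 i)//= big1 => [|j /negPf ->].
  have -> : (i == i)%:R = 1 :> R by rewrite eqxx.
  by ring.
by rewrite mul0r mulr0 addr0.
Qed.

(* The division by 0 makes it vanish at the origin. *)
Definition ratio i j t : R := coord i t * coord j t / sqn t.

Lemma ratioC i j t : ratio i j t = ratio j i t.
Proof. by rewrite /ratio mulrC [coord i t * _]mulrC [LHS]mulrC. Qed.

Lemma sqn_ratio i j t : sqn t * ratio i j t = coord i t * coord j t.
Proof.
rewrite /ratio; have [s0|s0] := eqVneq (sqn t) 0.
  by rewrite (sqn_eq0 i s0) !mul0r mulr0.
by rewrite mulrCA divff// mulr1.
Qed.

Lemma ratio_bounded i j : bounded_fct (ratio i j).
Proof.
exists 1 => t; rewrite /ratio.
have [s0|s0] := eqVneq (sqn t) 0; first by rewrite s0 invr0 mulr0 normr0.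
have sp : 0 < sqn t by rewrite lt_def s0 sqn_ge0.
rewrite normrM normfV (ger0_norm (ltW sp)) ler_pdivrMr// mul1r.
have h1 := coord_sqn i t; have h2 := coord_sqn j t.
have : `|coord i t * coord j t| ^+ 2 <= sqn t ^+ 2.
  by rewrite real_normK ?num_real// exprMn [leRHS]expr2 ler_pM ?sqr_ge0.
by rewrite ler_pXn2r ?nnegrE ?sqn_ge0.
Qed.

(** Writing 1/x as x * (x^2)^-1 reduces to the inverse of a nonnegative real, which is a real power;
    the identity also holds at 0, where both sides are 0. *)
Lemma measurable_invr : measurable_fun setT (fun x : R => x^-1).
Proof.
rewrite (_ : (fun x => _) = fun x => x * (x ^+ 2) `^ (-1)); last first.
  apply/funext => x; rewrite powR_inv1 ?sqr_ge0//.
  have [->|x0] := eqVneq x 0; first by rewrite mul0r invr0.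
  by rewrite expr2 invfM mulrA divff// mul1r.
apply: measurable_funM => //.
by apply: (@measurableT_comp _ _ _ _ _ _ (fun y : R => y `^ (-1))).
Qed.

Lemma measurable_sqn : measurable_fun setT sqn.
Proof.
apply: measurable_sum => i; apply: measurable_funX; exact: measurable_coord.
Qed.

Lemma measurable_ratio i j : measurable_fun setT (ratio i j).
Proof.
apply: measurable_funM; first by apply: measurable_funM; exact: measurable_coord.
apply: (@measurableT_comp _ _ _ _ _ _ (fun y : R => y^-1)).
  exact: measurable_invr.
exact: measurable_sqn.
Qed.

(** An algebra of functions of degree 0. Boundedness, measurability and stability under the fields
    u_j d/du_i are checked on the generators only. *)
Inductive ratio_poly : (T -> R) -> Prop :=
| ratio_poly_gen i j : ratio_poly (ratio i j)
| ratio_poly_cst c : ratio_poly (fun=> c)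
| ratio_polyD f g : ratio_poly f -> ratio_poly g -> ratio_poly (fun t => f t + g t)
| ratio_polyM f g : ratio_poly f -> ratio_poly g -> ratio_poly (fun t => f t * g t).

Lemma ratio_poly_sum (I : Type) (r : seq I) (F : I -> T -> R) :
  (forall n, ratio_poly (F n)) -> ratio_poly (fun t => \sum_(n <- r) F n t).
Proof.
move=> h; elim: r => [|n r IH].
  rewrite (_ : (fun t => _) = fun=> 0); first exact: ratio_poly_cst.
  by apply/funext => t; rewrite big_nil.
rewrite (_ : (fun t => _) = fun t => F n t + \sum_(n <- r) F n t).
  exact: ratio_polyD.
by apply/funext => t; rewrite big_cons.
Qed.

Lemma ratio_polyN f : ratio_poly f -> ratio_poly (fun t => - f t).
Proof.
move=> h; rewrite (_ : (fun t => _) = fun t => (-1) * f t).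
  by apply: ratio_polyM => //; exact: ratio_poly_cst.
by apply/funext => t; rewrite mulN1r.
Qed.

Lemma ratio_poly_bounded f : ratio_poly f -> bounded_fct f.
Proof.
elim=> *; [exact: ratio_bounded|exact: bounded_fct_cst|exact: bounded_fctD|exact: bounded_fctM].
Qed.

Lemma ratio_poly_measurable f : ratio_poly f -> measurable_fun setT f.
Proof.
elim=> *; [exact: measurable_ratio|exact: measurable_cst
  |exact: measurable_funD|exact: measurable_funM].
Qed.

(* [Lfield i j f g]: away from 0, g is the derivative of f along the linear
   vector field u_j d/du_i; these fields preserve homogeneity of degree 0. *)
Definition Lfield i j f g := forall t, sqn t != 0 ->
  exists2 d, line_derive i f t d & coord j t * d = g t.

Lemma LfieldD i j f g f' g' : Lfield i j f f' -> Lfield i j g g' ->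
  Lfield i j (fun t => f t + g t) (fun t => f' t + g' t).
Proof.
move=> hf hg t t0; have [d fd <-] := hf t t0; have [d' gd <-] := hg t t0.
by exists (d + d'); [exact: line_deriveD|rewrite mulrDr].
Qed.

Lemma LfieldM i j f g f' g' : Lfield i j f f' -> Lfield i j g g' ->
  Lfield i j (fun t => f t * g t) (fun t => f' t * g t + f t * g' t).
Proof.
move=> hf hg t t0; have [d fd <-] := hf t t0; have [d' gd <-] := hg t t0.
by eexists; [exact: line_deriveM fd gd|ring].
Qed.

Lemma Lfield_ratio i j k l : Lfield i j (ratio k l)
  (fun t => (k == i)%:R * ratio j l t + (l == i)%:R * ratio k j t
     - 2 * ratio k l t * ratio i j t).
Proof.
move=> t s0; eexists.
  apply: (line_deriveM (line_deriveM (line_derive_coord i k t) (line_derive_coord i l t))).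
  exact: line_deriveV (line_derive_sqn i t).
rewrite /ratio; set s := (sqn t)^-1; ring.
Qed.

Lemma ratio_poly_Lfield f : ratio_poly f -> forall i j,
  exists2 g, ratio_poly g & Lfield i j f g.
Proof.
move=> rf i j.
elim: rf => [k l|c|{}f g _ [f' rf lf] _ [g' rg lg]|{}f g rf [f' rf' lf] rg [g' rg' lg]].
- eexists; last exact: Lfield_ratio.
  apply: ratio_polyD.
    apply: ratio_polyD; (apply: ratio_polyM; [exact: ratio_poly_cst|exact: ratio_poly_gen]).
  apply: ratio_polyN; apply: ratio_polyM; last exact: ratio_poly_gen.
  by apply: ratio_polyM; [exact: ratio_poly_cst|exact: ratio_poly_gen].
- exists (fun=> 0); first exact: ratio_poly_cst.
  by move=> t _; exists 0; [exact: line_derive_cst|rewrite mulr0].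
- by exists (fun t => f' t + g' t); [exact: ratio_polyD|exact: LfieldD].
- exists (fun t => f' t * g t + f t * g' t); last exact: LfieldM.
  by apply: ratio_polyD; exact: ratio_polyM.
Qed.

Lemma Lfield_continuous i j f g t : Lfield i j f g -> sqn t != 0 -> line_continuous i f t.
Proof. by move=> h t0; have [d /line_derive_continuous] := h t t0. Qed.

Lemma ratio_poly_continuous f i t : ratio_poly f -> sqn t != 0 -> line_continuous i f t.
Proof. by move=> /(ratio_poly_Lfield)/(_ i i)[g _ h] t0; exact: Lfield_continuous h t0. Qed.

End line_derivatives.

(** * Weights and the fields dual to the gradients *)

Section weights.
Context {R : realType} {N : nat}.

Notation T := (N.-tuple (measurableTypeR R)).
Implicit Types (f g u : T -> R) (t : T) (i j k : 'I_N) (b c : bool).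

Variables (H : bool -> 'I_N -> 'I_N -> R).

Definition rayleigh b t : R := \sum_i \sum_j H b i j * ratio i j t.

(* |u|^2 times the gradient of the Rayleigh quotient is the field with components
   [grad_field b i]; its coefficients in the coordinates are [grad_coef b i j]. *)
Definition grad_coef b i j t : R := 2 * H b i j + (- 2 * (i == j)%:R) * rayleigh b t.

Definition grad_field b i t : R := \sum_j grad_coef b i j t * coord j t.

(** The Gram matrix of the gradients of the two Rayleigh quotients, multiplied by |u|^2 to reach
    degree 0 and expanded in ratios so as to be a [ratio_poly]. *)
Definition gram b c t : R :=
  \sum_i \sum_j \sum_k grad_coef b i j t * grad_coef c i k t * ratio j k t.

Definition gram_det t : R :=
  gram false false t * gram true true t - gram false true t * gram false true t.

(* Coefficients of the tangential field dual to the two gradients (Cramer). *)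
Definition dual_coef b i j t : R :=
  gram (~~ b) (~~ b) t * grad_coef b i j t - gram false true t * grad_coef (~~ b) i j t.

(** The derivative of [rayleigh b] along u_j d/du_i, in a form that is visibly a [ratio_poly]. *)
Definition Lrayleigh b i j t : R := \sum_k grad_coef b i k t * ratio k j t.

Lemma rayleigh_poly b : ratio_poly (rayleigh b).
Proof.
apply: ratio_poly_sum => i; apply: ratio_poly_sum => j.
by apply: ratio_polyM; [exact: ratio_poly_cst|exact: ratio_poly_gen].
Qed.

Lemma grad_coef_poly b i j : ratio_poly (grad_coef b i j).
Proof.
apply: ratio_polyD; first exact: ratio_poly_cst.
by apply: ratio_polyM; [exact: ratio_poly_cst|exact: rayleigh_poly].
Qed.

Lemma gram_poly b c : ratio_poly (gram b c).
Proof.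
apply: ratio_poly_sum => i; apply: ratio_poly_sum => j; apply: ratio_poly_sum => k.
by apply: ratio_polyM; [apply: ratio_polyM; exact: grad_coef_poly|exact: ratio_poly_gen].
Qed.

Lemma gram_det_poly : ratio_poly gram_det.
Proof.
by apply: ratio_polyD; [|apply: ratio_polyN]; apply: ratio_polyM; exact: gram_poly.
Qed.

Lemma dual_coef_poly b i j : ratio_poly (dual_coef b i j).
Proof.
apply: ratio_polyD; [|apply: ratio_polyN]; apply: ratio_polyM.
all: by [exact: gram_poly|exact: grad_coef_poly].
Qed.

Lemma Lrayleigh_poly b i j : ratio_poly (Lrayleigh b i j).
Proof.
apply: ratio_poly_sum => k.
by apply: ratio_polyM; [exact: grad_coef_poly|exact: ratio_poly_gen].
Qed.

Lemma gramC b c t : gram b c t = gram c b t.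
Proof.
rewrite /gram; apply: eq_bigr => i _; rewrite exchange_big; apply: eq_bigr => j _ /=.
by apply: eq_bigr => k _; rewrite [ratio k j t]ratioC; ring.
Qed.

Lemma gram_grad_field b c t :
  sqn t * gram b c t = \sum_i grad_field b i t * grad_field c i t.
Proof.
rewrite /gram mulr_sumr; apply: eq_bigr => i _.
rewrite mulr_sumr /grad_field mulr_suml; apply: eq_bigr => j _.
rewrite mulr_sumr mulr_sumr; apply: eq_bigr => k _.
rewrite mulrCA sqn_ratio; ring.
Qed.

Lemma sum_grad_Lrayleigh b c t :
  \sum_i \sum_j grad_coef b i j t * Lrayleigh c i j t = gram b c t.
Proof.
apply: eq_bigr => i _; apply: eq_bigr => j _.
rewrite /Lrayleigh mulr_sumr; apply: eq_bigr => k _.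
by rewrite [ratio k j t]ratioC; ring.
Qed.

(** Cramer's rule: [dual_coef] applies the adjugate of the Gram matrix to the two gradients, and
    adjugate times matrix is the determinant times the identity. *)
Lemma sum_dual_Lrayleigh b c t :
  \sum_i \sum_j dual_coef b i j t * Lrayleigh c i j t = (b == c)%:R * gram_det t.
Proof.
transitivity (gram (~~ b) (~~ b) t * gram b c t - gram false true t * gram (~~ b) c t).
  rewrite -(sum_grad_Lrayleigh b c) -(sum_grad_Lrayleigh (~~ b) c) !mulr_sumr -sumrB.
  apply: eq_bigr => i _.
  rewrite !mulr_sumr -sumrB; apply: eq_bigr => j _; rewrite /dual_coef.
  by ring.
rewrite /gram_det; case: b c => -[] /=; rewrite ?(gramC true false); ring.
Qed.

Lemma sum_ratio_diag t : sqn t != 0 -> \sum_i ratio i i t = 1.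
Proof.
move=> t0; rewrite /ratio -mulr_suml.
by rewrite (_ : \sum_i _ = sqn t) ?divff.
Qed.

Lemma sum2_linear (p K : R) (X Y : 'I_N -> 'I_N -> R) :
  \sum_i \sum_j (p * X i j + K * Y i j) =
  p * (\sum_i \sum_j X i j) + K * \sum_i \sum_j Y i j.
Proof.
rewrite 2!mulr_sumr -big_split; apply: eq_bigr => i _ /=.
by rewrite 2!mulr_sumr -big_split.
Qed.

(** Euler's identity: the gradient of a function of degree 0 is orthogonal to u. *)
Lemma sum_grad_ratio b t : \sum_i \sum_j grad_coef b i j t * ratio i j t = 0.
Proof.
have [s0|s0] := eqVneq (sqn t) 0.
  by rewrite big1// => i _; rewrite big1// => j _; rewrite /ratio s0 invr0 !mulr0.
transitivity (2 * (\sum_i \sum_j H b i j * ratio i j t)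
    + (- 2 * rayleigh b t) * \sum_i \sum_j (i == j)%:R * ratio i j t).
  rewrite -sum2_linear; apply: eq_bigr => i _; apply: eq_bigr => j _.
  by rewrite /grad_coef; ring.
rewrite (_ : \sum_i \sum_j (i == j)%:R * ratio i j t = 1).
  by rewrite -/(rayleigh b t); ring.
transitivity (\sum_i ratio i i t); last exact: sum_ratio_diag.
apply: eq_bigr => i _.
rewrite (bigD1 i)//= eqxx mul1r big1 ?addr0// => j.
by rewrite eq_sym => /negPf ->; rewrite mul0r.
Qed.

(** The field with components sum_j [dual_coef b i j] u_j is a combination of the two gradients,
    hence tangent to the spheres. *)
Lemma sum_dual_ratio b t : \sum_i \sum_j dual_coef b i j t * ratio i j t = 0.
Proof.
transitivity (gram (~~ b) (~~ b) t * (\sum_i \sum_j grad_coef b i j t * ratio i j t)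
   - gram false true t * (\sum_i \sum_j grad_coef (~~ b) i j t * ratio i j t)).
  rewrite !mulr_sumr -sumrB; apply: eq_bigr => i _.
  rewrite !mulr_sumr -sumrB; apply: eq_bigr => j _; rewrite /dual_coef.
  by ring.
by rewrite !sum_grad_ratio !mulr0 subrr.
Qed.

Hypothesis Hsym : forall b i j, H b i j = H b j i.

Lemma line_derive_rayleigh b i t : sqn t != 0 ->
  line_derive i (rayleigh b) t (grad_field b i t / sqn t).
Proof.
move=> s0.
have dratio l m : line_derive i (ratio l m) t
   (((l == i)%:R * coord m t + (m == i)%:R * coord l t
     - 2 * ratio l m t * coord i t) / sqn t).
  apply: line_derive_eq.
    apply: (line_deriveM (line_deriveM (line_derive_coord i l t) (line_derive_coord i m t))).
    exact: line_deriveV (line_derive_sqn i t).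
  rewrite /ratio; set s := (sqn t)^-1; ring.
apply: line_derive_eq.
  apply: line_derive_sum => l; apply: line_derive_sum => m.
  exact: line_deriveM (line_derive_cst i (H b l m) t) (dratio l m).
have S1 : \sum_l \sum_m H b l m * ((l == i)%:R * coord m t) = \sum_m H b i m * coord m t.
  rewrite (bigD1 i)//= [X in _ + X]big1 ?addr0.
    apply: eq_bigr => m _; rewrite eqxx mul1r//.
  by move=> l /negPf li; rewrite big1// => m _; rewrite li mul0r mulr0.
have S2 : \sum_l \sum_m H b l m * ((m == i)%:R * coord l t) = \sum_m H b i m * coord m t.
  rewrite exchange_big /= -S1; apply: eq_bigr => l _; apply: eq_bigr => m _.
  by rewrite Hsym.
transitivity ((\sum_l \sum_m H b l m * ((l == i)%:R * coord m t)
  + \sum_l \sum_m H b l m * ((m == i)%:R * coord l t)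
  - 2 * coord i t * rayleigh b t) / sqn t).
  rewrite /rayleigh mulr_sumr -big_split -sumrB mulr_suml; apply: eq_bigr => l _ /=.
  rewrite mulr_sumr -big_split -sumrB mulr_suml; apply: eq_bigr => m _ /=.
  set s := (sqn t)^-1; ring.
congr (_ / _); rewrite S1 S2 /grad_field.
have -> : \sum_j grad_coef b i j t * coord j t =
   \sum_j (2 * (H b i j * coord j t)) - \sum_j 2 * rayleigh b t * ((i == j)%:R * coord j t).
  rewrite -sumrB; apply: eq_bigr => j _; rewrite /grad_coef; ring.
rewrite -!mulr_sumr (_ : \sum_j (i == j)%:R * coord j t = coord i t); first by ring.
rewrite (bigD1 i)//= eqxx mul1r big1 ?addr0// => j.
by rewrite eq_sym => /negPf ->; rewrite mul0r.
Qed.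

Lemma Lfield_rayleigh b i j : Lfield i j (rayleigh b) (Lrayleigh b i j).
Proof.
move=> t s0; eexists; first exact: line_derive_rayleigh.
rewrite /grad_field /Lrayleigh mulrCA mulr_suml; apply: eq_bigr => k _.
by rewrite /ratio; set s := (sqn t)^-1; ring.
Qed.

Variables (z : bool -> R) (kappa : R) (th : nat -> R -> R).
Hypothesis kappa_gt0 : 0 < kappa.

Definition dist2 t : R := (rayleigh false t - z false) ^+ 2 + (rayleigh true t - z true) ^+ 2.

Hypothesis kappa_le : forall t, sqn t != 0 -> kappa <= gram_det t + dist2 t.
Hypothesis th_derive : forall m (x : R), is_derive x 1 (th m) (th m.+1 x).
Hypothesis th_neg : forall m (x : R), x <= 0 -> th m x = 0.
Hypothesis th_bounded : forall m, exists C : R, forall x, `|th m x| <= C.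

(* At least 1 where dist2 <= kappa / 4, at most 0 where dist2 >= kappa / 2. *)
Definition cut_arg t : R := 2 + (- 4 / kappa) * dist2 t.

(* Zeros of [gram_det] outside the origin are harmless: [cut_arg] is negative there. *)
Definition weight_gen (m k : nat) t : R := th m (cut_arg t) * (gram_det t)^-1 ^+ k.

(** The generators run over all derivatives of the cutoff and all powers of 1 / [gram_det] because a
    field raises m or k by one, and a division by [gram_det] raises k. *)
Inductive weight : (T -> R) -> Prop :=
| weight_generator (m k : nat) : weight (weight_gen m k)
| weight_poly f u : ratio_poly f -> weight u -> weight (fun t => f t * u t)
| weightD u v : weight u -> weight v -> weight (fun t => u t + v t).

Lemma weight_sum (I : Type) (r : seq I) (F : I -> T -> R) :
  (forall n, weight (F n)) -> weight (fun t => \sum_(n <- r) F n t).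
Proof.
move=> h; elim: r => [|n r IH].
  rewrite (_ : (fun t => _) = fun t => 0 * weight_gen 0 0 t).
    by apply: weight_poly; [exact: ratio_poly_cst|exact: weight_generator].
  by apply/funext => t; rewrite big_nil mul0r.
rewrite (_ : (fun t => _) = fun t => F n t + \sum_(n <- r) F n t).
  exact: weightD.
by apply/funext => t; rewrite big_cons.
Qed.

Lemma weightZ (a : R) u : weight u -> weight (fun t => a * u t).
Proof. by move=> wu; apply: weight_poly => //; exact: ratio_poly_cst. Qed.

Lemma dist2_poly : ratio_poly dist2.
Proof.
have h b : ratio_poly (fun t => rayleigh b t - z b).
  by apply: ratio_polyD; [exact: rayleigh_poly|exact: ratio_poly_cst].
rewrite (_ : dist2 = fun t => (rayleigh false t - z false) * (rayleigh false t - z false)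
  + (rayleigh true t - z true) * (rayleigh true t - z true)).
  by apply: ratio_polyD; apply: ratio_polyM.
by apply/funext => t; rewrite -!expr2.
Qed.

Lemma cut_arg_poly : ratio_poly cut_arg.
Proof.
apply: ratio_polyD; first exact: ratio_poly_cst.
by apply: ratio_polyM; [exact: ratio_poly_cst|exact: dist2_poly].
Qed.

Lemma cut_arg_kappa t : cut_arg t * kappa = 2 * kappa - 4 * dist2 t.
Proof. by rewrite /cut_arg; field; rewrite gt_eqF. Qed.

Lemma cut_arg_gram_det t : sqn t != 0 -> 0 < cut_arg t -> kappa / 2 <= gram_det t.
Proof.
move=> s0 c0; have := kappa_le s0; have := cut_arg_kappa t.
have := mulr_gt0 c0 kappa_gt0; lra.
Qed.

(** Here [dist2] >= [kappa], so [cut_arg] <= -2. Strict negativity persists nearby, which makes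
    weights vanish around such a point and not only at it. *)
Lemma cut_arg_singular t : sqn t != 0 -> gram_det t = 0 -> cut_arg t < 0.
Proof.
move=> s0 d0; have := kappa_le s0; rewrite d0 add0r => h.
rewrite -(pmulr_llt0 _ kappa_gt0) cut_arg_kappa.
by have := kappa_gt0; lra.
Qed.

Lemma th_continuous m : continuous (th m).
Proof. by move=> x; exact: deriv1_continuous (th_derive m x). Qed.

Lemma weight_measurable u : weight u -> measurable_fun setT u.
Proof.
elim=> [m k|f {}u rf _ mu|{}u v _ mu _ mv]; last exact: measurable_funD.
  apply: measurable_funM.
    apply: (@measurableT_comp _ _ _ _ _ _ (th m)).
      by apply: continuous_measurable_fun; exact: th_continuous.
    exact: ratio_poly_measurable cut_arg_poly.
  apply: (@measurable_funX _ _ _ _ (fun t => (gram_det t)^-1)).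
  apply: (@measurableT_comp _ _ _ _ _ _ (fun y : R => y^-1)).
    exact: measurable_invr.
  exact: ratio_poly_measurable gram_det_poly.
by apply: measurable_funM => //; exact: ratio_poly_measurable.
Qed.

Lemma weight_bounded u : weight u -> bounded_fct u.
Proof.
elim=> [m k|f {}u rf _ mu|{}u v _ mu _ mv]; last exact: bounded_fctD.
  have [C hC] := th_bounded m.
  have C0 : 0 <= C by apply: le_trans (hC 0).
  have K0 : 0 < 2 / kappa by rewrite divr_gt0.
  (* The term 2 / [kappa] bounds 1 / [gram_det] where the cutoff argument is positive. The summand 1
     covers the origin, where [kappa_le] says nothing and the power is 0^k with 1/0 = 0. *)
  exists (C * ((2 / kappa) ^+ k + 1)) => t; rewrite /weight_gen normrM.
  have [s0|s0] := eqVneq (sqn t) 0.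
    apply: ler_pM => //; apply: (@le_trans _ _ 1); last first.
      by rewrite lerDr exprn_ge0// ltW.
    have gram0 b c : gram b c t = 0.
      rewrite /gram big1// => i _; rewrite big1// => j _; rewrite big1// => l _.
      by rewrite /ratio s0 invr0 !mulr0.
    rewrite /gram_det !gram0 mul0r subr0.
    by rewrite invr0 expr0n; case: k => [|k]; rewrite /= ?normr1 ?normr0.
  have [c0|c0] := leP (cut_arg t) 0.
    by rewrite th_neg// normr0 mul0r mulr_ge0// addr_ge0// exprn_ge0// ltW.
  apply: ler_pM => //; apply: (@le_trans _ _ ((2 / kappa) ^+ k)); last by rewrite lerDl.
  have kd := cut_arg_gram_det s0 c0.
  have d0 : 0 < gram_det t by apply: lt_le_trans kd; rewrite divr_gt0.
  rewrite normrX; apply: lerXn2r; rewrite ?nnegrE//; first exact: ltW.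
  rewrite gtr0_norm ?invr_gt0// -[2 / kappa]invrK invf_div lef_pV2 ?posrE//.
  by rewrite divr_gt0.
by apply: bounded_fctM => //; exact: ratio_poly_bounded.
Qed.

Lemma weight_Lfield u : weight u -> forall i j, exists2 v, weight v & Lfield i j u v.
Proof.
move=> wu i j; elim: wu => [m k|f {}u rf wu [v wv lv]|{}u v _ [u' wu' lu'] _ [v' wv' lv']].
- have [lq rlq hq] := ratio_poly_Lfield cut_arg_poly i j.
  have [ld rld hd] := ratio_poly_Lfield gram_det_poly i j.
  exists (fun t => lq t * weight_gen m.+1 k t
    + ((fun t => - k%:R * ld t) t) * weight_gen m k.+1 t).
    apply: weightD; apply: weight_poly => //; try exact: weight_generator.
    by apply: ratio_polyM => //; exact: ratio_poly_cst.
  move=> t s0; have [dq hdq eq_lq] := hq t s0; have [dd hdd eq_ld] := hd t s0.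
  have [d0|d0] := eqVneq (gram_det t) 0.
    have c0 := cut_arg_singular s0 d0.
    exists 0; last by rewrite mulr0 /weight_gen !th_neg ?ltW// !mul0r !mulr0 addr0.
    apply: line_derive_near0.
    near=> x; rewrite /weight_gen th_neg ?mul0r// ltW//.
    by near: x; apply: line_continuous_near c0; exact: line_derive_continuous hdq.
  eexists.
    apply: line_deriveM.
      exact: line_derive_comp (th_derive m _) hdq.
    have h := line_deriveV d0 hdd.
    by have h2 := deriv1X k h; rewrite upd_coord in h2; exact: h2.
  rewrite /weight_gen -eq_lq -eq_ld; set y := (gram_det t)^-1.
  case: k => [|k]; first by rewrite !expr0; ring.
  rewrite -[k.+1.-1]/k !exprS; ring.
- have [g rg lg] := ratio_poly_Lfield rf i j.
  exists (fun t => g t * u t + f t * v t); last exact: LfieldM.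
  by apply: weightD; exact: weight_poly.
- by exists (fun t => u' t + v' t); [exact: weightD|exact: LfieldD].
Unshelve. all: by end_near.
Qed.

(** Dividing a generator raises k by one; at a zero of [gram_det] outside the origin both sides
    vanish because of the cutoff. *)
Lemma weight_div_gram_det u : weight u ->
  exists2 v, weight v & forall t, sqn t != 0 -> gram_det t * v t = u t.
Proof.
elim=> [m k|f {}u rf wu [v wv lv]|{}u v _ [u' wu' lu'] _ [v' wv' lv']].
- exists (weight_gen m k.+1); first exact: weight_generator.
  move=> t s0; rewrite /weight_gen.
  have [d0|d0] := eqVneq (gram_det t) 0.
    by rewrite d0 mul0r th_neg ?mul0r// ltW// cut_arg_singular.
  by rewrite mulrCA exprS [gram_det t * _]mulrA divff// mul1r.
- exists (fun t => f t * v t); first exact: weight_poly.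
  by move=> t s0; rewrite mulrCA lv.
- exists (fun t => u' t + v' t); first exact: weightD.
  by move=> t s0; rewrite mulrDr lu'// lv'.
Qed.

Lemma weight_field b u : weight u -> exists v v' : 'I_N -> 'I_N -> T -> R,
  [/\ forall i j, weight (v i j) /\ weight (v' i j),
      forall i j, Lfield i j (v i j) (v' i j),
      forall t, \sum_i \sum_j v i j t * ratio i j t = 0 &
      forall c t, sqn t != 0 ->
        \sum_i \sum_j v i j t * Lrayleigh c i j t = (b == c)%:R * u t].
Proof.
move=> wu; have [u1 wu1 hu1] := weight_div_gram_det wu.
pose v i j t := dual_coef b i j t * u1 t.
have wv i j : weight (v i j) by apply: weight_poly => //; exact: dual_coef_poly.
have /choice[v' hv'] : forall ij : 'I_N * 'I_N, exists w : T -> R,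
    weight w /\ Lfield ij.1 ij.2 (v ij.1 ij.2) w.
  by move=> [i j]; have [w ww hw] := weight_Lfield (wv i j) i j; exists w.
exists v, (fun i j => v' (i, j)); split.
- by move=> i j; split => //; exact: (hv' (i, j)).1.
- by move=> i j; exact: (hv' (i, j)).2.
- move=> t; transitivity (u1 t * \sum_i \sum_j dual_coef b i j t * ratio i j t).
    rewrite mulr_sumr; apply: eq_bigr => i _; rewrite mulr_sumr; apply: eq_bigr => j _.
    by rewrite /v; ring.
  by rewrite sum_dual_ratio mulr0.
- move=> c t s0; transitivity (u1 t * \sum_i \sum_j dual_coef b i j t * Lrayleigh c i j t).
    rewrite mulr_sumr; apply: eq_bigr => i _; rewrite mulr_sumr; apply: eq_bigr => j _.
    by rewrite /v; ring.
  by rewrite sum_dual_Lrayleigh -(hu1 t s0); ring.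
Qed.

Lemma weight_continuous u i t : weight u -> sqn t != 0 -> line_continuous i u t.
Proof. by move=> /(weight_Lfield)/(_ i i)[g _ h] t0; exact: Lfield_continuous h t0. Qed.

End weights.

(** * Moving derivatives onto weights *)

Section integration_by_parts.
Context {R : realType} {N : nat}.

Notation T := (N.-tuple (measurableTypeR R)).
Notation pm := (power_measure (@lebesgue_measure R) N).
Implicit Types (f g u : T -> R) (t : T) (i j k : 'I_N) (b c : bool).

Definition punctured_ball : set T := [set t | 0 < sqn t <= 1].

Lemma measurable_punctured_ball : measurable punctured_ball.
Proof.
have := (@measurable_sqn R N) measurableT _ (measurable_itv `]0, 1]).
by rewrite setTI.
Qed.

Lemma sqn_box t : sqn t <= 4 -> box 2 t.
Proof.
move=> s4 i; have h := le_trans (coord_sqn i t) s4.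
rewrite -(@ler_pXn2r _ 2) ?nnegrE// real_normK ?num_real//.
by rewrite (le_trans h)// -natrX.
Qed.

Lemma punctured_ball_box : punctured_ball `<=` box 2.
Proof. by move=> t /= /andP[_ s1]; apply: sqn_box; rewrite (le_trans s1)// ler1n. Qed.

Lemma punctured_ball_lty : (pm punctured_ball < +oo)%E.
Proof.
apply: le_lt_trans (@box_lty R N 2); apply: le_measure.
- by rewrite inE; exact: measurable_punctured_ball.
- by rewrite inE; exact: measurable_box.
- exact: punctured_ball_box.
Qed.

Lemma punctured_ball_integrable f : measurable_fun setT f -> bounded_fct f ->
  pm.-integrable punctured_ball (EFin \o f).
Proof.
move=> mf [C fC]; apply: measurable_bounded_integrable.
- exact: measurable_punctured_ball.
- exact: punctured_ball_lty.
- exact: measurable_funTS.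
- exists C; split; first by rewrite num_real.
  by move=> x Cx t _; exact: le_trans (fC t) (ltW Cx).
Qed.

Lemma bounded_fct_sqn (psi : R -> R) : continuous psi ->
  (forall s : R, 4 <= s -> psi s = 0) -> bounded_fct (fun t => psi (sqn t)).
Proof.
move=> cp p4.
have cn : {within `[0, 4], continuous (fun x => `|psi x|)}.
  apply: continuous_subspaceT => x; apply: continuous_comp; first exact: cp.
  exact: norm_continuous.
have [c _ hc] := EVT_max (ler0n _ 4) cn.
exists `|psi c| => t; have [s4|s4] := leP (sqn t) 4.
  by apply: hc; rewrite in_itv/= sqn_ge0.
by rewrite p4 ?normr0// ltW.
Qed.

Lemma integral_sum0 (I : Type) (r : seq I) (F : I -> T -> R) :
  (forall n, pm.-integrable setT (EFin \o F n)) ->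
  (forall n, \int[pm]_t (F n t)%:E = 0)%E ->
  (\int[pm]_t (\sum_(n <- r) F n t)%:E = 0)%E.
Proof.
move=> iF F0.
under eq_integral do rewrite -sumEFin.
rewrite (integral_sum (mu := pm) measurableT iF); apply: big1 => n _; exact: F0.
Qed.

Variables (H : bool -> 'I_N -> 'I_N -> R).
Hypothesis Hsym : forall b i j, H b i j = H b j i.
Variables (z : bool -> R) (kappa : R) (th : nat -> R -> R).
Hypothesis kappa_gt0 : 0 < kappa.
Hypothesis kappa_le : forall t, sqn t != 0 -> kappa <= gram_det H t + dist2 H z t.
Hypothesis th_derive : forall m (x : R), is_derive x 1 (th m) (th m.+1 x).
Hypothesis th_neg : forall m (x : R), x <= 0 -> th m x = 0.
Hypothesis th_one : forall x : R, 1 <= x -> th 0 x = 1.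
Hypothesis th_bounded : forall m, exists C : R, forall x, `|th m x| <= C.

Notation weight := (weight H z kappa th).

Definition tensor (phi : bool -> R -> R) t : R :=
  phi false (rayleigh H false t) * phi true (rayleigh H true t).

Section test_function.
Variables (phi phi' : bool -> R -> R).
Hypothesis phi_derive : forall b (x : R), is_derive x 1 (phi b) (phi' b x).
Hypothesis phi'_continuous : forall b, continuous (phi' b).

Let phi_continuous b : continuous (phi b).
Proof. by move=> x; exact: deriv1_continuous (phi_derive b x). Qed.

(** The partial derivative in the plane variable [b] of the product function, evaluated at the two
    Rayleigh quotients. *)
Definition tensor_derive b t : R :=
  tensor (fun c => if c == b then phi' c else phi c) t.

Let Ltensor i j t : R := \sum_(c : bool) tensor_derive c t * Lrayleigh H c i j t.

Let Lfield_tensor i j : Lfield i j (tensor phi) (Ltensor i j).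
Proof.
move=> t s0.
have [d0 l0 e0] := Lfield_rayleigh Hsym false i j s0.
have [d1 l1 e1] := Lfield_rayleigh Hsym true i j s0.
eexists.
  apply: line_deriveM.
    exact: line_derive_comp (phi_derive false _) l0.
  exact: line_derive_comp (phi_derive true _) l1.
rewrite /Ltensor big_bool /tensor_derive /tensor/= -e0 -e1; ring.
Qed.

Let comp_rayleigh_bounded (psi : R -> R) b : continuous psi ->
  bounded_fct (fun t => psi (rayleigh H b t)).
Proof.
move=> cp; apply: bounded_fct_comp => //.
exact: ratio_poly_bounded (rayleigh_poly H b).
Qed.

Let comp_rayleigh_measurable (psi : R -> R) b : continuous psi ->
  measurable_fun setT (fun t => psi (rayleigh H b t)).
Proof.
move=> cp; apply: (@measurableT_comp _ _ _ _ _ _ psi).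
  exact: continuous_measurable_fun.
exact: ratio_poly_measurable (rayleigh_poly H b).
Qed.

Let comp_rayleigh_continuous (psi : R -> R) b i t : continuous psi -> sqn t != 0 ->
  line_continuous i (fun t => psi (rayleigh H b t)) t.
Proof.
move=> cp s0; apply: line_continuous_comp => //.
exact: ratio_poly_continuous (rayleigh_poly H b) s0.
Qed.

(** What [integral_coord_derivative] asks of a derivative, except at the origin, where ratios need
    not be continuous and the radial cutoff takes over. *)
Let tame f := [/\ bounded_fct f, measurable_fun setT f &
  forall i t, sqn t != 0 -> line_continuous i f t].

Let tameM f g : tame f -> tame g -> tame (fun t => f t * g t).
Proof.
move=> [bf mf cf] [bg mg cg]; split; first exact: bounded_fctM.
  exact: measurable_funM.
by move=> i t s0; apply: line_continuousM; [exact: cf|exact: cg].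
Qed.

Let tameD f g : tame f -> tame g -> tame (fun t => f t + g t).
Proof.
move=> [bf mf cf] [bg mg cg]; split; first exact: bounded_fctD.
  exact: measurable_funD.
by move=> i t s0; apply: line_continuousD; [exact: cf|exact: cg].
Qed.

Let tame_comp (psi : R -> R) b : continuous psi -> tame (fun t => psi (rayleigh H b t)).
Proof.
move=> cp; split; [exact: comp_rayleigh_bounded|exact: comp_rayleigh_measurable|].
by move=> i t s0; exact: comp_rayleigh_continuous.
Qed.

Let tame_poly f : ratio_poly f -> tame f.
Proof.
move=> rf; split; [exact: ratio_poly_bounded|exact: ratio_poly_measurable|].
by move=> i t s0; exact: ratio_poly_continuous.
Qed.

Let tame_weight f : weight f -> tame f.
Proof.
move=> rf; split.
- by apply: weight_bounded rf.
- by apply: weight_measurable rf.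
- by move=> i t s0; apply: weight_continuous rf s0.
Qed.

Let tame_sqn (psi : R -> R) : continuous psi -> (forall s : R, 4 <= s -> psi s = 0) ->
  tame (fun t => psi (sqn t)).
Proof.
move=> cp p4; split; first exact: bounded_fct_sqn.
  apply: (@measurableT_comp _ _ _ _ _ _ psi); first exact: continuous_measurable_fun.
  exact: measurable_sqn.
move=> i t s0; apply: line_continuous_comp => //.
exact: line_derive_continuous (line_derive_sqn i t).
Qed.

Let tame_cst (c : R) : tame (fun=> c).
Proof. by apply: tame_poly; exact: ratio_poly_cst. Qed.

Let tame_tensor : tame (tensor phi).
Proof. by apply: tameM; apply: tame_comp. Qed.

Let tame_Ltensor i j : tame (Ltensor i j).
Proof.
have h c : tame (fun t => tensor_derive c t * Lrayleigh H c i j t).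
  apply: tameM; last by apply: tame_poly; exact: Lrayleigh_poly.
  by apply: tameM; apply: tame_comp; case: ifP.
rewrite (_ : Ltensor i j = fun t => tensor_derive true t * Lrayleigh H true i j t +
  tensor_derive false t * Lrayleigh H false i j t).
  exact: tameD.
by apply/funext => t; rewrite /Ltensor big_bool.
Qed.

Section cutoff.
Variables (rho rho' : R -> R) (s0 : R).
Hypothesis rho_derive : forall x : R, is_derive x 1 rho (rho' x).
Hypothesis rho'_continuous : continuous rho'.
Hypothesis s0_gt0 : 0 < s0.
Hypothesis rho_small : forall s : R, s < s0 -> rho s = 0.
Hypothesis rho_large : forall s : R, 4 <= s -> rho s = 0.
Hypothesis rho'_large : forall s : R, 4 <= s -> rho' s = 0.

Let rho'_small s : s < s0 -> rho' s = 0.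
Proof.
move=> ss; have [_ <-] := rho_derive s.
rewrite (@near_eq_derive R R R _ (cst 0)) ?derive_cst//.
by near=> y; rewrite rho_small//; near: y; exact: lt_nbhsl.
Unshelve. all: by end_near.
Qed.

Let rho_continuous : continuous rho.
Proof. by move=> x; exact: deriv1_continuous (rho_derive x). Qed.

Variables (i j : 'I_N) (v v' : T -> R).
Hypotheses (wv : weight v) (wv' : weight v') (hv : Lfield i j v v').

(** The u_i-derivative of [component]. The factor u_j is absorbed: u_i u_j becomes |u|^2 times a
    ratio in the radial term, u_j d/du_i gives [Ltensor] and [v'], and d u_j / du_i gives the
    Kronecker term. Apart from functions of |u|^2 only functions of degree 0 remain. *)
Definition component_derive t : R :=
  2 * (rho' (sqn t) * sqn t) * ratio i j t * (tensor phi t * v t)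
  + rho (sqn t) * (Ltensor i j t * v t + tensor phi t * v' t
                   + (i == j)%:R * (tensor phi t * v t)).

Let component t : R := rho (sqn t) * (tensor phi t * v t * coord j t).

Let component_small t : sqn t < s0 -> component t = 0 /\ component_derive t = 0.
Proof.
move=> ss; split; first by rewrite /component rho_small// mul0r.
by rewrite /component_derive rho_small// rho'_small// !mul0r mulr0 !mul0r addr0.
Qed.

Let near_small k t : sqn t < s0 -> \forall x \near coord k t, sqn (upd k x t) < s0.
Proof.
move=> ss; apply: line_continuous_near ss.
exact: line_derive_continuous (line_derive_sqn k t).
Qed.

Let sqn_neq0 t : s0 <= sqn t -> sqn t != 0.
Proof. by move=> ss; rewrite gt_eqF// (lt_le_trans s0_gt0). Qed.

Let tame_component_derive : tame component_derive.
Proof.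
have tv := tame_weight wv; have tv' := tame_weight wv'.
apply: tameD.
  apply: tameM; last by apply: tameM.
  apply: tameM; last by apply: tame_poly; exact: ratio_poly_gen.
  apply: tameM; first exact: tame_cst.
  apply: (@tame_sqn (fun s => rho' s * s)).
    by move=> x; apply: continuousM; [exact: rho'_continuous|exact: cvg_id].
  by move=> s s4; rewrite rho'_large// mul0r.
apply: tameM; first exact: tame_sqn.
by apply: tameD; [apply: tameD; apply: tameM|apply: tameM => //; exact: tameM].
Qed.

Let component_support t : component t != 0 \/ component_derive t != 0 -> box 2 t.
Proof.
move=> h; apply: sqn_box; rewrite leNgt; apply/negP => /ltW s4.
by case: h; rewrite /component /component_derive rho_large ?rho'_large//
  !mul0r ?(mulr0, mul0r, addr0) eqxx.
Qed.

Lemma integrable_component_derive : pm.-integrable setT (EFin \o component_derive).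
Proof.
have [[C hC] mc _] := tame_component_derive.
by apply: (@box_integrable _ _ _ 2 C) => // t h; apply: component_support; right.
Qed.

Lemma integral_component_derive : (\int[pm]_t (component_derive t)%:E = 0)%E.
Proof.
have [[C hC] mc cc] := tame_component_derive.
apply: (@integral_coord_derivative _ _ i component _ 2 C) => //.
- move=> t; have [ss|ss] := ltP (sqn t) s0.
    rewrite (component_small ss).2; apply: line_derive_near0.
    by apply: filterS (near_small i ss) => x /component_small[].
  have n0 := sqn_neq0 ss.
  have [dt lt et] := Lfield_tensor i j n0; have [dv lv ev] := hv n0.
  apply: line_derive_eq.
    apply: line_deriveM.
      exact: line_derive_comp (rho_derive _) (line_derive_sqn i t).
    apply: line_deriveM; last exact: line_derive_coord.
    exact: line_deriveM lt lv.
  rewrite /component_derive -et -ev [rho' _ * _ in RHS]mulrC.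
  have -> : 2 * (sqn t * rho' (sqn t)) * ratio i j t =
      2 * rho' (sqn t) * (coord i t * coord j t) by rewrite -sqn_ratio; ring.
  by rewrite [j == i]eq_sym; ring.
- move=> t; have [ss|ss] := ltP (sqn t) s0; last exact/cc/sqn_neq0.
  rewrite /prop_for /continuous_at upd_coord (component_small ss).2.
  apply: cvg_near_cst.
  by apply: filterS (near_small i ss) => x /component_small[].
Qed.

End cutoff.

End test_function.
End integration_by_parts.

(** * Removing the radial cutoff and moving derivatives onto weights on the punctured ball *)

Section transport.
Context {R : realType} {N : nat}.

Notation T := (N.-tuple (measurableTypeR R)).
Notation pm := (power_measure (@lebesgue_measure R) N).
Implicit Types (f g u : T -> R) (t : T) (i j : 'I_N) (b c : bool).

Variables (H : bool -> 'I_N -> 'I_N -> R).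
Hypothesis Hsym : forall b i j, H b i j = H b j i.
Variables (z : bool -> R) (kappa : R) (th : nat -> R -> R).
Hypothesis kappa_gt0 : 0 < kappa.
Hypothesis kappa_le : forall t, sqn t != 0 -> kappa <= gram_det H t + dist2 H z t.
Hypothesis th_derive : forall m (x : R), is_derive x 1 (th m) (th m.+1 x).
Hypothesis th_neg : forall m (x : R), x <= 0 -> th m x = 0.
Hypothesis th_one : forall x : R, 1 <= x -> th 0 x = 1.
Hypothesis th_bounded : forall m, exists C : R, forall x, `|th m x| <= C.

Notation weight := (weight H z kappa th).

(** As a function of s = |u|^2 it rises on [1/n, 2/n] and falls on [1, 1 + 1/n]. The limit is the
    indicator of ]0, 1], endpoint 1 included, since [th 0] vanishes at 0. *)
Let rho n (s : R) : R := th 0 (n%:R * s + -1) * (1 + -1 * th 0 (n%:R * s + - n%:R)).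

Let rho' n (s : R) : R :=
  n%:R * th 1 (n%:R * s + -1) * (1 + -1 * th 0 (n%:R * s + - n%:R))
  + th 0 (n%:R * s + -1) * (-1 * (n%:R * th 1 (n%:R * s + - n%:R))).

Let th_affine_derive m (a c s : R) :
  is_derive s 1 (fun s => th m (a * s + c)) (a * th m.+1 (a * s + c)).
Proof.
have ha := deriv1D (deriv1M (deriv1_cst a s) (deriv1_id s)) (deriv1_cst c s).
have h := @deriv1_comp _ (th m) (fun s => a * s + c) s _ _ (th_derive m _) ha.
by apply: (deriv1_eq h); ring.
Qed.

Let th_affine_continuous m (a c : R) : continuous (fun s : R => th m (a * s + c)).
Proof. by move=> s; exact: deriv1_continuous (th_affine_derive m a c s). Qed.

Let rho_derive n (s : R) : is_derive s 1 (rho n) (rho' n s).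
Proof.
have h1 := th_affine_derive 0 n%:R (-1) s.
have h2 := th_affine_derive 0 n%:R (- n%:R) s.
have h3 := deriv1D (deriv1_cst 1 s) (deriv1M (deriv1_cst (-1) s) h2).
have h := deriv1M h1 h3.
by apply: (deriv1_eq h); rewrite /rho'; ring.
Qed.

Let rho'_continuous n : continuous (rho' n).
Proof.
have cM m (c : R) : continuous (fun s : R => n%:R * th m (n%:R * s + c)).
  by apply: continuous1M; [exact: continuous1_cst|exact: th_affine_continuous].
apply: continuous1D; apply: continuous1M => //; last 1 first.
- by apply: continuous1M => //; exact: continuous1_cst.
- apply: continuous1D; first exact: continuous1_cst.
  by apply: continuous1M; [exact: continuous1_cst|exact: th_affine_continuous].
Qed.

Let th1_one (x : R) : 1 < x -> th 1 x = 0.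
Proof.
move=> x1; have [_ <-] := th_derive 0 x.
rewrite (@near_eq_derive R R R _ (cst 1)) ?derive_cst//.
by near=> y; rewrite th_one// ltW//; near: y; exact: lt_nbhsr.
Unshelve. all: by end_near.
Qed.

Let rho_small n (s : R) : (0 < n)%N -> s < n%:R^-1 -> rho n s = 0.
Proof.
move=> n0 sn; rewrite /rho th_neg ?mul0r//.
by rewrite subr_le0 mulrC -ler_pdivlMr ?ltr0n// div1r ltW.
Qed.

Let rho_large_arg n (s : R) : (0 < n)%N -> 4 <= s -> 1 < n%:R * s + - n%:R.
Proof.
move=> n0 s4; have : (1 : R) <= n%:R by rewrite ler1n.
by nra.
Qed.

Let rho_large n (s : R) : (0 < n)%N -> 4 <= s -> rho n s = 0.
Proof.
move=> n0 s4; rewrite /rho [th 0 (_ + - n%:R)]th_one; last exact/ltW/rho_large_arg.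
by ring.
Qed.

Let rho'_large n (s : R) : (0 < n)%N -> 4 <= s -> rho' n s = 0.
Proof.
move=> n0 s4; rewrite /rho' [th 0 (_ + - n%:R)]th_one; last exact/ltW/rho_large_arg.
by rewrite [th 1 (_ + - n%:R)]th1_one ?rho_large_arg//; ring.
Qed.

Let rho_cvg (s : R) : 0 <= s ->
  \forall n \near \oo, rho n.+1 s = ((0 < s) && (s <= 1))%:R.
Proof.
rewrite le_eqVlt => /predU1P[<-|s_gt0].
  by near=> n; rewrite ltxx/= rho_small// invr_gt0 ltr0n.
have [s1|s1] := leP s 1.
  near=> n; rewrite s_gt0/= /rho.
  rewrite [th 0 (_ + - n.+1%:R)]th_neg; last first.
    by rewrite subr_le0 -[leRHS]mulr1 ler_wpM2l.
  rewrite th_one ?mulr0 ?addr0 ?mulr1//.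
  rewrite lerBrDr -ler_pdivrMr//.
  have : (1 + 1) / s <= n%:R by near: n; exact: nbhs_infty_ger.
  by move/le_trans; apply; rewrite ler_nat.
near=> n; rewrite andbF /rho [th 0 (_ + - n.+1%:R)]th_one; first by rewrite mulr1 subrr mulr0.
have : (s - 1)^-1 <= n%:R by near: n; exact: nbhs_infty_ger.
have s10 : 0 < s - 1 by rewrite subr_gt0.
rewrite -div1r ler_pdivrMr// => h; apply: le_trans h _.
rewrite -[X in _ + - X]mulr1 -mulrBr.
by apply: ler_wpM2r; [exact: ltW|rewrite ler_nat].
Unshelve. all: by end_near.
Qed.

Let rho_bounded : exists C : R, forall n s, `|rho n s| <= C.
Proof.
have [C hC] := th_bounded 0; exists (C * (1 + C)) => n s.
rewrite /rho normrM ler_pM// (le_trans (ler_normD _ _))// normr1 lerD2l.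
by rewrite normrM normrN1 mul1r.
Qed.

Let measurable_rho n : measurable_fun setT (rho n).
Proof.
apply: continuous_measurable_fun => s; exact: deriv1_continuous (rho_derive n s).
Qed.

(** Dominated convergence: the cutoffs are uniformly bounded and all vanish for |u|^2 >= 4, hence
    outside [box 2]. *)
Lemma integral_cutoff_limit (F : T -> R) : measurable_fun setT F -> bounded_fct F ->
  (forall n, \int[pm]_t (rho n.+1 (sqn t) * F t)%:E = 0)%E ->
  (\int[pm]_(t in punctured_ball) (F t)%:E = 0)%E.
Proof.
move=> mF [C FC] F0; have [D hD] := rho_bounded.
rewrite integral_mkcond.
pose f_ n t := (rho n.+1 (sqn t) * F t)%:E.
have := @dominated_convergence _ _ _ pm setT measurableT f_
  ((EFin \o F) \_ punctured_ball)
  (EFin \o (fun t => D * C * \1_(box 2) t)).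
case.
- move=> n; apply/measurable_EFinP; apply: measurable_funM => //.
  by apply: (@measurableT_comp _ _ _ _ _ _ (rho n.+1)) => //; exact: measurable_sqn.
- apply/(measurable_restrictT _ measurable_punctured_ball).
  by apply: measurable_funTS; exact/measurable_EFinP.
- apply: aeW => t _; apply: cvg_near_cst.
  near=> n; rewrite /f_ patchE.
  have -> : rho n.+1 (sqn t) = ((0 < sqn t) && (sqn t <= 1))%:R.
    by near: n; exact: rho_cvg (sqn_ge0 t).
  have [tb|tb] := boolP (t \in punctured_ball).
    by move: (set_mem tb) => /= ->; rewrite mul1r.
  rewrite (_ : _ && _ = false) ?mul0r//; apply/negbTE/negP => h.
  by move/negP : tb; apply; rewrite inE.
- apply: (@box_integrable _ _ _ 2 (D * C)).
  + by apply: measurable_funM => //; apply: measurable_indic; exact: measurable_box.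
  + move=> t; have D0 : 0 <= D by apply: le_trans (hD 0 0).
    have C0 : 0 <= C by apply: le_trans (FC t).
    rewrite normrM ger0_norm ?mulr_ge0// ger0_norm// ler_piMr ?mulr_ge0//.
  + move=> t; rewrite indicE; have [/set_mem//|_] := boolP (t \in box 2).
    by rewrite mulr0 eqxx.
- apply: aeW => t n _ /=; rewrite lee_fin.
  have D0 : 0 <= D by apply: le_trans (hD 0 0).
  have C0 : 0 <= C by apply: le_trans (FC t).
  rewrite indicE; have [tb|tb] := boolP (t \in box 2).
    by rewrite mulr1 normrM ler_pM.
  rewrite mulr0 rho_large ?mul0r ?normr0//.
  rewrite leNgt; apply/negP => s4; move/negP: tb; apply; rewrite inE.
  exact/sqn_box/ltW.
move=> _ _; rewrite (_ : [sequence _]_n = cst 0%E); last first.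
  by apply/funext => n; exact: F0.
by move=> h; have := cvg_unique _ h (cvg_cst 0%E); apply.
Unshelve. all: by end_near.
Qed.

(* The field dual to the gradients is tangential, hence annihilates the radial
   cutoffs: no boundary term remains when they tend to the punctured ball. *)
Lemma weight_transport b u : weight u -> exists2 u', weight u' &
  forall phi phi' : bool -> R -> R,
  (forall c (x : R), is_derive x 1 (phi c) (phi' c x)) ->
  (forall c, continuous (phi' c)) ->
  \int[pm]_(t in punctured_ball) (tensor_derive H phi phi' b t * u t) =
  \int[pm]_(t in punctured_ball) (tensor H phi t * u' t).
Proof.
move=> wu.
have [v [v' [wv hv vr vL]]] := weight_field kappa_gt0 kappa_le th_derive th_neg b wu.
(* The divergence of the field sum_ij v_ij u_j d/du_i; the new weight is its opposite. *)
pose S t := \sum_(p : 'I_N * 'I_N) (v' p.1 p.2 t + (p.1 == p.2)%:R * v p.1 p.2 t).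
have wS : weight S.
  apply: weight_sum => -[i j] /=; apply: weightD; first exact: (wv i j).2.
  by apply: weightZ; exact: (wv i j).1.
exists (fun t => -1 * S t); first exact: weightZ.
move=> phi phi' dphi cphi'.
have phi_cont c : continuous (phi c).
  by move=> x; exact: deriv1_continuous (dphi c x).
have tens (psi : bool -> R -> R) : (forall c, continuous (psi c)) ->
    measurable_fun setT (tensor H psi) /\ bounded_fct (tensor H psi).
  move=> cpsi; split.
    apply: measurable_funM; (apply: (@measurableT_comp _ _ _ _ _ _ (psi _));
      [exact: continuous_measurable_fun|exact: ratio_poly_measurable (rayleigh_poly H _)]).
  by apply: bounded_fctM; apply: bounded_fct_comp => //;
    exact: ratio_poly_bounded (rayleigh_poly H _).
have [mt bt] := tens phi phi_cont.
have [mt' bt'] : measurable_fun setT (tensor_derive H phi phi' b) /\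
    bounded_fct (tensor_derive H phi phi' b).
  by apply: tens => c; case: ifP.
have mu : measurable_fun setT u by apply: weight_measurable wu.
have bu : bounded_fct u by apply: weight_bounded wu.
have mS : measurable_fun setT S by apply: weight_measurable wS.
have bS : bounded_fct S by apply: weight_bounded wS.
pose F t := tensor_derive H phi phi' b t * u t + tensor H phi t * S t.
suff F0 : (\int[pm]_(t in punctured_ball) (F t)%:E = 0)%E.
  apply/eqP; rewrite -subr_eq0 -RintegralB.
  - rewrite /Rintegral (_ : (fun t => _) = fun t => (F t)%:E) ?F0//.
    by apply/funext => t; rewrite /F; congr EFin; ring.
  - exact: measurable_punctured_ball.
  - by apply: punctured_ball_integrable; [exact: measurable_funM|exact: bounded_fctM].
  - apply: punctured_ball_integrable.
      by apply: measurable_funM => //; exact: measurable_funM.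
    by apply: bounded_fctM => //; apply: bounded_fctM => //; exact: bounded_fct_cst.
apply: integral_cutoff_limit.
- by apply: measurable_funD; exact: measurable_funM.
- by apply: bounded_fctD; exact: bounded_fctM.
move=> n.
pose h (p : 'I_N * 'I_N) := component_derive H phi phi' (rho n.+1) (rho' n.+1)
  p.1 p.2 (v p.1 p.2) (v' p.1 p.2).
have n1 : 0 < n.+1%:R^-1 :> R by rewrite invr_gt0 ltr0n.
have ih p : pm.-integrable setT (EFin \o h p).
  apply: (@integrable_component_derive _ _ H z kappa th) => //.
  - by move=> s; exact: rho_large.
  - by move=> s; exact: rho'_large.
  - exact: (wv _ _).1.
  - exact: (wv _ _).2.
have h0 p : (\int[pm]_t (h p t)%:E = 0)%E.
  apply: (@integral_component_derive _ _ H Hsym z kappa th _ _ _ _ _ _ _ _ _ _ _ n.+1%:R^-1) => //.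
  - by move=> s; exact: rho_small.
  - by move=> s; exact: rho_large.
  - by move=> s; exact: rho'_large.
  - exact: (wv _ _).1.
  - exact: (wv _ _).2.
rewrite -[RHS](integral_sum0 (index_enum _) ih h0); apply: eq_integral => t _.
congr EFin.
(* [K] collects the derivative of the radial cutoff. It multiplies sum_ij v_ij [ratio i j], which is
   0 by tangency, so the large values of [rho'] never enter the limit. *)
pose K := 2 * (rho' n.+1 (sqn t) * sqn t) * tensor H phi t.
transitivity (K * \sum_i \sum_j v i j t * ratio i j t
  + rho n.+1 (sqn t) * (
    tensor_derive H phi phi' true t * \sum_i \sum_j v i j t * Lrayleigh H true i j t
  + tensor_derive H phi phi' false t * \sum_i \sum_j v i j t * Lrayleigh H false i j t
  + tensor H phi t * S t)).
  rewrite vr mulr0 add0r; have [s0|s0] := eqVneq (sqn t) 0.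
    by rewrite s0 rho_small// !mul0r.
  by rewrite !vL// /F; case: (b) => /=; ring.
rewrite !pair_big /= /S !mulr_sumr -!big_split mulr_sumr -big_split.
apply: eq_bigr => p _ /=.
rewrite /h /component_derive big_bool /K /=.
ring.
Qed.

End transport.

(** * Truncated powers and potentials *)

Section truncated_powers.
Context {R : realType}.
Implicit Types (s r h x : R) (a : nat).

Definition tpow a s : R := if 0 < s then s ^+ a / a`!%:R else 0.

Lemma tpow_le0 a s : s <= 0 -> tpow a s = 0.
Proof. by move=> s0; rewrite /tpow ltNge s0. Qed.

Lemma tpow_ge0 a s : 0 <= tpow a s.
Proof.
by rewrite /tpow; case: ifP => // s0; rewrite divr_ge0// exprn_ge0// ltW.
Qed.

Lemma tpow_le a s r : s <= r -> tpow a s <= tpow a r.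
Proof.
move=> sr; have [s0|s0] := leP s 0; first by rewrite (tpow_le0 _ s0) tpow_ge0.
rewrite /tpow s0 (lt_le_trans s0 sr) ler_wpM2r ?invr_ge0//.
by apply: lerXn2r; rewrite ?nnegrE// ltW// (lt_le_trans s0).
Qed.

Lemma tpow0_le1 s : tpow 0 s <= 1.
Proof. by rewrite /tpow; case: ifP => //; rewrite expr0 divr1. Qed.

(* Stated without derivatives so as to cover the jump of [tpow 0] at the origin. *)
Lemma tpow_mean a r s : r <= s ->
  (s - r) * tpow a r <= tpow a.+1 s - tpow a.+1 r <= (s - r) * tpow a s.
Proof.
move=> rs; have sr0 : 0 <= s - r by rewrite subr_ge0.
have [s0|s0] := leP s 0.
  by rewrite !tpow_le0 ?mulr0 ?subrr ?lexx// (le_trans rs).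
have fa : 0 < a`!%:R :> R by rewrite ltr0n fact_gt0.
have fE : a.+1`!%:R = a.+1%:R * a`!%:R :> R by rewrite factS natrM.
have [r0|r0] := leP r 0.
  rewrite !(tpow_le0 _ r0) mulr0 subr0 tpow_ge0/=.
  rewrite /tpow s0 exprS -mulrA ler_pM ?mulr_ge0 ?invr_ge0 ?exprn_ge0 ?(ltW s0)//.
    by lra.
  rewrite ler_wpM2l ?exprn_ge0 ?(ltW s0)// lef_pV2 ?posrE ?ltr0n ?fact_gt0//.
  by rewrite ler_nat factS leq_pmull.
rewrite /tpow s0 r0 -mulrBl subrXX fE.
(* In the factorization of s^(a+1) - r^(a+1) by s - r, each of the a + 1 terms lies between r^a and
   s^a. *)
have key : (s - r) * (a.+1%:R * r ^+ a) <=
    (s - r) * (\sum_(i < a.+1) s ^+ (a.+1.-1 - i) * r ^+ i) <= (s - r) * (a.+1%:R * s ^+ a).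
  apply/andP; split; apply: ler_wpM2l => //.
    rewrite mulr_natl -[X in _ *+ X]card_ord -sumr_const; apply: ler_sum => i _.
    have ia : (i <= a)%N by rewrite -ltnS.
    have -> : r ^+ a = r ^+ (a - i) * r ^+ i by rewrite -exprD subnK.
    rewrite ler_wpM2r ?exprn_ge0 ?(ltW r0)//.
    by apply: lerXn2r; rewrite ?nnegrE// ltW.
  rewrite mulr_natl -[X in _ *+ X]card_ord -sumr_const; apply: ler_sum => i _.
  have ia : (i <= a)%N by rewrite -ltnS.
  have -> : s ^+ a = s ^+ (a - i) * s ^+ i by rewrite -exprD subnK.
  rewrite ler_wpM2l ?exprn_ge0 ?(ltW s0)//.
  by apply: lerXn2r; rewrite ?nnegrE// ltW.
have f1 : 0 < (a.+1%:R * a`!%:R)^-1 :> R by rewrite invr_gt0 mulr_gt0// ltr0n.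
move/andP : key => [k1 k2]; apply/andP; split.
  rewrite (_ : _ * _ = (s - r) * (a.+1%:R * r ^+ a) * (a.+1%:R * a`!%:R)^-1).
    by rewrite ler_wpM2r// ltW.
  by field; rewrite (gt_eqF fa)/= nat1r pnatr_eq0.
rewrite [leRHS](_ : _ = (s - r) * (a.+1%:R * s ^+ a) * (a.+1%:R * a`!%:R)^-1).
  by rewrite ler_wpM2r// ltW.
by field; rewrite (gt_eqF fa)/= nat1r pnatr_eq0.
Qed.

Lemma tpow_lip a B s r : `|s| <= B -> `|r| <= B ->
  `|tpow a.+1 s - tpow a.+1 r| <= tpow a B * `|s - r|.
Proof.
wlog rs : s r / r <= s.
  move=> h sB rB; have [rs|/ltW sr] := leP r s; first exact: h.
  by rewrite distrC [`|s - r|]distrC; exact: h.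
move=> sB rB; have /andP[h1 h2] := tpow_mean a rs.
rewrite ger0_norm; last by rewrite subr_ge0 tpow_le.
rewrite ger0_norm ?subr_ge0// (le_trans h2)// mulrC ler_wpM2r ?subr_ge0//.
by rewrite tpow_le// (le_trans (ler_norm _)).
Qed.

(** The mean inequality leaves s - r times an increment of [tpow a.+1], which is again Lipschitz.
    The case a = 0 is allowed although the second derivative jumps at 0. *)
Lemma tpow_taylor a B s r : `|s| <= B -> `|r| <= B ->
  `|tpow a.+2 r - tpow a.+2 s - (r - s) * tpow a.+1 s| <= tpow a B * (r - s) ^+ 2.
Proof.
move=> sB rB; have h := tpow_lip a sB rB.
have [rs|/ltW sr] := leP r s.
  have /andP[h1 h2] := tpow_mean a.+1 rs.
  have rs0 : `|s - r| = s - r by rewrite ger0_norm// subr_ge0.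
  rewrite rs0 in h.
  have hh : tpow a.+1 s - tpow a.+1 r <= tpow a B * (s - r).
    by apply: le_trans h; exact: ler_norm.
  have sr0 : 0 <= s - r by rewrite subr_ge0.
  rewrite ger0_norm; last by lra.
  apply: (@le_trans _ _ ((s - r) * (tpow a.+1 s - tpow a.+1 r))).
    by lra.
  rewrite (_ : tpow a B * _ = (s - r) * (tpow a B * (s - r))); last by ring.
  by rewrite ler_wpM2l.
have /andP[h1 h2] := tpow_mean a.+1 sr.
have rs0 : `|s - r| = r - s by rewrite distrC ger0_norm// subr_ge0.
rewrite rs0 distrC in h.
have hh : tpow a.+1 r - tpow a.+1 s <= tpow a B * (r - s).
  by apply: le_trans h; exact: ler_norm.
have sr0 : 0 <= r - s by rewrite subr_ge0.
rewrite ger0_norm; last by lra.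
apply: (@le_trans _ _ ((r - s) * (tpow a.+1 r - tpow a.+1 s))).
  by lra.
rewrite (_ : tpow a B * _ = (r - s) * (tpow a B * (r - s))); last by ring.
by rewrite ler_wpM2l.
Qed.

Lemma is_derive_tpow a x : is_derive x 1 (tpow a.+2) (tpow a.+1 x).
Proof.
apply: (@is_derive_quadratic _ _ _ _ _ _ (tpow a (`|x| + 1))) => h h1.
have := @tpow_taylor a (`|x| + 1) x (h *: 1 + x).
rewrite [h *: 1]mulr1 addrK; apply; first by rewrite lerDl.
by rewrite addrC (le_trans (ler_normD _ _))// lerD2l.
Qed.

Lemma tpow_continuous a : continuous (tpow a.+1).
Proof.
case: a => [|a] x; last exact: deriv1_continuous (is_derive_tpow a x).
apply/cvgrPdist_le => e e0; near=> y.
have h := @tpow_lip 0 (`|x| + 1) x y.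
apply: le_trans (h _ _) _.
- by rewrite lerDl.
- have -> : y = x + (y - x) by ring.
  rewrite (le_trans (ler_normD _ _))// lerD2l distrC.
  by near: y; apply: cvgr_dist_le => //; exact: cvg_id.
- apply: (@le_trans _ _ (1 * `|x - y|)); first by rewrite ler_wpM2r// tpow0_le1.
  by rewrite mul1r; near: y; apply: cvgr_dist_le => //; exact: cvg_id.
Unshelve. all: by end_near.
Qed.

Lemma measurable_tpow a : measurable_fun setT (tpow a).
Proof.
case: a => [|a]; last by apply: continuous_measurable_fun; exact: tpow_continuous.
rewrite (_ : tpow 0 = \1_`]0, +oo[); first exact: measurable_indic.
apply/funext => x; rewrite indicE /tpow mem_setE in_itv/= andbT.
by case: ifP => //; rewrite expr0 divr1.
Qed.

(** The strict inequality in [tpow 0] makes it left continuous; this is why the difference quotients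
    below are backward. *)
Lemma tpow_left_cvg a s : tpow a (s - n.+1%:R^-1) @[n --> \oo] --> tpow a s.
Proof.
have [s0|s0] := leP s 0.
  rewrite (tpow_le0 _ s0); apply: cvg_near_cst; near=> n; rewrite tpow_le0//.
  by rewrite (le_trans _ s0)// gerBl invr_ge0.
case: a => [|a].
  apply: cvg_near_cst; near=> n.
  rewrite /tpow s0 ifT// subr_gt0.
  have : s^-1 < n%:R by near: n; exact: nbhs_infty_gtr.
  move=> h; rewrite invf_plt ?posrE ?ltr0n//.
  by rewrite (lt_le_trans h)// ler_nat.
apply: (@cvg_comp _ _ _ (fun n : nat => s - n.+1%:R^-1) (tpow a.+1)); last exact: tpow_continuous.
have h : s - n.+1%:R^-1 @[n --> \oo] --> s - 0.
  by apply: cvgB; [exact: cvg_cst|exact: cvg_harmonic].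
by rewrite subr0 in h; exact: h.
Unshelve. all: by end_near.
Qed.

Definition tpow_quotient a n s : R := n.+1%:R * (tpow a.+1 s - tpow a.+1 (s - n.+1%:R^-1)).

Lemma tpow_quotient_mean a n s :
  tpow a (s - n.+1%:R^-1) <= tpow_quotient a n s <= tpow a s.
Proof.
have n0 : 0 < n.+1%:R :> R by rewrite ltr0n.
have rs : s - n.+1%:R^-1 <= s by rewrite gerBl invr_ge0 ltW.
have /andP[h1 h2] := tpow_mean a rs.
rewrite subKr in h1 h2.
rewrite /tpow_quotient -ler_pdivrMl// mulrC.
by rewrite mulrC h1/= -ler_pdivlMl// h2.
Qed.

Lemma tpow_quotient_cvg a s : tpow_quotient a n s @[n --> \oo] --> tpow a s.
Proof.
have h : \forall n \near \oo,
    tpow a (s - n.+1%:R^-1) <= tpow_quotient a n s <= (fun=> tpow a s) n.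
  by apply: nearW => n; exact: tpow_quotient_mean.
exact: (squeeze_cvgr h (@tpow_left_cvg a s) (cvg_cst _)).
Qed.

End truncated_powers.

(** * Potentials: truncated powers integrated against weights *)

Section potentials.
Context {R : realType} {N : nat}.

Notation T := (N.-tuple (measurableTypeR R)).
Notation pm := (power_measure (@lebesgue_measure R) N).
Implicit Types (f g u : T -> R) (t : T) (b c : bool) (al : bool -> nat) (p : bool -> R).

Definition ball_integral f : R := \int[pm]_(t in punctured_ball) f t.

Definition bounded_measurable f := measurable_fun setT f /\ bounded_fct f.

Lemma bounded_measurableM f g : bounded_measurable f -> bounded_measurable g ->
  bounded_measurable (fun t => f t * g t).
Proof. by move=> [mf bf] [mg bg]; split; [exact: measurable_funM|exact: bounded_fctM]. Qed.

Lemma bounded_measurableD f g : bounded_measurable f -> bounded_measurable g ->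
  bounded_measurable (fun t => f t + g t).
Proof. by move=> [mf bf] [mg bg]; split; [exact: measurable_funD|exact: bounded_fctD]. Qed.

Lemma bounded_measurable_cst (c : R) : bounded_measurable (fun=> c).
Proof. by split; [exact: measurable_cst|exact: bounded_fct_cst]. Qed.

Lemma bounded_measurableZ (r : R) f : bounded_measurable f ->
  bounded_measurable (fun t => r * f t).
Proof. by move=> bf; apply: bounded_measurableM => //; exact: bounded_measurable_cst. Qed.

Lemma bounded_measurableB f g : bounded_measurable f -> bounded_measurable g ->
  bounded_measurable (fun t => f t - g t).
Proof.
move=> bf /(bounded_measurableZ (-1)) bg; under eq_fun do rewrite -mulN1r.
exact: bounded_measurableD.
Qed.

Lemma bounded_measurable_integrable f : bounded_measurable f ->
  pm.-integrable punctured_ball (EFin \o f).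
Proof. by move=> [mf bf]; exact: punctured_ball_integrable. Qed.

Lemma ball_integralD f g : bounded_measurable f -> bounded_measurable g ->
  ball_integral (fun t => f t + g t) = ball_integral f + ball_integral g.
Proof.
move=> bf bg; rewrite /ball_integral RintegralD//.
- exact: measurable_punctured_ball.
- exact: bounded_measurable_integrable.
- exact: bounded_measurable_integrable.
Qed.

Lemma ball_integralZ (r : R) f : bounded_measurable f ->
  ball_integral (fun t => r * f t) = r * ball_integral f.
Proof.
move=> bf; rewrite /ball_integral RintegralZl//.
- exact: measurable_punctured_ball.
- exact: bounded_measurable_integrable.
Qed.

Lemma ball_integralB f g : bounded_measurable f -> bounded_measurable g ->
  ball_integral (fun t => f t - g t) = ball_integral f - ball_integral g.
Proof.
move=> bf bg; rewrite /ball_integral RintegralB//.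
- exact: measurable_punctured_ball.
- exact: bounded_measurable_integrable.
- exact: bounded_measurable_integrable.
Qed.

Lemma ball_integral_ge0 f : (forall t, 0 <= f t) -> 0 <= ball_integral f.
Proof. by move=> f0; apply: Rintegral_ge0 => t _. Qed.

Lemma ball_integral_bound : exists2 V : R, 0 <= V & forall f (K : R),
  bounded_measurable f -> (forall t, `|f t| <= K) -> `|ball_integral f| <= V * K.
Proof.
exists (fine (pm punctured_ball)); first exact: fine_ge0.
move=> f K bf fK.
have mb := @measurable_punctured_ball R N.
apply: (@le_trans _ _ (\int[pm]_(t in punctured_ball) `|f t|)).
  by apply: le_normr_Rintegral => //; exact: bounded_measurable_integrable.
apply: (@le_trans _ _ (\int[pm]_(t in punctured_ball) K)).
  apply: le_Rintegral => //.
  - by apply: integrable_norm; exact: bounded_measurable_integrable.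
  - exact: (bounded_measurable_integrable (bounded_measurable_cst K)).
rewrite Rintegral_cst//; last first.
  by rewrite mulrC.
Qed.

Lemma ball_integral_cvg (f_ : nat -> T -> R) f (K : R) :
  (forall n, measurable_fun setT (f_ n)) -> measurable_fun setT f ->
  (forall n t, `|f_ n t| <= K) -> (forall t, f_ n t @[n --> \oo] --> f t) ->
  ball_integral (f_ n) @[n --> \oo] --> ball_integral f.
Proof.
move=> mf_ mf fK cf.
have fb t : `|f t| <= K.
  have h : `|f_ n t| @[n --> \oo] --> `|f t| by apply: cvg_norm; exact: cf.
  rewrite -(cvg_lim _ h)//; apply: limr_le; first by apply/cvg_ex; exists `|f t|.
  by apply: nearW => n; exact: fK.
have ifin g : bounded_measurable g ->
    (\int[pm]_(t in punctured_ball) (g t)%:E = (ball_integral g)%:E)%E.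
  move=> bg; rewrite /ball_integral /Rintegral fineK//.
  apply: integrable_fin_num; first exact: measurable_punctured_ball.
  exact: bounded_measurable_integrable.
have [] := @dominated_convergence _ _ _ pm _ measurable_punctured_ball
  (fun n t => (f_ n t)%:E) (EFin \o f) (EFin \o cst K).
- by move=> n; apply/measurable_EFinP; exact: measurable_funTS.
- by apply/measurable_EFinP; exact: measurable_funTS.
- by apply: aeW => t _; apply: cvg_EFin; [exact: nearW|exact: cf].
- exact: (bounded_measurable_integrable (bounded_measurable_cst K)).
- by apply: aeW => t n _ /=; rewrite lee_fin; exact: fK.
move=> _ _ h.
have {}h : (ball_integral (f_ n))%:E @[n --> \oo] --> (ball_integral f)%:E.
  rewrite -(ifin f); last by split => //; exists K.
  rewrite (_ : (fun n => _) = [sequence (\int[pm]_(x in punctured_ball) (f_ n x)%:E)%E]_n)//.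
  by apply/funext => n /=; rewrite -ifin//; split => //; exists K.
exact: (fine_cvg h).
Qed.

Variables (H : bool -> 'I_N -> 'I_N -> R).

Definition increment c al : bool -> nat := fun b => if b == c then (al b).+1 else al b.

Definition translate c (h : R) p : bool -> R := fun b => if b == c then p b + h else p b.

Definition kernel al p : T -> R := tensor H (fun c s => tpow (al c) (s - p c)).

(* Up to sign, the iterated primitives of the image under the map [rayleigh] of the
   signed measure with density [u]. *)
Definition potential al p u : R := ball_integral (fun t => kernel al p t * u t).

Lemma measurable_tensor (phi : bool -> R -> R) : (forall c, measurable_fun setT (phi c)) ->
  measurable_fun setT (tensor H phi).
Proof.
by move=> mphi; apply: measurable_funM; (apply: (@measurableT_comp _ _ _ _ _ _ (phi _));
  [exact: mphi|exact: ratio_poly_measurable (rayleigh_poly H _)]).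
Qed.

Lemma measurable_tpow_shift a (x : R) : measurable_fun setT (fun s : R => tpow a (s - x)).
Proof.
apply: (@measurableT_comp _ _ _ _ _ _ (tpow a)); first exact: measurable_tpow.
exact: measurable_funB.
Qed.

Lemma rayleigh_bounded : exists B : R, forall c t, `|rayleigh H c t| <= B.
Proof.
have [B0 h0] := ratio_poly_bounded (rayleigh_poly H false).
have [B1 h1] := ratio_poly_bounded (rayleigh_poly H true).
by exists (Num.max B0 B1) => -[] t; rewrite le_max ?h0 ?h1 ?orbT.
Qed.

Lemma tpow_rayleigh_bounded a (x : R) c : exists B : R, forall t,
  0 <= tpow a (rayleigh H c t - x) <= B.
Proof.
have [B hB] := rayleigh_bounded.
exists (tpow a (B + `|x|)) => t; rewrite tpow_ge0/=; apply: tpow_le.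
rewrite lerD//; first by rewrite (le_trans (ler_norm _)).
by rewrite -normrN ler_norm.
Qed.

Lemma kernel_bounded_measurable al p : bounded_measurable (kernel al p).
Proof.
split; first by apply: measurable_tensor => c; exact: measurable_tpow_shift.
by apply: bounded_fctM;
  [have [B hB] := tpow_rayleigh_bounded (al false) (p false) false
  |have [B hB] := tpow_rayleigh_bounded (al true) (p true) true];
  exists B => t; have /andP[h0 h1] := hB t; rewrite ger0_norm.
Qed.

(** A forward step in the corner [p] is a backward step in the argument of the truncated power, so
    the quotients converge pointwise and boundedly, even down to the discontinuous order 0. *)
Lemma potential_quotient_cvg c al p u : bounded_measurable u ->
  n.+1%:R * (potential (increment c al) p u
             - potential (increment c al) (translate c n.+1%:R^-1 p) u)
    @[n --> \oo] --> potential al p u.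
Proof.
move=> bu; have [C hC] := bu.2.
have [B0 hB0] := tpow_rayleigh_bounded (al false) (p false) false.
have [B1 hB1] := tpow_rayleigh_bounded (al true) (p true) true.
pose phi n b (s : R) := if b == c then tpow_quotient (al b) n (s - p b) else tpow (al b) (s - p b).
have phi_le n b (s : R) : 0 <= phi n b s <= tpow (al b) (s - p b).
  rewrite /phi; case: ifP => _; last by rewrite lexx tpow_ge0.
  have /andP[h1 ->] := tpow_quotient_mean (al b) n (s - p b).
  by rewrite (le_trans _ h1)// tpow_ge0.
have mphi n b : measurable_fun setT (phi n b).
  rewrite /phi; case: (b == c); last exact: measurable_tpow_shift.
  have h2 := measurable_tpow_shift (al b).+1 (p b + n.+1%:R^-1).
  have h := measurable_funB (measurable_tpow_shift (al b).+1 (p b)) h2.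
  have hM := measurable_funM (@measurable_cst _ _ R R setT n.+1%:R) h.
  rewrite (_ : (fun s => _) = (fun s => n.+1%:R *
    (tpow (al b).+1 (s - p b) - tpow (al b).+1 (s - (p b + n.+1%:R^-1)))))//.
  by apply/funext => s; rewrite /tpow_quotient opprD addrA.
have -> : (fun n => n.+1%:R * (potential (increment c al) p u
    - potential (increment c al) (translate c n.+1%:R^-1 p) u)) =
    (fun n => ball_integral (fun t => tensor H (phi n) t * u t)).
  apply/funext => n; rewrite /potential -ball_integralB; last first.
  - by apply: bounded_measurableM => //; exact: kernel_bounded_measurable.
  - by apply: bounded_measurableM => //; exact: kernel_bounded_measurable.
  rewrite -ball_integralZ; last first.
    by apply: bounded_measurableB; apply: bounded_measurableM => //;
      exact: kernel_bounded_measurable.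
  congr ball_integral; apply/funext => t.
  rewrite /kernel /tensor /phi /increment /translate /tpow_quotient.
  by case: (c) => /=; rewrite opprD addrA; ring.
apply: (@ball_integral_cvg _ _ (B0 * B1 * C)).
- by move=> n; apply: measurable_funM; [exact: measurable_tensor|exact: bu.1].
- by apply: measurable_funM; [exact: (kernel_bounded_measurable _ _).1|exact: bu.1].
- move=> n t; rewrite normrM ler_pM// /tensor normrM.
  have /andP[f0 f1] := phi_le n false (rayleigh H false t).
  have /andP[g0 g1] := phi_le n true (rayleigh H true t).
  have /andP[_ k0] := hB0 t; have /andP[_ k1] := hB1 t.
  by rewrite !ger0_norm// ler_pM// ?(le_trans f1) ?(le_trans g1).
- move=> t; apply: cvgM; last exact: cvg_cst.
  have cphi b (s : R) : phi n b s @[n --> \oo] --> tpow (al b) (s - p b).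
    by rewrite /phi; case: (b == c); [exact: tpow_quotient_cvg|exact: cvg_cst].
  by apply: cvgM; exact: cphi.
Qed.

Hypothesis Hsym : forall b i j, H b i j = H b j i.
Variables (z : bool -> R) (kappa : R) (th : nat -> R -> R).
Hypothesis kappa_gt0 : 0 < kappa.
Hypothesis kappa_le : forall t, sqn t != 0 -> kappa <= gram_det H t + dist2 H z t.
Hypothesis th_derive : forall m (x : R), is_derive x 1 (th m) (th m.+1 x).
Hypothesis th_neg : forall m (x : R), x <= 0 -> th m x = 0.
Hypothesis th_one : forall x : R, 1 <= x -> th 0 x = 1.
Hypothesis th_bounded : forall m, exists C : R, forall x, `|th m x| <= C.

Notation weight := (weight H z kappa th).

Lemma weight_bounded_measurable u : weight u -> bounded_measurable u.
Proof.
by move=> wu; split; [apply: weight_measurable wu|apply: weight_bounded wu].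
Qed.

(** At orders at least 2 the kernels are regular enough for [weight_transport]. The new weight does
    not depend on order or corner, so difference quotients in [p] carry the identity to lower
    orders. *)
Lemma potential_transport b u : weight u -> exists2 u', weight u' &
  forall al p, potential al p u = potential (increment b al) p u'.
Proof.
move=> wu.
have [u' wu' hu'] := weight_transport Hsym kappa_gt0 kappa_le th_derive th_neg
  th_one th_bounded b wu.
exists u' => //.
have bu := weight_bounded_measurable wu; have bu' := weight_bounded_measurable wu'.
have large al p : (forall c, (2 <= al c)%N) ->
    potential al p u = potential (increment b al) p u'.
  move=> al2.
  have al2' c : increment b al c = (increment b al c).-2.+2.
    by have := al2 c; rewrite /increment; case: ifP => _; case: (al c) => [|[|]].
  pose phi c (s : R) := tpow (increment b al c) (s - p c).
  pose phi' c (s : R) := tpow (increment b al c).-1 (s - p c).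
  transitivity (ball_integral (fun t => tensor_derive H phi phi' b t * u t)); last apply: hu'.
  - congr ball_integral; apply/funext => t; congr (_ * _).
    by rewrite /kernel /phi /phi' /tensor_derive /tensor /increment; case: (b).
  - move=> c x; rewrite /phi /phi' al2'.
    have d := deriv1D (deriv1_id x) (deriv1_cst (- p c) x).
    have := @deriv1_comp _ (tpow (increment b al c).-2.+2) (fun s : R => s - p c) x _ _
      (is_derive_tpow _ _) d.
    by move/deriv1_eq; apply; rewrite addr0 mulr1.
  - move=> c x; rewrite /phi' al2'.
    apply: (@continuous_comp _ _ _ (fun s : R => s - p c) (tpow (increment b al c).-2.+1)).
      by apply: cvgB; [exact: cvg_id|exact: cvg_cst].
    exact: tpow_continuous.
have incC c al : increment b (increment c al) = increment c (increment b al).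
  by apply/funext => e; rewrite /increment; case: (e == b); case: (e == c).
have reduce c al :
    (forall p, potential (increment c al) p u = potential (increment b (increment c al)) p u') ->
    forall p, potential al p u = potential (increment b al) p u'.
  move=> h p; have h1 := @potential_quotient_cvg c al p u bu.
  have h2 := @potential_quotient_cvg c (increment b al) p u' bu'.
  suff h3 : n.+1%:R * (potential (increment c al) p u
      - potential (increment c al) (translate c n.+1%:R^-1 p) u)
      @[n --> \oo] --> potential (increment b al) p u'.
    by have := cvg_unique _ h1 h3; apply.
  by under eq_fun do rewrite !h incC.
(* Two raises in each variable make every order at least 2. *)
move=> al; do 2 apply: (reduce false); do 2 apply: (reduce true).
by move=> p; apply: large => -[].
Qed.

End potentials.

(** * Smoothness of potentials of order (2, 2) *)

Section smoothness.
Context {R : realType} {N : nat}.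

Notation T := (N.-tuple (measurableTypeR R)).
Implicit Types (f g u : T -> R) (t : T) (b c : bool) (al : bool -> nat) (p : bool -> R).

Definition point (x : R * R) : bool -> R := fun b => if b then x.2 else x.1.

(** The error splits into three terms carrying a remainder c h^2 times at most K, whence 3 K c, and
    the cross term h^2 a b, whence K^2. *)
Lemma product_taylor (A B A0 B0 a b c K h : R) : `|h| <= 1 ->
  `|A - A0 - h * a| <= c * h ^+ 2 -> `|B - B0 - h * b| <= c * h ^+ 2 ->
  `|A0| <= K -> `|B| <= K -> `|a| <= K -> `|b| <= K ->
  `|A * B - A0 * B0 - h * (a * B0 + A0 * b)| <= (3 * K * c + K ^+ 2) * h ^+ 2.
Proof.
move=> h1 hA hB kA kB ka kb.
have K0 : 0 <= K by apply: le_trans ka.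
have -> : A * B - A0 * B0 - h * (a * B0 + A0 * b) =
  (A - A0 - h * a) * B + A0 * (B - B0 - h * b) + h * a * (B - B0 - h * b) + h ^+ 2 * (a * b).
  by ring.
have ch0 : 0 <= c * h ^+ 2 by apply: le_trans hA.
have e1 : `|(A - A0 - h * a) * B| <= c * h ^+ 2 * K by rewrite normrM ler_pM.
have e2 : `|A0 * (B - B0 - h * b)| <= K * (c * h ^+ 2) by rewrite normrM ler_pM.
have e3 : `|h * a * (B - B0 - h * b)| <= 1 * K * (c * h ^+ 2).
  by rewrite !normrM ler_pM ?mulr_ge0// ler_pM.
have e4 : `|h ^+ 2 * (a * b)| <= h ^+ 2 * (K * K).
  by rewrite normrM ger0_norm ?sqr_ge0// ler_wpM2l ?sqr_ge0// normrM ler_pM.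
rewrite (le_trans (ler_normD _ _))// (_ : _ * h ^+ 2 =
  (c * h ^+ 2 * K + K * (c * h ^+ 2) + 1 * K * (c * h ^+ 2)) + h ^+ 2 * (K * K)); last by ring.
rewrite lerD// (le_trans (ler_normD _ _))// lerD// (le_trans (ler_normD _ _))// lerD//.
Qed.

Variables (H : bool -> 'I_N -> 'I_N -> R).
Hypothesis Hsym : forall b i j, H b i j = H b j i.
Variables (z : bool -> R) (kappa : R) (th : nat -> R -> R).
Hypothesis kappa_gt0 : 0 < kappa.
Hypothesis kappa_le : forall t, sqn t != 0 -> kappa <= gram_det H t + dist2 H z t.
Hypothesis th_derive : forall m (x : R), is_derive x 1 (th m) (th m.+1 x).
Hypothesis th_neg : forall m (x : R), x <= 0 -> th m x = 0.
Hypothesis th_one : forall x : R, 1 <= x -> th 0 x = 1.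
Hypothesis th_bounded : forall m, exists C : R, forall x, `|th m x| <= C.

Notation weight := (weight H z kappa th).

Definition potential2 u (x : R * R) : R := potential H (fun=> 2%N) (point x) u.

Let bmw u : weight u -> bounded_measurable u.
Proof. by move=> wu; apply: weight_bounded_measurable wu. Qed.

Let bmk al p u : weight u -> bounded_measurable (fun t => kernel H al p t * u t).
Proof.
move=> wu; apply: bounded_measurableM; last exact: bmw.
exact: kernel_bounded_measurable.
Qed.

Let potentialD al p u v : weight u -> weight v ->
  potential H al p (fun t => u t + v t) = potential H al p u + potential H al p v.
Proof.
move=> wu wv; rewrite /potential -ball_integralD; [|exact: bmk..].
by congr ball_integral; apply/funext => t; rewrite mulrDr.
Qed.

Lemma potentialZ al p (r : R) u : bounded_measurable u ->
  potential H al p (fun t => r * u t) = r * potential H al p u.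
Proof.
move=> bu; rewrite /potential -ball_integralZ.
  by congr ball_integral; apply/funext => t; rewrite mulrCA.
by apply: bounded_measurableM => //; exact: kernel_bounded_measurable.
Qed.

(** The kernel expands with a quadratic remainder uniform in t, so differentiation passes under the
    integral and lowers one order to 1. Transport in that variable brings it back to 2, which keeps
    the derivative in the same class. *)
Lemma potential2_derive u v : weight u -> exists2 u', weight u' &
  forall x, is_derive x v (potential2 u) (potential2 u' x).
Proof.
move=> wu.
have [u0 wu0 hu0] := potential_transport Hsym kappa_gt0 kappa_le th_derive th_neg
  th_one th_bounded false wu.
have [u1 wu1 hu1] := potential_transport Hsym kappa_gt0 kappa_le th_derive th_neg
  th_one th_bounded true wu.
exists (fun t => (- v.1) * u0 t + (- v.2) * u1 t).
  by apply: weightD; exact: weightZ.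
move=> x; have [B hB] := @rayleigh_bounded R N H.
(* The orders (1, 2) and (2, 1) left after differentiating in the first, resp. second, coordinate of
   the corner. *)
pose al0 b : nat := if b then 2 else 1.
pose al1 b : nat := if b then 1 else 2.
have -> : potential2 (fun t => (- v.1) * u0 t + (- v.2) * u1 t) x =
   (- v.1) * potential H al0 (point x) u + (- v.2) * potential H al1 (point x) u.
  rewrite /potential2 potentialD; [|exact: weightZ..].
  rewrite potentialZ ?potentialZ; [|exact: bmw..].
  by rewrite hu0 hu1.
(* Bounds the arguments of the truncated powers for both corners x and x + h v, since |h| <= 1. *)
pose M := B + (`|x.1| + `|x.2| + `|v.1| + `|v.2|).
have [C hC] := (bmw wu).2.
have [V V0 hV] := @ball_integral_bound R N.
pose K := (tpow 2 M + tpow 1 M + tpow 1 M * (`|v.1| + `|v.2|)).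
pose c := v.1 ^+ 2 + v.2 ^+ 2.
pose D := 3 * K * c + K ^+ 2.
apply: (@is_derive_quadratic _ _ _ _ _ _ (V * (D * C))) => h h1.
rewrite /potential2 /potential -!ball_integralZ; [|exact: bmk..].
have bk0 := bmk al0 (point x) wu; have bk1 := bmk al1 (point x) wu.
have bl : bounded_measurable (fun t => (- v.1) * (kernel H al0 (point x) t * u t)
    + (- v.2) * (kernel H al1 (point x) t * u t)).
  by apply: bounded_measurableD; exact: bounded_measurableZ.
rewrite -ball_integralD; [|exact: bounded_measurableZ..].
rewrite -ball_integralZ//.
rewrite -ball_integralB; [|exact: bmk..].
have bd := bounded_measurableB (bmk (fun=> 2%N) (point (h *: v + x)) wu)
  (bmk (fun=> 2%N) (point x) wu).
rewrite -ball_integralB//; last exact: bounded_measurableZ.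
rewrite [leRHS](_ : _ = V * (D * h ^+ 2 * C)); last by ring.
apply: hV.
  by apply: bounded_measurableB => //; exact: bounded_measurableZ.
move=> t.
set k2 := kernel H _ (point (h *: v + x)) t; set k := kernel H _ (point x) t.
set k0 := kernel H al0 _ _; set k1 := kernel H al1 _ _.
rewrite (_ : _ - _ = (k2 - k - h * ((- v.1) * k0 + (- v.2) * k1)) * u t); last by ring.
have cM b s : `|s| <= `|x.1| + `|x.2| + `|v.1| + `|v.2| -> `|rayleigh H b t - s| <= M.
  by move=> hs; rewrite (le_trans (ler_normB _ _))// lerD.
have nx1 := normr_ge0 x.1; have nx2 := normr_ge0 x.2.
have nv1 := normr_ge0 v.1; have nv2 := normr_ge0 v.2.
have hv w : `|h * w| <= `|w| by rewrite normrM ler_piMl.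
have S0M := cM false x.1 ltac:(lra); have S1M := cM true x.2 ltac:(lra).
have r0M : `|rayleigh H false t - (h * v.1 + x.1)| <= M.
  apply: cM; have := ler_normD (h * v.1) x.1; have := hv v.1; lra.
have r1M : `|rayleigh H true t - (h * v.2 + x.2)| <= M.
  apply: cM; have := ler_normD (h * v.2) x.2; have := hv v.2; lra.
have p0 := tpow_ge0 2 M; have p1 := tpow_ge0 1 M.
have pv0 : 0 <= tpow 1 M * `|v.1| by exact: mulr_ge0.
have pv1 : 0 <= tpow 1 M * `|v.2| by exact: mulr_ge0.
have tM a s : `|s| <= M -> `|tpow a s| <= tpow a M.
  by move=> sM; rewrite ger0_norm ?tpow_ge0// tpow_le// (le_trans (ler_norm _)).
have tay s w : `|s| <= M -> `|s - h * w| <= M ->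
    `|tpow 2 (s - h * w) - tpow 2 s - h * (- w * tpow 1 s)| <= w ^+ 2 * h ^+ 2.
  move=> sM rM; have := tpow_taylor 0 sM rM.
  rewrite (_ : s - h * w - s = - (h * w)); last by ring.
  rewrite (_ : - (h * w) * tpow 1 s = h * (- w * tpow 1 s)); last by ring.
  move/le_trans; apply; rewrite sqrrN exprMn [leRHS]mulrC.
  by rewrite ler_piMl ?tpow0_le1// mulr_ge0// sqr_ge0.
rewrite normrM ler_pM//.
rewrite (_ : (- v.1) * k0 + (- v.2) * k1 =
  (- v.1 * tpow 1 (rayleigh H false t - x.1)) * tpow 2 (rayleigh H true t - x.2) +
  tpow 2 (rayleigh H false t - x.1) * (- v.2 * tpow 1 (rayleigh H true t - x.2))); last first.
  by rewrite /k0 /k1 /kernel /tensor /=; ring.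
have hs : 0 <= h ^+ 2 := sqr_ge0 h.
have hr0 : rayleigh H false t - (h * v.1 + x.1) = rayleigh H false t - x.1 - h * v.1 by ring.
have hr1 : rayleigh H true t - (h * v.2 + x.2) = rayleigh H true t - x.2 - h * v.2 by ring.
rewrite hr0 in r0M; rewrite hr1 in r1M.
rewrite /k2 /k /kernel /tensor/= -[h *: v.1]/(h * v.1) -[h *: v.2]/(h * v.2) hr0 hr1.
apply: product_taylor => //.
- apply: le_trans (tay _ _ S0M r0M) _; rewrite ler_wpM2r// lerDl sqr_ge0//.
- apply: le_trans (tay _ _ S1M r1M) _; rewrite ler_wpM2r// lerDr sqr_ge0//.
- by apply: le_trans (tM _ _ S0M) _; rewrite /K; lra.
- by apply: le_trans (tM _ _ r1M) _; rewrite /K; lra.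
- rewrite normrM normrN; have h0 := tM 1 _ S0M.
  have : `|v.1| * `|tpow 1 (rayleigh H false t - x.1)| <= `|v.1| * tpow 1 M by rewrite ler_wpM2l.
  by rewrite /K; lra.
- rewrite normrM normrN; have h0 := tM 1 _ S1M.
  have : `|v.2| * `|tpow 1 (rayleigh H true t - x.2)| <= `|v.2| * tpow 1 M by rewrite ler_wpM2l.
  by rewrite /K; lra.
Qed.

(** Directional derivatives do not give joint continuity; a Lipschitz bound on the kernel in x,
    uniform in t, does. *)
Lemma potential2_continuous u : weight u -> continuous (potential2 u).
Proof.
move=> wu x; have [B hB] := @rayleigh_bounded R N H.
pose M := B + (`|x.1| + `|x.2| + 1).
have [C hC] := (bmw wu).2.
have [V V0 hV] := @ball_integral_bound R N.
have nx1 := normr_ge0 x.1; have nx2 := normr_ge0 x.2.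
have p1 := tpow_ge0 1 M; have p2 := tpow_ge0 2 M.
have key y : `|x - y| <= 1 ->
    `|potential2 u x - potential2 u y| <= V * (2 * tpow 1 M * tpow 2 M * `|x - y| * C).
  move=> xy; rewrite /potential2 /potential -ball_integralB; [|exact: bmk..].
  apply: hV; first by apply: bounded_measurableB; exact: bmk.
  move=> t; rewrite -mulrBl normrM ler_pM//.
  have xy1 : `|x.1 - y.1| <= `|x - y| by rewrite [leRHS]prod_normE le_max lexx.
  have xy2 : `|x.2 - y.2| <= `|x - y| by rewrite [leRHS]prod_normE le_max lexx orbT.
  have cM b s : `|s| <= `|x.1| + `|x.2| + 1 -> `|rayleigh H b t - s| <= M.
    by move=> hs; rewrite (le_trans (ler_normB _ _))// lerD.
  have S0M := cM false x.1 ltac:(lra); have S1M := cM true x.2 ltac:(lra).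
  have r0M : `|rayleigh H false t - y.1| <= M.
    apply: cM; have := ler_normB x.1 (x.1 - y.1); rewrite subKr; lra.
  have r1M : `|rayleigh H true t - y.2| <= M.
    apply: cM; have := ler_normB x.2 (x.2 - y.2); rewrite subKr; lra.
  have tM a s : `|s| <= M -> `|tpow a s| <= tpow a M.
    by move=> sM; rewrite ger0_norm ?tpow_ge0// tpow_le// (le_trans (ler_norm _)).
  have lip s w w' : `|s - w| <= M -> `|s - w'| <= M -> `|w - w'| <= `|x - y| ->
      `|tpow 2 (s - w) - tpow 2 (s - w')| <= tpow 1 M * `|x - y|.
    move=> h1 h2 h3; apply: le_trans (tpow_lip 1 h1 h2) _.
    rewrite ler_wpM2l// (_ : s - w - (s - w') = w' - w); last by ring.
    by rewrite distrC.
  rewrite /kernel /tensor/=.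
  set A := tpow 2 (_ - x.1); set A' := tpow 2 (_ - y.1).
  set E := tpow 2 (_ - x.2); set E' := tpow 2 (_ - y.2).
  rewrite (_ : A * E - A' * E' = (A - A') * E + A' * (E - E')); last by ring.
  rewrite (le_trans (ler_normD _ _))//.
  rewrite (_ : 2 * _ * _ * _ =
    tpow 1 M * `|x - y| * tpow 2 M + tpow 2 M * (tpow 1 M * `|x - y|)); last by ring.
  by rewrite !normrM lerD// ler_pM// ?lip ?tM.
have C0 : 0 <= `|C| by [].
pose L := V * (2 * tpow 1 M * tpow 2 M * `|C|) + 1.
have L0 : 0 < L by rewrite ltr_wpDl// !mulr_ge0.
apply/cvgrPdist_le => e e0; near=> y.
have y1 : `|x - y| <= 1 by near: y; apply: cvgr_dist_le => //; exact: cvg_id.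
have y2 : `|x - y| <= e / L.
  by near: y; apply: cvgr_dist_le; [exact: cvg_id|exact: divr_gt0].
apply: le_trans (key y y1) _.
rewrite ler_pdivlMr// in y2; apply: le_trans y2.
rewrite (_ : V * _ = `|x - y| * (V * (2 * tpow 1 M * tpow 2 M * C))); last by ring.
rewrite ler_wpM2l// /L ler_wpDr// ler_wpM2l// ler_wpM2l ?mulr_ge0// ler_norm//.
Unshelve. all: by end_near.
Qed.

Lemma potential2_smooth u : weight u -> smooth_on setT (potential2 u).
Proof.
move=> wu s x _.
have [u' wu' ->] : exists2 u', weight u' & iter_derive (potential2 u) s = potential2 u'.
  elim: s => [|v s [u' wu' IH]]; first by exists u.
  have [u'' wu'' du''] := potential2_derive v wu'.
  exists u'' => //; apply/funext => y; rewrite /= -/(iter_derive _ s) IH.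
  by case: (du'' y).
split; first exact: potential2_continuous.
by move=> v; have [u'' _ du''] := potential2_derive v wu'; case: (du'' x).
Qed.

End smoothness.

(** * The smooth density *)

Section image_density.
Local Open Scope ereal_scope.
Context d d' (X : measurableType d) (Y : measurableType d') (R : realType).
Variables (mu : {measure set X -> \bar R}) (phi : X -> Y) (f : X -> \bar R).

(** The image under [phi] of the measure with density [f]. The proofs are arguments so that the
    measure structure can be attached canonically. *)
Definition image_density of measurable_fun setT phi & measurable_fun setT f
    & (forall x, 0 <= f x) : set Y -> \bar R :=
  fun B => \int[mu]_(x in phi @^-1` B) f x.

Hypotheses (mphi : measurable_fun setT phi) (mf : measurable_fun setT f)
  (f0 : forall x, 0 <= f x).

Let image_density0 : image_density mphi mf f0 set0 = 0.
Proof. by rewrite /image_density preimage_set0 integral_set0. Qed.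

Let image_density_ge0 B : 0 <= image_density mphi mf f0 B.
Proof. exact: integral_ge0. Qed.

Let image_density_sigma_additive : semi_sigma_additive (image_density mphi mf f0).
Proof.
move=> /= F mF tF mUF; rewrite /image_density; apply: cvg_toP.
  apply: ereal_nondecreasing_is_cvgn => m n mn.
  by apply: lee_sum_nneg_natr => // k _ _; apply: integral_ge0.
rewrite preimage_bigcup ge0_integral_bigcup//=.
- by move=> k; rewrite -[X in measurable X]setTI; exact: mphi.
- exact: measurable_funTS.
- apply/trivIsetP => i j _ _ ij; rewrite -preimage_setI.
  by move/trivIsetP : tF => ->//; rewrite preimage_set0.
Qed.

HB.instance Definition _ := isMeasure.Build _ _ _ (image_density mphi mf f0)
  image_density0 image_density_ge0 image_density_sigma_additive.

End image_density.

Section quadrants.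
Context {R : realType}.

Let exists_nat_gt (x : R) : exists n : nat, x < n%:R.
Proof.
by exists (Num.bound `|x|); rewrite (le_lt_trans (ler_norm _))// archi_boundP.
Qed.

Notation R2 := (measurableTypeR R * measurableTypeR R)%type.

Definition quadrant (p : bool -> R) : set R2 := `]p false, +oo[%classic `*` `]p true, +oo[%classic.

(* The canonical sigma-finite structure found on a product measure is the one for
   subprobabilities, hence this copy. *)
Definition lebesgue_plane : set R2 -> \bar R :=
  (@lebesgue_measure R \x @lebesgue_measure R)%E.

HB.instance Definition _ := Measure.on lebesgue_plane.

Let lebesgue_plane_sigma_finite : sigma_finite setT lebesgue_plane.
Proof.
pose I (n : nat) : set (measurableTypeR R) := `[- n%:R, n%:R]%classic.
exists (fun n => I n `*` I n).
  apply/esym/seteqP; split => // x _.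
  have [n] := exists_nat_gt (Num.max `|x.1| `|x.2|).
  rewrite gt_max => /andP[h1 h2]; exists n => //.
  by split; rewrite /I /= in_itv/= -ler_norml ltW.
move=> n; split; first by apply: measurableX; exact: measurable_itv.
rewrite /lebesgue_plane product_measure1E; [|exact: measurable_itv..].
have lI : (@lebesgue_measure R (I n) < +oo)%E.
  by rewrite /I lebesgue_measure_itv/=; case: ifP => _; rewrite ?ltry.
by apply: lte_mul_pinfty => //; rewrite ge0_fin_numE.
Qed.

HB.instance Definition _ := Measure_isSigmaFinite.Build _ _ _ lebesgue_plane
  lebesgue_plane_sigma_finite.

Let quadrants : set (set R2) := range quadrant.

Lemma measurable_quadrant p : measurable (quadrant p).
Proof. by apply: measurableX; exact: measurable_itv. Qed.

Lemma quadrantE p (x : R2) : quadrant p x <-> p false < x.1 /\ p true < x.2.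
Proof. by rewrite /quadrant /= !in_itv/= !andbT. Qed.

(** It suffices that both projections be measurable for the generated algebra: the inverse image of
    a half-line is the union of the quadrants whose other corner coordinate is -n. *)
Let quadrants_generate : @measurable _ R2 = <<s quadrants >>.
Proof.
apply/seteqP; split; last first.
  apply: smallest_sub; first exact: sigma_algebra_measurable.
  by move=> _ [p _ <-]; exact: measurable_quadrant.
have msub : forall B : set R2, quadrants B -> (quadrants).-sigma.-measurable B.
  by move=> B qB; exact: sub_sigma_algebra.
have mfst : measurable_fun (setT : set (g_sigma_algebraType quadrants))
    (fst : g_sigma_algebraType quadrants -> measurableTypeR R).
  apply: (measurability _ (RGenOInfty.measurableE R)) => _ [_ [x ->] <-].
  rewrite setTI (_ : _ @^-1` _ =
    \bigcup_n quadrant (fun b => if b then - n%:R else x)); last first.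
    apply/seteqP; split => [y /= xy|y [n _] /quadrantE[xy _] /=].
      rewrite in_itv/= andbT in xy.
      have [n hn] := exists_nat_gt (- y.2).
      by exists n => //; apply/quadrantE; split=> //=; rewrite ltrNl.
    by rewrite in_itv/= xy.
  by apply: bigcupT_measurable => n; apply: msub; exists (fun b => if b then - n%:R else x).
have msnd : measurable_fun (setT : set (g_sigma_algebraType quadrants))
    (snd : g_sigma_algebraType quadrants -> measurableTypeR R).
  apply: (measurability _ (RGenOInfty.measurableE R)) => _ [_ [x ->] <-].
  rewrite setTI (_ : _ @^-1` _ =
    \bigcup_n quadrant (fun b => if b then x else - n%:R)); last first.
    apply/seteqP; split => [y /= xy|y [n _] /quadrantE[_ xy] /=].
      rewrite in_itv/= andbT in xy.
      have [n hn] := exists_nat_gt (- y.1).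
      by exists n => //; apply/quadrantE; split=> //=; rewrite ltrNl.
    by rewrite in_itv/= xy.
  by apply: bigcupT_measurable => n; apply: msub; exists (fun b => if b then x else - n%:R).
rewrite measurable_prod_measurableType.
apply: smallest_sub; first exact: smallest_sigma_algebra.
move=> _ [A mA [B mB <-]].
have := measurableI _ _ (mfst measurableT _ mA) (msnd measurableT _ mB).
rewrite !setTI.
by congr (<<s _ >> _).
Qed.

(** Quadrants form a pi-system of finite mass, and those with corners (-n, -n) exhaust the plane. *)
Lemma quadrant_measure_unique (m1 m2 : {measure set R2 -> \bar R}) :
  (forall p, m1 (quadrant p) = m2 (quadrant p)) ->
  (forall p, (m1 (quadrant p) < +oo)%E) ->
  forall A, measurable A -> m1 A = m2 A.
Proof.
move=> m12 m1oo A mA.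
apply: (measure_unique quadrants (fun n => quadrant (fun=> - n%:R))) => //.
- move=> _ _ [p _ <-] [q _ <-].
  exists (fun b => Num.max (p b) (q b)) => //; apply/seteqP; split => x.
    move=> /quadrantE; rewrite !gt_max => -[/andP[? ?] /andP[? ?]].
    by split; apply/quadrantE.
  move=> [/quadrantE[? ?] /quadrantE[? ?]]; apply/quadrantE; rewrite !gt_max.
  by split; apply/andP.
- by move=> n; exists (fun=> - n%:R).
- apply/seteqP; split => // x _.
  pose M := Num.max (- x.1) (- x.2).
  have [n] := exists_nat_gt M; rewrite gt_max => /andP[h1 h2].
  by exists n => //; apply/quadrantE; split; rewrite ltrNl.
- by move=> _ [p _ <-].
Qed.

End quadrants.

(** * Tail functions and their integrals over quadrants *)

Section smooth_density.
Context {R : realType} {N : nat}.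

Notation T := (N.-tuple (measurableTypeR R)).
Notation R2 := (measurableTypeR R * measurableTypeR R)%type.
Notation leb := (@lebesgue_measure R).
Notation leb2 := (@lebesgue_plane R).
Notation pm := (power_measure leb N).
Implicit Types (f g u v : T -> R) (t : T) (b c : bool) (al : bool -> nat) (p : bool -> R).

Variables (H : bool -> 'I_N -> 'I_N -> R).

Definition rayleigh_map t : R2 := (rayleigh H false t, rayleigh H true t).

(** The signed mass that [u] gives to the quadrant with corner x; it will turn out to be the density
    itself, for a suitable weight. *)
Definition tail_integral u (x : R2) : R := potential H (fun=> 0%N) (point x) u.

Lemma measurable_rayleigh c : measurable_fun setT (rayleigh H c).
Proof. exact: ratio_poly_measurable (rayleigh_poly H c). Qed.

Lemma measurable_rayleigh_map : measurable_fun setT rayleigh_map.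
Proof. by apply: measurable_fun_pair; exact: measurable_rayleigh. Qed.

Let measurable_kernel0 : measurable_fun [set: T * R2]
  (fun y => kernel H (fun=> 0%N) (point y.2) y.1).
Proof.
apply: measurable_funM => /=.
  apply: (@measurableT_comp _ _ _ _ _ _ (@tpow R 0)); first exact: measurable_tpow.
  apply: measurable_funB.
    by apply: (measurableT_comp (measurable_rayleigh _)).
  by apply: (measurableT_comp measurable_fst).
apply: (@measurableT_comp _ _ _ _ _ _ (@tpow R 0)); first exact: measurable_tpow.
apply: measurable_funB.
  by apply: (measurableT_comp (measurable_rayleigh _)).
by apply: (measurableT_comp measurable_snd).
Qed.

Let indic_ball_integral f : bounded_measurable f ->
  (\int[pm]_t (\1_punctured_ball t * f t)%:E = (ball_integral f)%:E)%E.
Proof.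
move=> bf; rewrite /ball_integral /Rintegral fineK; last first.
  apply: integrable_fin_num; first exact: measurable_punctured_ball.
  exact: bounded_measurable_integrable.
rewrite [RHS]integral_mkcond; apply: eq_integral => t _.
by rewrite patchE indicE; case: ifP => _; rewrite ?mul1r ?mul0r.
Qed.

Let kernel_bm al p v : bounded_measurable v ->
  bounded_measurable (fun t => kernel H al p t * v t).
Proof. by move=> bv; apply: bounded_measurableM => //; exact: kernel_bounded_measurable. Qed.

(** For fixed t the integrand is the indicator of a rectangle with sides from [p] to the Rayleigh
    quotients; its area is a product of two [tpow 1]. *)
Let integral_quadrant_kernel p t :
  (\int[leb2]_x (\1_(quadrant p) x * kernel H (fun=> 0%N) (point x) t)%:E =
   (kernel H (fun=> 1%N) p t)%:E)%E.
Proof.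
pose I0 := `]p false, rayleigh H false t[%classic.
pose I1 := `]p true, rayleigh H true t[%classic.
have E (x : R2) : \1_(quadrant p) x * kernel H (fun=> 0%N) (point x) t = \1_(I0 `*` I1) x.
  have tE (s y : R) : tpow 0 (s - y) = ((y < s)%R)%:R.
    by rewrite /tpow subr_gt0 expr0 divr1; case: ifP.
  rewrite /kernel /tensor /= !tE !indicE -natrM mulnb -natrM mulnb.
  congr ((nat_of_bool _)%:R); apply/idP/idP.
    move=> /andP[/set_mem/quadrantE[h1 h2] /andP[h3 h4]]; rewrite inE.
    by split; rewrite /I0 /I1 /= in_itv/=; apply/andP.
  rewrite inE /I0 /I1 /= !in_itv/= => -[/andP[h1 h2] /andP[h3 h4]].
  rewrite h2 h4 !andbT; apply/mem_set/quadrantE; by split.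
under eq_integral do rewrite E.
rewrite integral_indic ?setIT//; last by apply: measurableX; exact: measurable_itv.
transitivity (leb I0 * leb I1)%E; first by apply: product_measure1E; exact: measurable_itv.
rewrite /I0 /I1 !lebesgue_measure_itv/= !lte_fin /kernel /tensor.
rewrite /tpow !subr_gt0 !expr1 !divr1 EFinM.
by congr (_ * _)%E; case: ifP.
Qed.

Let tail_integrand p v (y : T * R2) : \bar R :=
  ((\1_punctured_ball y.1 * v y.1) *
   (\1_(quadrant p) y.2 * kernel H (fun=> 0%N) (point y.2) y.1))%:E.

Let measurable_tail_integrand p v : bounded_measurable v ->
  measurable_fun setT (tail_integrand p v).
Proof.
move=> [mv _]; apply/measurable_EFinP; apply: measurable_funM.
  apply: (@measurableT_comp _ _ _ _ _ _ (fun t => \1_punctured_ball t * v t)) => //.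
  by apply: measurable_funM => //; apply: measurable_indic; exact: measurable_punctured_ball.
apply: measurable_funM => //.
apply: (@measurableT_comp _ _ _ _ _ _ (\1_(quadrant p) : R2 -> R)) => //.
by apply: measurable_indic; exact: measurable_quadrant.
Qed.

Let tail_integral_quadrant p v (x : R2) : bounded_measurable v ->
  (\int[pm]_t tail_integrand p v (t, x) = (\1_(quadrant p) x * tail_integral v x)%:E)%E.
Proof.
move=> bv; rewrite /tail_integral /potential -ball_integralZ; last exact: kernel_bm.
rewrite -indic_ball_integral; last by apply: bounded_measurableZ; exact: kernel_bm.
by apply: eq_integral => t _; rewrite /tail_integrand/=; congr EFin; ring.
Qed.

Let tail_integrand_ge0 p v : (forall t, 0 <= v t) -> forall y, (0 <= tail_integrand p v y)%E.
Proof.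
move=> v0 y; rewrite lee_fin mulr_ge0// mulr_ge0// /kernel /tensor.
by rewrite mulr_ge0// tpow_ge0.
Qed.

Let measurable_indic_tail_integral p v : bounded_measurable v -> (forall t, 0 <= v t) ->
  measurable_fun setT (fun x : R2 => \1_(quadrant p) x * tail_integral v x).
Proof.
move=> bv v0; apply/measurable_EFinP.
have := @measurable_fun_fubini_tonelli_G _ _ _ _ _ pm _
  (measurable_tail_integrand p bv) (tail_integrand_ge0 p v0).
congr (measurable_fun _ _); apply/funext => x.
exact: tail_integral_quadrant.
Qed.

(* The primitive of the indicator of the positive reals is [tpow 1], so Tonelli's
   theorem integrates the tail function over a quadrant. *)
Let ge0_integral_tail p v : bounded_measurable v -> (forall t, 0 <= v t) ->
  (\int[leb2]_(x in quadrant p) (tail_integral v x)%:E =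
   (potential H (fun=> 1%N) p v)%:E)%E.
Proof.
move=> bv v0.
transitivity (\int[leb2]_x \int[pm]_t tail_integrand p v (t, x))%E.
  rewrite integral_mkcond; apply: eq_integral => x _.
  rewrite tail_integral_quadrant// patchE indicE.
  by case: ifP => _; rewrite ?mul1r ?mul0r.
transitivity (\int[pm]_t \int[leb2]_x tail_integrand p v (t, x))%E.
  exact/esym/(@fubini_tonelli _ _ _ _ _ pm leb2 (tail_integrand p v)
    (measurable_tail_integrand p bv) (tail_integrand_ge0 p v0)).
rewrite /potential -indic_ball_integral; last exact: kernel_bm.
apply: eq_integral => t _ /=.
rewrite /tail_integrand/=.
under eq_integral do rewrite EFinM.
rewrite ge0_integralZl//; last 2 first.
- by move=> x _; rewrite lee_fin mulr_ge0// /kernel /tensor mulr_ge0// tpow_ge0.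
- by rewrite lee_fin mulr_ge0.
  rewrite integral_quadrant_kernel -EFinM; congr EFin; ring.
apply/measurable_EFinP; apply: measurable_funM.
  by apply: measurable_indic; exact: measurable_quadrant.
exact: (measurableT_comp measurable_kernel0 (pair1_measurable t)).
Qed.

Let tail_integralB u v (x : R2) : bounded_measurable u -> bounded_measurable v ->
  tail_integral (fun t => u t - v t) x = tail_integral u x - tail_integral v x.
Proof.
move=> bu bv; rewrite /tail_integral /potential -ball_integralB; [|exact: kernel_bm..].
by congr ball_integral; apply/funext => t; rewrite mulrBr.
Qed.

Lemma integral_tail p u : bounded_measurable u -> (forall x, 0 <= tail_integral u x) ->
  measurable_fun setT (tail_integral u) /\
  (\int[leb2]_(x in quadrant p) (tail_integral u x)%:E =
   (potential H (fun=> 1%N) p u)%:E)%E.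
Proof.
move=> bu tu0; have [C hC] := bu.2.
have bC := @bounded_measurable_cst R N C.
pose v t := C + u t; have bv : bounded_measurable v by exact: bounded_measurableD.
have v0 t : 0 <= v t by rewrite /v -lerBlDl sub0r; have := hC t; rewrite ler_norml => /andP[].
have C0 (t : T) : 0 <= C by apply: le_trans (hC t).
have uE : u = fun t => v t - C by apply/funext => t; rewrite /v addrC addKr.
have tE x : tail_integral u x = tail_integral v x - tail_integral (fun=> C) x.
  by rewrite [in LHS]uE tail_integralB.
have mI q : measurable_fun setT (fun x : R2 => \1_(quadrant q) x * tail_integral u x).
  have h := measurable_funB (measurable_indic_tail_integral q bv v0)
    (measurable_indic_tail_integral q bC C0).
  rewrite (_ : (fun x => _) = (fun x : R2 => \1_(quadrant q) x * tail_integral v x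
    - \1_(quadrant q) x * tail_integral (fun=> C) x))//.
  by apply/funext => x; rewrite tE mulrBr.
split.
  (* Measurability is known only after truncation to a quadrant; letting the quadrants exhaust the
     plane removes the truncation. *)
  apply: (@measurable_fun_cvg _ _ _ _ (fun n (x : R2) =>
    \1_(quadrant (fun=> - n%:R)) x * tail_integral u x)).
    by move=> n; exact: mI.
  move=> x _; apply: cvg_near_cst; near=> n.
  rewrite indicE mem_set ?mul1r//; apply/quadrantE.
  by split; rewrite ltrNl; near: n; exact: nbhs_infty_gtr.
have iv := ge0_integral_tail p bv v0; have iC := ge0_integral_tail p bC C0.
have mq := measurable_quadrant p.
have integ w : bounded_measurable w -> (forall t, 0 <= w t) ->
    leb2.-integrable (quadrant p) (EFin \o tail_integral w).
  move=> bw w0; apply/integrableP; split.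
    have /(measurable_restrictT _ mq) : measurable_fun setT
        ((EFin \o tail_integral w) \_ (quadrant p)).
      rewrite (_ : _ \_ _ = EFin \o (fun x : R2 => \1_(quadrant p) x * tail_integral w x)).
        by apply/measurable_EFinP; exact: measurable_indic_tail_integral.
      apply/funext => x; rewrite patchE/= indicE.
      by case: ifP => _; rewrite ?mul1r ?mul0r.
    by [].
  rewrite (_ : (fun x => _) = EFin \o tail_integral w).
    by rewrite ge0_integral_tail// ltry.
  apply/funext => x /=; rewrite ger0_norm//; apply: ball_integral_ge0 => t.
  by rewrite mulr_ge0// /kernel /tensor mulr_ge0// tpow_ge0.
transitivity (\int[leb2]_(x in quadrant p)
  ((tail_integral v x)%:E - (tail_integral (fun=> C) x)%:E))%E.
  by apply: eq_integral => x _; rewrite tE.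
rewrite (integralB (mu := leb2)) //; [|exact: integ..].
rewrite iv iC -EFinB; congr EFin.
rewrite /potential -ball_integralB; [|exact: kernel_bm..].
by congr ball_integral; apply/funext => t; rewrite /v; ring.
Unshelve. all: by end_near.
Qed.

End smooth_density.

(** * The image of a nonnegative weight has a smooth density *)

Section weighted_density.
Context {R : realType} {N : nat}.

Notation T := (N.-tuple (measurableTypeR R)).
Notation R2 := (measurableTypeR R * measurableTypeR R)%type.
Notation leb := (@lebesgue_measure R).
Notation leb2 := (@lebesgue_plane R).
Notation pm := (power_measure leb N).
Implicit Types (f g u v w : T -> R) (t : T) (b c : bool) (al : bool -> nat) (p : bool -> R).

Variables (H : bool -> 'I_N -> 'I_N -> R).
Hypothesis Hsym : forall b i j, H b i j = H b j i.
Variables (z : bool -> R) (kappa : R) (th : nat -> R -> R).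
Hypothesis kappa_gt0 : 0 < kappa.
Hypothesis kappa_le : forall t, sqn t != 0 -> kappa <= gram_det H t + dist2 H z t.
Hypothesis th_derive : forall m (x : R), is_derive x 1 (th m) (th m.+1 x).
Hypothesis th_neg : forall m (x : R), x <= 0 -> th m x = 0.
Hypothesis th_one : forall x : R, 1 <= x -> th 0 x = 1.
Hypothesis th_bounded : forall m, exists C : R, forall x, `|th m x| <= C.

Notation weight := (weight H z kappa th).
Notation potential := (potential H).

Let bmw u : weight u -> bounded_measurable u.
Proof. by move=> wu; apply: weight_bounded_measurable wu. Qed.

(** The mixed difference of quadrant masses is the mass of a rectangle: the kernel factors and both
    differences are nonnegative. *)
Let potential_mixed_ge0 p (h k : R) w : 0 <= h -> 0 <= k -> bounded_measurable w ->
  (forall t, 0 <= w t) ->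
  0 <= potential (fun=> 0%N) p w - potential (fun=> 0%N) (translate false k p) w
     - (potential (fun=> 0%N) (translate true h p) w
        - potential (fun=> 0%N) (translate false k (translate true h p)) w).
Proof.
move=> h0 k0 bw w0; rewrite /potential.
have bk q : bounded_measurable (fun t => kernel H (fun=> 0%N) q t * w t).
  by apply: bounded_measurableM => //; exact: kernel_bounded_measurable.
rewrite -!ball_integralB//; try exact: bounded_measurableB.
apply: ball_integral_ge0 => t.
pose a := tpow 0 (rayleigh H false t - p false).
pose a' := tpow 0 (rayleigh H false t - (p false + k)).
pose b := tpow 0 (rayleigh H true t - p true).
pose b' := tpow 0 (rayleigh H true t - (p true + h)).
rewrite (_ : _ - _ = (a - a') * (b - b') * w t); last first.
  by rewrite /kernel /tensor /translate /= /a /a' /b /b'; ring.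
rewrite mulr_ge0// mulr_ge0// subr_ge0 tpow_le// lerD2l lerN2 lerDl//.
Qed.

(* A second order mixed difference quotient of the mass of quadrants is nonnegative. *)
Let tail_integral_ge0 w u1 u p : weight u1 -> weight u -> bounded_measurable w ->
  (forall t, 0 <= w t) ->
  (forall al p, potential al p w = potential (increment false al) p u1) ->
  (forall al p, potential al p u1 = potential (increment true al) p u) ->
  0 <= potential (fun=> 0%N) p u.
Proof.
move=> wu1 wu bw w0 h1 h2.
have step (m : nat) : 0 <= potential (fun=> 0%N) p u1
    - potential (fun=> 0%N) (translate true m.+1%:R^-1 p) u1.
  pose D q (n : nat) := n.+1%:R * (potential (increment false (fun=> 0%N)) q u1
    - potential (increment false (fun=> 0%N)) (translate false n.+1%:R^-1 q) u1).
  have cD q : D q n @[n --> \oo] --> potential (fun=> 0%N) q u1.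
    exact: potential_quotient_cvg (bmw wu1).
  have c3 : D p n - D (translate true m.+1%:R^-1 p) n @[n --> \oo] -->
      potential (fun=> 0%N) p u1 - potential (fun=> 0%N) (translate true m.+1%:R^-1 p) u1.
    exact: cvgB (cD p) (cD _).
  rewrite -(cvg_lim _ c3)//; apply: limr_ge.
    by apply/cvg_ex; eexists; exact: c3.
  apply: nearW => n; rewrite /D -mulrBr mulr_ge0// -!h1.
  by apply: potential_mixed_ge0 => //; rewrite invr_ge0.
have c := @potential_quotient_cvg R N H true (fun=> 0%N) p u (bmw wu).
rewrite -(cvg_lim _ c)//; apply: limr_ge; first by apply/cvg_ex; eexists; exact: c.
by apply: nearW => n; rewrite -!h2 mulr_ge0.
Qed.

(** Transport once in each variable turns the mass of a quadrant into a potential of order (1, 1),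
    which is the integral over that quadrant of a potential of order (0, 0). The latter is the
    density; two more transports per variable exhibit it as a potential of order (2, 2). *)
Lemma weight_smooth_density w : weight w -> (forall t, 0 <= w t) ->
  exists2 u, weight u & forall B : set R2, measurable B ->
    (\int[pm]_(t in punctured_ball `&` rayleigh_map H @^-1` B) (w t)%:E =
     \int[leb \x leb]_(x in B) (potential2 H u x)%:E)%E.
Proof.
move=> ww w0.
have tr := potential_transport Hsym kappa_gt0 kappa_le th_derive th_neg th_one th_bounded.
have [u1 wu1 h1] := tr false w ww; have [u wu h2] := tr true u1 wu1.
have [u3 wu3 h3] := tr false u wu; have [u4 wu4 h4] := tr false u3 wu3.
have [u5 wu5 h5] := tr true u4 wu4; have [u6 wu6 h6] := tr true u5 wu5.
exists u6 => //.
have -> : potential2 H u6 = tail_integral H u.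
  by apply/funext => x; rewrite /tail_integral h3 h4 h5 h6.
(* Nonnegativity makes the candidate density define a measure [m2], to be compared with the image
   measure [m1] on quadrants. *)
have tail0 (x : R2) : 0 <= tail_integral H u x.
  exact: tail_integral_ge0 wu1 wu (bmw ww) w0 h1 h2.
have [mtail _] := integral_tail (H := H) (fun=> 0) (bmw wu) tail0.
have mtailE : measurable_fun setT (EFin \o tail_integral H u) by exact/measurable_EFinP.
have tailE0 x : (0 <= (EFin \o tail_integral H u) x)%E by rewrite lee_fin.
pose F t := (\1_(punctured_ball) t * w t)%:E.
have mF : measurable_fun setT F.
  apply/measurable_EFinP; apply: measurable_funM; last exact: (bmw ww).1.
  by apply: measurable_indic; exact: measurable_punctured_ball.
have F0 t : (0 <= F t)%E by rewrite lee_fin mulr_ge0.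
have mid : measurable_fun setT (id : R2 -> R2) by exact: measurable_id.
pose m1 := image_density pm (measurable_rayleigh_map H) mF F0.
pose m2 := image_density leb2 mid mtailE tailE0.
have m1q p : m1 (quadrant p) = (potential (fun=> 0%N) p w)%:E.
  rewrite /m1 /image_density integral_mkcond /potential.
  transitivity (\int[pm]_t (\1_(@punctured_ball R N) t * (kernel H (fun=> 0%N) p t * w t))%:E)%E.
    apply: eq_integral => t _; rewrite patchE /F.
    have tE (s y : R) : tpow 0 (s - y) = ((y < s)%R)%:R.
      by rewrite /tpow subr_gt0 expr0 divr1; case: ifP.
    rewrite /kernel /tensor !tE -natrM mulnb.
    case: ifPn => tq.
      have /quadrantE[/= -> ->] := set_mem tq.
      by rewrite mul1r.
    rewrite (_ : _ && _ = false) ?mul0r ?mulr0//.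
    apply/negbTE; apply: contra tq => /andP[q0 q1].
    by apply/mem_set/quadrantE.
  rewrite /ball_integral /Rintegral fineK; last first.
    apply: integrable_fin_num; first exact: measurable_punctured_ball.
    apply: bounded_measurable_integrable; apply: bounded_measurableM; last exact: bmw.
    exact: kernel_bounded_measurable.
  rewrite [RHS]integral_mkcond; apply: eq_integral => t _.
  by rewrite patchE indicE; case: ifP => _; rewrite ?mul1r ?mul0r.
have m12 : forall A, measurable A -> m1 A = m2 A.
  apply: quadrant_measure_unique => p; last first.
    by apply: (@le_lt_trans _ _ (potential (fun=> 0%N) p w)%:E); rewrite ?ltry// -m1q.
  transitivity (potential (fun=> 0%N) p w)%:E; first exact: m1q.
  rewrite h1 h2; apply/esym.
  exact: (integral_tail (H := H) p (bmw wu) tail0).2.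
move=> B mB; transitivity (m1 B); last exact: m12.
rewrite /m1 /image_density [RHS]integral_mkcond [LHS]integral_mkcond.
apply: eq_integral => t _; rewrite !patchE /F in_setI.
by rewrite indicE; case: (t \in punctured_ball) => //=; case: ifP; rewrite ?mul1r ?mul0r.
Qed.

End weighted_density.

(** * The numerical map *)

Section gram_determinant.
Context {R : realType} {N : nat}.

Notation T := (N.-tuple (measurableTypeR R)).
Implicit Types (t : T).

Lemma ratio_poly_ext (f : T -> R) t t' : ratio_poly f ->
  (forall i j, ratio i j t = ratio i j t') -> f t = f t'.
Proof. by move=> rf h; elim: rf => //= f1 f2 _ -> _ ->. Qed.

Variables (H : bool -> 'I_N -> 'I_N -> R).

Let W b i t := grad_field H b i t.

(** The squared length of a combination of the gradient fields as a quadratic form in the Gram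
    matrix. With x = -g01 and y = g00 it equals |u|^2 g00 [gram_det], which settles both the sign
    and the vanishing of the determinant. *)
Let combo_sum (x y : R) t : \sum_i (x * W false i t + y * W true i t) ^+ 2 =
  sqn t * (x ^+ 2 * gram H false false t + 2 * x * y * gram H false true t
           + y ^+ 2 * gram H true true t).
Proof.
have -> : sqn t * (x ^+ 2 * gram H false false t + 2 * x * y * gram H false true t
           + y ^+ 2 * gram H true true t) =
  x ^+ 2 * (sqn t * gram H false false t) + 2 * x * y * (sqn t * gram H false true t)
           + y ^+ 2 * (sqn t * gram H true true t) by ring.
rewrite !gram_grad_field !mulr_sumr -!big_split; apply: eq_bigr => i _ /=.
by rewrite -/(W false i t) -/(W true i t); ring.
Qed.

Let gram_ge0 b t : sqn t != 0 -> 0 <= gram H b b t.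
Proof.
move=> s0; have sp : 0 < sqn t by rewrite lt_def s0 sqn_ge0.
rewrite -(pmulr_rge0 _ sp) gram_grad_field; apply: sumr_ge0 => i _.
by rewrite -expr2 sqr_ge0.
Qed.

Let gram0 t : gram H false false t = 0 -> forall i, W false i t = 0.
Proof.
move=> g0 i; have := gram_grad_field H false false t; rewrite g0 mulr0 => /esym/eqP.
rewrite psumr_eq0; last by move=> j _; rewrite -expr2 sqr_ge0.
by move/allP/(_ i (mem_index_enum _)); rewrite -expr2 sqrf_eq0 => /eqP.
Qed.

Lemma gram_det_ge0 t : sqn t != 0 -> 0 <= gram_det H t.
Proof.
move=> s0; have sp : 0 < sqn t by rewrite lt_def s0 sqn_ge0.
have [g0|g0] := eqVneq (gram H false false t) 0.
  have gg : gram H false true t = 0.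
    apply: (mulfI s0); rewrite mulr0 gram_grad_field big1// => i _.
    by rewrite -/(W _ _ _) gram0// mul0r.
  by rewrite /gram_det g0 gg !mul0r subr0.
have gp : 0 < gram H false false t by rewrite lt_def g0 gram_ge0.
rewrite -(pmulr_rge0 _ gp) -(pmulr_rge0 _ sp).
have := combo_sum (- gram H false true t) (gram H false false t) t => h.
rewrite (_ : sqn t * _ = \sum_i (- gram H false true t * W false i t
    + gram H false false t * W true i t) ^+ 2).
  by apply: sumr_ge0 => i _; exact: sqr_ge0.
by rewrite h /gram_det; ring.
Qed.

Lemma gram_det_eq0 t : gram_det H t = 0 -> exists x y : R,
  x ^+ 2 + y ^+ 2 != 0 /\
  forall i, x * grad_field H false i t + y * grad_field H true i t = 0.
Proof.
move=> d0; have [g0|g0] := eqVneq (gram H false false t) 0.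
  exists 1, 0; split; first by rewrite expr1n expr0n/= addr0 oner_eq0.
  by move=> i; rewrite -/(W _ _ _) gram0// mulr0 mul0r addr0.
exists (- gram H false true t), (gram H false false t); split.
  by rewrite gt_eqF// ltr_wpDl ?sqr_ge0// lt_def sqrf_eq0 g0 sqr_ge0.
move=> i.
have := combo_sum (- gram H false true t) (gram H false false t) t.
rewrite (_ : sqn t * _ = sqn t * gram H false false t * gram_det H t); last first.
  by rewrite /gram_det; ring.
rewrite d0 mulr0 => /eqP; rewrite psumr_eq0; last by move=> j _; exact: sqr_ge0.
by move/allP/(_ i (mem_index_enum _)); rewrite sqrf_eq0 => /eqP.
Qed.

End gram_determinant.

(** * The numerical map as a pair of real quadratic forms *)

Section quadratic_map.
Context {R : realType} {n : nat}.
Variable A : 'M[R[i]]_n.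

Implicit Types (u v : 'rV[R]_(n + n)).

Definition component b (x : R[i]) : R := if b then complex.Im x else complex.Re x.

Lemma componentD b (x y : R[i]) : component b (x + y) = component b x + component b y.
Proof. by case: b x y => -[a b] [c d]. Qed.

Lemma componentZ b (a : R) (x : R[i]) : component b (a%:C%C * x) = a * component b x.
Proof.
by case: b x => -[c d] /=; rewrite /component/= mul0r ?subr0 ?addr0.
Qed.

Definition hform b u v : R := component b (inner (A *m cvec u) (cvec v)).

Lemma cvecD u v : cvec (u + v) = cvec u + cvec v.
Proof. by apply/matrixP => i j; rewrite !mxE. Qed.

Lemma cvecZ (a : R) u : cvec (a *: u) = a%:C%C *: cvec u.
Proof.
apply/matrixP => i j; rewrite !mxE.
by apply/eqP; rewrite eq_complex /= !mul0r subr0 addr0 !eqxx.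
Qed.

Lemma innerDl (x y z : 'cV[R[i]]_n) : inner (x + y) z = inner x z + inner y z.
Proof. by rewrite /inner mulmxDr mxE. Qed.

Lemma innerDr (x y z : 'cV[R[i]]_n) : inner z (x + y) = inner z x + inner z y.
Proof. by rewrite /inner linearD/= map_mxD mulmxDl mxE. Qed.

Lemma innerZl (a : R[i]) (x z : 'cV[R[i]]_n) : inner (a *: x) z = a * inner x z.
Proof. by rewrite /inner -scalemxAr mxE. Qed.

Lemma innerZr (a : R) (x z : 'cV[R[i]]_n) : inner z (a%:C%C *: x) = a%:C%C * inner z x.
Proof.
rewrite /inner linearZ/= map_mxZ -scalemxAl mxE; congr (_ * _).
by apply/eqP; rewrite eq_complex /= oppr0 !eqxx.
Qed.

Lemma hformDl b u v w : hform b (u + v) w = hform b u w + hform b v w.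
Proof. by rewrite /hform cvecD mulmxDr innerDl componentD. Qed.

Lemma hformDr b u v w : hform b w (u + v) = hform b w u + hform b w v.
Proof. by rewrite /hform cvecD innerDr componentD. Qed.

Lemma hformZl b a u w : hform b (a *: u) w = a * hform b u w.
Proof. by rewrite /hform cvecZ -scalemxAr innerZl componentZ. Qed.

Lemma hformZr b a u w : hform b w (a *: u) = a * hform b w u.
Proof. by rewrite /hform cvecZ innerZr componentZ. Qed.

Lemma hform_sum b u v : hform b u v =
  \sum_i \sum_j u 0 i * v 0 j * hform b (delta_mx 0 i) (delta_mx 0 j).
Proof.
have h0l w : hform b 0 w = 0 by rewrite -(scale0r (0 : 'rV[R]_(n + n))) hformZl mul0r.
have h0r w : hform b w 0 = 0 by rewrite -(scale0r (0 : 'rV[R]_(n + n))) hformZr mul0r.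
rewrite [in LHS](row_sum_delta u) [in LHS](row_sum_delta v).
rewrite (big_morph (fun x => hform b x _) (fun x y => hformDl b x y _) (h0l _)).
apply: eq_bigr => i _; rewrite hformZl.
rewrite (big_morph (fun x => hform b _ x) (fun x y => hformDr b x y _) (h0r _)).
by rewrite mulr_sumr; apply: eq_bigr => j _; rewrite hformZr mulrA.
Qed.

(** Symmetrizing leaves the quadratic form unchanged and supplies the symmetry on which the gradient
    formula rests. *)
Definition sym_matrix b (i j : 'I_(n + n)) : R :=
  (hform b (delta_mx 0 i) (delta_mx 0 j) + hform b (delta_mx 0 j) (delta_mx 0 i)) / 2.

Lemma sym_matrixC b i j : sym_matrix b i j = sym_matrix b j i.
Proof. by rewrite /sym_matrix addrC. Qed.

Lemma sym_matrix_hform b u v : \sum_i \sum_j sym_matrix b i j * (u 0 i * v 0 j) =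
  (hform b u v + hform b v u) / 2.
Proof.
rewrite (hform_sum b u v) (hform_sum b v u) [X in _ + X]exchange_big/=.
rewrite -big_split mulr_suml; apply: eq_bigr => i _ /=.
rewrite -big_split mulr_suml; apply: eq_bigr => j _ /=.
by rewrite /sym_matrix; ring.
Qed.

Lemma numerical_mapE u : numerical_map A u = (hform false u u, hform true u u).
Proof. by []. Qed.

Lemma inner_real u v : complex.Re (inner (cvec v) (cvec u)) = \sum_i v 0 i * u 0 i.
Proof.
rewrite /inner mxE (big_morph (@complex.Re R) (id1 := 0) (op1 := +%R)) => [|[a b] [c d]|]//.
rewrite [RHS]big_split_ord/= -big_split; apply: eq_bigr => i _ /=.
by rewrite !mxE/=; ring.
Qed.

Lemma hnormE u : hnorm (cvec u) = Num.sqrt (\sum_i u 0 i ^+ 2).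
Proof. by rewrite /hnorm inner_real. Qed.

(** Differentiability being known, the differential is read off from directional derivatives of each
    component; expanding the form along u + h v leaves the remainder h^2 [hform b v v]. *)
Lemma diff_numerical_map u v : 'd (numerical_map A) u v =
  (hform false u v + hform false v u, hform true u v + hform true v u).
Proof.
have dc b : is_derive u v (fun x => hform b x x) (hform b u v + hform b v u).
  apply: (@is_derive_quadratic _ _ _ _ _ _ `|hform b v v|) => h _.
  rewrite !(hformDl, hformDr, hformZl, hformZr).
  rewrite (_ : _ - _ = hform b v v * h ^+ 2); last by ring.
  by rewrite normrM [`|h ^+ 2|]ger0_norm ?sqr_ge0.
have df := differentiable_numerical_map A u.
have := diff_derivable (v := v) df; rewrite /derivable => cf.
rewrite -deriveE//.
have c0 : h^-1 *: (numerical_map A (h *: v + u) - numerical_map A u) @[h --> 0^'] -->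
   'D_v (numerical_map A) u by exact: cf.
have f0 b : h^-1 *: (hform b (h *: v + u) (h *: v + u) - hform b u u) @[h --> 0^'] -->
   hform b u v + hform b v u.
  by have [cb <-] := dc b; exact: cb.
have c1 : (h^-1 *: (numerical_map A (h *: v + u) - numerical_map A u)).1 @[h --> 0^'] -->
    ('D_v (numerical_map A) u).1 by apply: (cvg_comp _ fst c0); exact: cvg_fst.
have c2 : (h^-1 *: (numerical_map A (h *: v + u) - numerical_map A u)).2 @[h --> 0^'] -->
    ('D_v (numerical_map A) u).2 by apply: (cvg_comp _ snd c0); exact: cvg_snd.
rewrite [LHS]surjective_pairing; congr pair.
  by have := cvg_unique _ c1 (f0 false); apply.
by have := cvg_unique _ c2 (f0 true); apply.
Qed.

End quadratic_map.

(** * The numerical measure as an image of Lebesgue measure, and the constant [kappa] *)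

Section numerical_measure_density.
Context {R : realType} {n : nat}.
Variable A : 'M[R[i]]_n.

Notation T := ((n + n).-tuple (measurableTypeR R)).
Notation R2 := (measurableTypeR R * measurableTypeR R)%type.
Notation pm := (power_measure (@lebesgue_measure R) (n + n)).
Notation H := (sym_matrix A).
Implicit Types (u v : 'rV[R]_(n + n)) (t : T).

Let tuple_of_row u : T := [tuple (u 0 i : measurableTypeR R) | i < n + n].

Let coord_row u i : coord i (tuple_of_row u) = u 0 i.
Proof. by rewrite /coord tnth_mktuple. Qed.

Let row_of_tuple t : 'rV[R]_(n + n) := \row_i tnth t i.

Let row_of_tupleK t : tuple_of_row (row_of_tuple t) = t.
Proof. by apply: eq_from_tnth => i; rewrite tnth_mktuple mxE. Qed.

Let sqn_row u : sqn (tuple_of_row u) = \sum_i u 0 i ^+ 2.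
Proof. by apply: eq_bigr => i _; rewrite coord_row. Qed.

Let hnorm_row u : hnorm (cvec u) = Num.sqrt (sqn (tuple_of_row u)).
Proof. by rewrite hnormE sqn_row. Qed.

Let unit_sphereE u : unit_sphere u <-> sqn (tuple_of_row u) = 1.
Proof.
rewrite /unit_sphere /= hnorm_row; split => [h|->]; last by rewrite sqrtr1.
by rewrite -(sqr_sqrtr (sqn_ge0 _)) h expr1n.
Qed.

Let rayleigh_row b u : rayleigh H b (tuple_of_row u) = hform A b u u / sqn (tuple_of_row u).
Proof.
have := sym_matrix_hform A b u u => h.
rewrite (_ : hform A b u u = (hform A b u u + hform A b u u) / 2); last by field.
rewrite -h mulr_suml; apply: eq_bigr => i _; rewrite mulr_suml; apply: eq_bigr => j _.
by rewrite /ratio !coord_row mulrA.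
Qed.

(** For v tangent at u the radial correction in [grad_coef] drops out, leaving the differential of
    the numerical map. *)
Let grad_row b u v : sqn (tuple_of_row u) = 1 -> \sum_i v 0 i * u 0 i = 0 ->
  \sum_i grad_field H b i (tuple_of_row u) * v 0 i = hform A b u v + hform A b v u.
Proof.
move=> u1 uv.
have := sym_matrix_hform A b v u => h.
transitivity (2 * (\sum_i \sum_j sym_matrix A b i j * (v 0 i * u 0 j))
  + (- 2 * rayleigh H b (tuple_of_row u)) *
    \sum_i \sum_j (i == j)%:R * (v 0 i * u 0 j)); last first.
  rewrite h (_ : \sum_i \sum_j (i == j)%:R * (v 0 i * u 0 j) = 0); first by field.
  rewrite -[RHS]uv; apply: eq_bigr => i _.
  rewrite (bigD1 i)//= eqxx mul1r big1 ?addr0// => j.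
  by rewrite eq_sym => /negPf ->; rewrite mul0r.
rewrite -sum2_linear; apply: eq_bigr => i _; rewrite /grad_field mulr_suml.
apply: eq_bigr => j _; rewrite coord_row /grad_coef; ring.
Qed.

(** A linear relation (x, y) between the gradients confines the image of the tangent space to the
    line orthogonal to (x, y); were (x, y) itself attained, x^2 + y^2 would be 0. *)
Lemma critical_point_gram_det u : unit_sphere u -> gram_det H (tuple_of_row u) = 0 ->
  critical_point A u.
Proof.
move=> su d0; split => // onto; have u1 := (unit_sphereE u).1 su.
have [x [y [xy h]]] := gram_det_eq0 d0.
have : [set: R * R] (x, y) by [].
rewrite -onto => -[v]; rewrite /tangent /= inner_real => uv.
rewrite diff_numerical_map -!grad_row// => -[vx vy].
have : x * x + y * y = 0.
  rewrite -{2}vx -{2}vy !mulr_sumr -big_split big1// => i _ /=.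
  by rewrite !mulrA -mulrDl h mul0r.
by move/eqP; rewrite -!expr2 (negPf xy).
Qed.

(** By degree 0 the cone over the part of the sphere mapped into B is the part of the punctured ball
    mapped into B by the Rayleigh quotients. Only the sign of K matters later, so the area of the
    sphere is never computed. *)
Lemma numerical_measureE : exists2 K : R, 0 <= K & forall B : set (R * R),
  numerical_measure A B = (K%:E * pm (@punctured_ball R (n + n) `&` rayleigh_map H @^-1` B))%E.
Proof.
pose c := (fine (surface_measure (@unit_sphere R n)))^-1.
have c0 : 0 <= c.
  rewrite invr_ge0; apply: fine_ge0; apply: mule_ge0 => //.
exists ((n + n)%:R * c); first by rewrite mulr_ge0.
move=> B; rewrite /numerical_measure /sphere_probability /surface_measure -/c.
rewrite [LHS]muleC muleA -EFinM [(_ * c)%R]mulrC; congr (_ * _)%E.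
rewrite /lebesgue_rV; congr (pm _); apply/seteqP.
have key t : 0 < sqn t -> numerical_map A ((hnorm (cvec (row_of_tuple t)))^-1 *: row_of_tuple t)
    = rayleigh_map H t.
  have rE b : rayleigh H b t = hform A b (row_of_tuple t) (row_of_tuple t) / sqn t.
    by rewrite -[X in rayleigh H b X](row_of_tupleK t) rayleigh_row row_of_tupleK.
  move=> s0; rewrite numerical_mapE /rayleigh_map !rE.
  rewrite !(hformZl, hformZr) hnorm_row row_of_tupleK.
  have e x : (Num.sqrt (sqn t))^-1 * ((Num.sqrt (sqn t))^-1 * x) = x / sqn t.
    by rewrite mulrA -invfM -expr2 sqr_sqrtr ?sqn_ge0// mulrC.
  by rewrite !e.
have sqn1 t : (0 < hnorm (cvec (row_of_tuple t)) <= 1) = (0 < sqn t <= 1).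
  rewrite hnorm_row row_of_tupleK sqrtr_gt0.
  by rewrite -[X in _ && (_ <= X)]sqrtr1 ler_sqrt.
split => t /=.
  rewrite /cone /= -/(row_of_tuple t) sqn1 => -[tb [_ tB]]; split => //.
  by rewrite -key//; case/andP: tb.
move=> [tb tB]; have s0 : 0 < sqn t by case/andP: tb.
rewrite /cone /= -/(row_of_tuple t) sqn1; split => //; split; last by rewrite key.
apply/unit_sphereE; rewrite sqn_row.
under eq_bigr do rewrite mxE exprMn.
rewrite -mulr_sumr -sqn_row row_of_tupleK hnorm_row row_of_tupleK exprVn sqr_sqrtr ?sqn_ge0//.
by rewrite mulVf// gt_eqF.
Qed.

Let coord_cont u i : {for u, continuous (fun v => coord i (tuple_of_row v))}.
Proof.
rewrite (_ : (fun v => _) = fun v : 'rV[R]_(n + n) => v 0 i); first exact: coord_continuous.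
by apply/funext => v; rewrite coord_row.
Qed.

Let sqn_cont : continuous (fun v => sqn (tuple_of_row v)).
Proof.
rewrite (_ : (fun v => _) = fun v => \sum_i coord i (tuple_of_row v) * coord i (tuple_of_row v)).
  apply: continuous_big => [|i _ u]; first exact: add_continuous.
  exact: (@continuousM _ _ (fun v => coord i (tuple_of_row v))
    (fun v => coord i (tuple_of_row v)) u (@coord_cont u i) (@coord_cont u i)).
by apply/funext => v; apply: eq_bigr => i _; rewrite expr2.
Qed.

Let ratio_poly_cont f u : ratio_poly f -> sqn (tuple_of_row u) != 0 ->
  {for u, continuous (fun v => f (tuple_of_row v))}.
Proof.
move=> rf u0; elim: rf => [i j|c|f1 f2 _ h1 _ h2|f1 f2 _ h1 _ h2].
- apply: continuousM; first by apply: continuousM; exact: coord_cont.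
  by apply: continuousV => //; exact: sqn_cont.
- exact: cst_continuous.
- exact: continuousD.
- exact: continuousM.
Qed.

Let compact_sphere : compact (@unit_sphere R n).
Proof.
apply: bounded_closed_compact.
  exists 1; split; first exact: num_real.
  move=> x x1 u /unit_sphereE u1; apply: le_trans (ltW x1).
  rewrite /Num.norm/=.
  have [->//|/mx_norm_neq0[i ->]] := eqVneq (mx_norm u) 0.
  have := coord_sqn i.2 (tuple_of_row u); rewrite u1 coord_row (ord1 i.1) => h.
  by rewrite -(@ler_pXn2r _ 2) ?nnegrE// real_normK ?num_real// expr1n.
rewrite (_ : @unit_sphere R n = (fun v => sqn (tuple_of_row v)) @^-1` [set x | x = 1]).
  by apply: preimage_closed; [move=> ? _; exact: sqn_cont|exact: closed_eq].
by apply/seteqP; split => u /unit_sphereE.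
Qed.

Hypothesis n_gt0 : (0 < n)%N.

(* On the sphere the continuous function gram_det + dist2 vanishes only at critical
   points in the fibre, so it has a positive minimum; it is homogeneous of degree 0. *)
Lemma gram_det_dist2_ge (z : R * R) : ~ critical_values A z ->
  exists2 kappa : R, 0 < kappa & forall t, sqn t != 0 ->
    kappa <= gram_det H t + dist2 H (point z) t.
Proof.
move=> zc; pose f t := gram_det H t + dist2 H (point z) t.
have rf : ratio_poly f by apply: ratio_polyD; [exact: gram_det_poly|exact: dist2_poly].
have [u su umin] : exists2 u, u \in @unit_sphere R n & forall v, v \in @unit_sphere R n ->
    f (tuple_of_row u) <= f (tuple_of_row v).
  apply: EVT_min_rV.
  (* A minimum requires a nonempty sphere; n > 0 provides a basis vector. *)
  - have i0 : 'I_(n + n) by exists 0%N; rewrite addn_gt0 n_gt0.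
    exists (delta_mx 0 i0); apply/unit_sphereE; rewrite sqn_row (bigD1 i0)//= big1.
      by rewrite mxE !eqxx expr1n addr0.
    by move=> j /negPf ji; rewrite mxE ji andbF expr0n.
  - exact: compact_sphere.
  - apply: continuous_in_subspaceT => u; rewrite inE => /unit_sphereE u1.
    by apply: ratio_poly_cont => //; rewrite u1 oner_neq0.
have {}su := set_mem su; have u1 := (unit_sphereE u).1 su.
have u0 : sqn (tuple_of_row u) != 0 by rewrite u1 oner_neq0.
have d0 := gram_det_ge0 H u0.
have e0 : 0 <= dist2 H (point z) (tuple_of_row u) by rewrite addr_ge0 ?sqr_ge0.
exists (f (tuple_of_row u)).
  rewrite lt_def addr_ge0// andbT; apply/negP; rewrite paddr_eq0// => /andP[/eqP g0 dz].
  apply: zc; exists u; first exact: critical_point_gram_det.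
  move: dz; rewrite /dist2 paddr_eq0 ?sqr_ge0// !sqrf_eq0 !subr_eq0 !rayleigh_row u1 !divr1.
  by move=> /andP[/eqP h1 /eqP h2]; rewrite numerical_mapE h1 h2 -surjective_pairing.
move=> t t0; have tp : 0 < sqn t by rewrite lt_def t0 sqn_ge0.
(* The radial projection of t has the same ratios, so the bound on the sphere transfers. *)
pose v := (Num.sqrt (sqn t))^-1 *: row_of_tuple t.
have v1 : sqn (tuple_of_row v) = 1.
  rewrite sqn_row /v; under eq_bigr do rewrite mxE exprMn.
  by rewrite -mulr_sumr -sqn_row row_of_tupleK exprVn sqr_sqrtr ?sqn_ge0// mulVf.
rewrite -/(f t) (@ratio_poly_ext _ _ f t (tuple_of_row v) rf).
  by apply: umin; apply/mem_set/unit_sphereE.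
move=> i j; rewrite /ratio v1 divr1 !coord_row /v !mxE.
rewrite mulrACA -invfM -expr2 sqr_sqrtr ?sqn_ge0//.
by rewrite mulrC.
Qed.

End numerical_measure_density.

Theorem lemma2p3 (R : realType) (n : nat) (n_gt0 : (0 < n)%N)
    (A : 'M[R[i]]_n) :
  sing_supp (numerical_measure A) `<=` critical_values A.
Proof.
move=> z zS; apply: contrapT => zc; apply: zS.
have [kappa kappa_gt0 kappa_le] := gram_det_dist2_ge n_gt0 zc.
have [th [th_derive th_neg th_one th_ge0 th_bounded]] := @smooth_step_exists R.
have [K K0 muE] := numerical_measureE A.
pose H := sym_matrix A.
(* On this disc [cut_arg] >= 1, so the cutoff is 1 and the weight [w] is the constant K: for B
   inside U the weighted image measure is the numerical measure. *)
pose U := [set x : R * R | (x.1 - z.1) ^+ 2 + (x.2 - z.2) ^+ 2 < kappa / 4].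
pose w t := K * weight_gen H (point z) kappa th 0 0 t.
have ww : weight H (point z) kappa th w by apply: weightZ; exact: weight_generator.
have w0 t : 0 <= w t.
  by rewrite mulr_ge0// /weight_gen expr0 mulr1 th_ge0.
have [u wu hu] := weight_smooth_density (sym_matrixC A) kappa_gt0 kappa_le th_derive th_neg
  th_one th_bounded ww w0.
exists U; last by rewrite /U /= !subrr expr0n addr0 divr_gt0.
split.
  rewrite (_ : U = (fun x : R * R => (x.1 - z.1) ^+ 2 + (x.2 - z.2) ^+ 2) @^-1`
    [set y | y < kappa / 4])//.
  apply: open_comp; last exact: open_lt.
  move=> x _.
  have c1 : {for x, continuous (fun x : R * R => x.1 - z.1)}.
    by apply: cvgB; [exact: cvg_fst|exact: cvg_cst].
  have c2 : {for x, continuous (fun x : R * R => x.2 - z.2)}.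
    by apply: cvgB; [exact: cvg_snd|exact: cvg_cst].
  have := @continuousD _ _ _ _ _ _ (@continuousM _ _ _ _ x c1 c1) (@continuousM _ _ _ _ x c2 c2).
  exact.
exists (potential2 H u).
  have sm := potential2_smooth (sym_matrixC A) kappa_gt0 kappa_le th_derive th_neg
    th_one th_bounded wu.
  by move=> s x _; exact: sm.
move=> B mB BU; rewrite -hu// muE.
set X := punctured_ball `&` _.
have mX : measurable X.
  apply: measurableI; first exact: measurable_punctured_ball.
  by rewrite -[X in measurable X]setTI; exact: measurable_rayleigh_map.
rewrite -integral_cst//; apply: eq_integral => t /set_mem[_ tB].
have tU := BU _ tB.
rewrite /w /weight_gen expr0 mulr1 th_one ?mulr1//.
rewrite /cut_arg.
have d4 : dist2 H (point z) t < kappa / 4 by exact: tU.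
have : 4 / kappa * dist2 H (point z) t <= 1.
  rewrite mulrAC ler_pdivrMr// mul1r; lra.
rewrite !mulNr; lra.
Qed.
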